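(* Let $0<p<\infty$, $K\ge1$, $L\ge1$, and $\alpha,\beta>1$. There exists a constant $A=A(p,L,\alpha,\beta)<\infty$ such that every $f\in\mathcal S^p_{K,L}(\alpha,\beta)$ and every convex curve $\Gamma\subset\mathbb D$ satisfy $$\int_\Gamma|f(z)|^p\,ds(z)\le A\int_{\mathbb T}|f^*(\xi)|^p\,|d\xi|.$$
   Context: $\mathbb D=\{z\in\mathbb C:|z|<1\}$, $\mathbb T=\partial\mathbb D$, $|d\xi|$ is arclength measure on $\mathbb T$, and $ds$ is arclength. The analytic Hardy space $H^p$ consists of all analytic $g$ in $\mathbb D$ with $\sup_{0<r<1}\int_{\mathbb T}|g(r\zeta)|^p\,|d\zeta|<\infty$. For $\alpha>1$, $\xi\in\mathbb T$, the Stolz cone is $\Gamma_\alpha(\xi)=\{z\in\mathbb D:|z-\xi|<\alpha(1-|z|)\}$. $f^*(\xi)=\lim_{z\to\xi,\,z\in\Gamma_\alpha(\xi)}f(z)$ denotes the non-tangential boundary function of $f$, defined for a.e. $\xi\in\mathbb T$. The controlled bi-Lipschitz Stoilow class $\mathcal S^p_{K,L}(\alpha,\beta)$ consists of all $f=g\circ\phi$ where $g\in H^p$, $\phi:\mathbb D\to\mathbb D$ is $K$-quasiconformal, the boundary extension $\phi|_{\mathbb T}$ (a homeomorphism of $\mathbb T$) is $L$-bi-Lipschitz with respect to arclength on $\mathbb T$, and $\phi(\Gamma_\alpha(\xi))\subset\Gamma_\beta(\phi(\xi))$ for all $\xi\in\mathbb T$. The notation $A(p,L,\alpha,\beta)$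 means that the constant depends only on the listed parameters. A convex curve means a simple rectifiable arc, or a closed rectifiable curve, contained in the boundary of a convex subset of $\mathbb D$; line segments are allowed. Repeated parametrizations are excluded: the relevant measure is arclength on the trace. *)

(* Defs.v *)
From HB Require Import structures.
From mathcomp Require Import all_boot all_order all_algebra.
From mathcomp Require Import all_classical all_reals all_analysis.
From mathcomp Require Import complex.

Set Implicit Arguments.
Unset Strict Implicit.
Unset Printing Implicit Defensive.

Import Order.TTheory GRing.Theory Num.Theory.
Import numFieldNormedType.Exports.

Local Open Scope classical_set_scope.
Local Open Scope ring_scope.
Local Open Scope complex_scope.

(* The library puts the norm topology on [K^o] for a [numFieldType] [K]; the
   norm `|z| of z : Cplx R is itself complex-valued, so the real-valued modulus is
   [cmod z]. *)
Notation Cplx R := ((R[i])^o).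

Section Disk.
Context {R : realType}.
Local Notation C := (Cplx R).

Definition cmod (z : C) : R := ComplexField.Normc.normc z.

Definition unit_disk : set C := [set z | cmod z < 1].
Definition unit_circle : set C := [set z | cmod z = 1].
Definition closed_disk : set C := [set z | cmod z <= 1].

Definition stolz (alpha : R) (xi : C) : set C :=
  [set z | unit_disk z /\ cmod (z - xi) < alpha * (1 - cmod z)].

Definition circle_pt (t : R) : C := cos t +i* sin t.

Definition circle_integral (h : C -> R) : \bar R :=
  (\int[@lebesgue_measure R]_(t in `[0%R, (2 * pi)%R]) (h (circle_pt t))%:E)%E.

(* [lim] is total, with an arbitrary value at the points xi where the
   non-tangential limit does not exist. *)
Definition nt_boundary (alpha : R) (f : C -> C) (xi : C) : C :=
  lim (f z @[z --> within (stolz alpha xi) (nbhs xi)]).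

(* Complex derivability: the scalars of [Cplx R] are R[i]. *)
Definition analytic_in (A : set C) (g : C -> C) : Prop :=
  forall z, A z -> derivable g z 1.

Definition hardy_sup (p : R) (g : C -> C) : \bar R :=
  ereal_sup [set circle_integral (fun zeta => cmod (g (r%:C * zeta)) `^ p)
            | r in [set r : R | 0 < r < 1]].

Definition hardy (p : R) (g : C -> C) : Prop :=
  analytic_in unit_disk g /\
  (hardy_sup p g < +oo)%E.

End Disk.

Section Quasiconformal.
Context {R : realType}.
Local Notation C := (Cplx R).

Definition homeomorphism_between (A B : set C) (phi : C -> C) : Prop :=
  [/\ {within A, continuous phi}, phi @` A `<=` B &
      exists psi : C -> C,
        [/\ {within B, continuous psi}, psi @` B `<=` A,
            {in A, cancel phi psi} & {in B, cancel psi phi}]].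

(* The finitely many disjoint intervals [I.1, I.2] are listed from left to
   right. *)
Definition abs_continuous (a b : R) (h : R -> C) : Prop :=
  forall e : R, 0 < e -> exists2 d : R, 0 < d &
    forall s : seq (R * R),
      (forall I, I \in s -> [/\ a <= I.1, I.1 <= I.2 & I.2 <= b]) ->
      pairwise (fun I J => I.2 <= J.1) s ->
      \sum_(I <- s) (I.2 - I.1) < d ->
      \sum_(I <- s) cmod (h I.2 - h I.1) < e.

Definition abs_continuous_on_lines (A : set C) (phi : C -> C) : Prop :=
  forall a b c d : R, a <= b -> c <= d ->
    (forall x y, a <= x <= b -> c <= y <= d -> A (x +i* y)) ->
    {ae @lebesgue_measure R, forall y, c <= y <= d ->
       abs_continuous a b (fun x => phi (x +i* y))} /\
    {ae @lebesgue_measure R, forall x, a <= x <= b ->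
       abs_continuous c d (fun y => phi (x +i* y))}.

(* Partial derivatives in the two real directions. They are total functions;
   they are genuine derivatives a.e. on A when phi is absolutely continuous on
   lines in A. *)
Definition partial_x (phi : C -> C) (x y : R) : C :=
  derive1 (fun t : R => complex.Re (phi (t +i* y))) x
  +i* derive1 (fun t : R => complex.Im (phi (t +i* y))) x.

Definition partial_y (phi : C -> C) (x y : R) : C :=
  derive1 (fun t : R => complex.Re (phi (x +i* t))) y
  +i* derive1 (fun t : R => complex.Im (phi (x +i* t))) y.

Definition wirtinger (phi : C -> C) (x y : R) : C :=
  (partial_x phi x y - 'i%C * partial_y phi x y) / 2.

Definition wirtinger_bar (phi : C -> C) (x y : R) : C :=
  (partial_x phi x y + 'i%C * partial_y phi x y) / 2.

(* The analytic definition (Ahlfors): a homeomorphism which is absolutely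
   continuous on lines and satisfies
   |phi_zbar| <= (K - 1) / (K + 1) |phi_z| a.e. *)
Definition quasiconformal (K : R) (A B : set C) (phi : C -> C) : Prop :=
  [/\ homeomorphism_between A B phi,
      abs_continuous_on_lines A phi &
      {ae (@lebesgue_measure R \x @lebesgue_measure R)%E, forall w,
         A (w.1 +i* w.2) ->
         cmod (wirtinger_bar phi w.1 w.2)
           <= (K - 1) / (K + 1) * cmod (wirtinger phi w.1 w.2)}].

End Quasiconformal.

Section Stoilow.
Context {R : realType}.
Local Notation C := (Cplx R).

Definition arc_dist (xi eta : C) : R :=
  inf [set `|st.1 - st.2| | st in
        [set st : R * R | circle_pt st.1 = xi /\ circle_pt st.2 = eta]].

Definition circle_bilipschitz (L : R) (phi : C -> C) : Prop :=
  forall xi eta, unit_circle xi -> unit_circle eta ->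
    L^-1 * arc_dist xi eta <= arc_dist (phi xi) (phi eta)
      <= L * arc_dist xi eta.

(* phi is given on the closed disk; its values on the unit circle are those of
   the boundary extension. *)
Definition stoilow_class (p K L alpha beta : R) (f : C -> C) : Prop :=
  exists g phi : C -> C,
  [/\ hardy p g,
      quasiconformal K unit_disk unit_disk phi,
      {within closed_disk, continuous phi} /\
        homeomorphism_between unit_circle unit_circle phi,
      circle_bilipschitz L phi /\
        (forall xi, unit_circle xi ->
           phi @` stolz alpha xi `<=` stolz beta (phi xi)) &
      forall z, unit_disk z -> f z = g (phi z)].

End Stoilow.

Section Curves.
Context {R : realType}.
Local Notation C := (Cplx R).

Definition curve_length (gamma : R -> C) (a b : R) : \bar R :=
  ereal_sup [set (\sum_(0 <= k < size s)
      cmod (gamma (nth b (a :: s) k.+1) - gamma (nth b (a :: s) k)))%:E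
    | s in itv_partition a b].

Definition simple_arc (gamma : R -> C) (a b : R) : Prop :=
  {in `[a, b] &, injective gamma}.

Definition simple_closed (gamma : R -> C) (a b : R) : Prop :=
  gamma a = gamma b /\ {in `[a, b[ &, injective gamma}.

(* The point of the curve at arclength u from gamma a. *)
Definition arclength_pt (gamma : R -> C) (a b u : R) : C :=
  gamma (xget a [set t | a <= t <= b /\ curve_length gamma a t = u%:E]).

Definition curve_integral (gamma : R -> C) (a b : R) (h : C -> R) : \bar R :=
  (\int[@lebesgue_measure R]_(u in `[0%R, fine (curve_length gamma a b)])
     (h (arclength_pt gamma a b u))%:E)%E.

(* The curve is traversed once, so that [curve_integral] is the integral
   against arclength on the trace; a = b gives a single point. *)
Definition convex_curve (gamma : R -> C) (a b : R) : Prop :=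
  [/\ a <= b,
      {within `[a, b], continuous gamma},
      (curve_length gamma a b < +oo)%E,
      simple_arc gamma a b \/ simple_closed gamma a b &
      exists E : set C,
        [/\ convex_set E, E `<=` unit_disk &
            gamma @` `[a, b] `<=` closure E `\` interior E]].

End Curves.

(* Main.v *)
Require Import Defs.
From HB Require Import structures.
From mathcomp Require Import all_boot all_order all_algebra.
From mathcomp Require Import all_classical all_reals all_analysis.
From mathcomp Require Import measurable_realfun complex ring lra.

(** Let f = g o phi. The cone hypothesis sends a Stolz cone at xi into one at
    phi(xi), so on the cone at xi the function |f|^p is at most N(phi(xi)), where
    N is the non-tangential maximal function of |g|^p. The theorem follows from
    three estimates.

    The integral of |f|^p over a convex curve is at most a constant times the
    integral of N over the circle ([convex_curve_bound]). Consider the lines at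
    distance at most kap from the origin that are orthogonal to a direction e.
    For small kap, every point of the disk on such a line lies in the Stolz cone
    of one of the two points where the line leaves the disk ([exit_stolz]). A line
    with points of the curve strictly on both sides meets the curve at most twice,
    for then the middle one of three boundary points on the line would be interior
    to the convex set ([two_boundary_points]). Hence, on each line, the sum of
    |f|^p over the crossings is controlled by N at two points of the circle. The
    angle of phi at the exit point expands in the height of the line, as phi is
    bi-Lipschitz, so integrating over the heights gives the integral of N
    ([direction_bound]). Finitely many directions e see every short chord of the
    curve transversally ([direction_net]), and chord sums exhaust the arclength
    integral ([curve_integral_le]).

    The integral of N is at most a constant times the integral of |g*|^p
    ([hardy_ntmax]). Since |g|^(p/2) is subharmonic, its dilates lie below the
    Poisson integrals of their values on the circle ([norm_powR_poisson]), and it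
    suffices to bound the maximal function of Poisson integrals in L2. By
    linearisation this is a bound for a positive operator T, and T T* is easy to
    estimate because the inner product of two Poisson kernels is again a value of
    a Poisson kernel ([TTstar_bound]). Passing from circles of radius r < 1 to the
    boundary needs the existence of g* almost everywhere ([cntlim_hardy]). For
    real parts bounded in quadratic mean it follows from the same maximal
    inequality ([ntlim_L2]). In general |g|^(p/2) has a majorant Re U of that kind
    ([hardy_majorant]); then g / (1 + U)^n is bounded for large n, so that both
    this quotient and 1 + U have limits, and hence g does.

    The integral of |g*|^p is at most a constant times the integral of
    |g* o phi|^p because the angle of the inverse of phi expands
    ([boundary_transport]), and g* o phi is the boundary function of f
    ([nt_boundary_comp]).

    The function theory rests on Goursat's argument, carried out in polar
    coordinates so that only integrals over intervals occur ([goursat]). *)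

Set Implicit Arguments.
Unset Strict Implicit.
Unset Printing Implicit Defensive.

Import Order.TTheory GRing.Theory Num.Theory.
Import numFieldNormedType.Exports.

Local Open Scope classical_set_scope.
Local Open Scope ring_scope.
Local Open Scope complex_scope.

(** * Integrals of bounded measurable functions on an interval *)

Section RealIntegral.
Context {R : realType}.
Implicit Types (a b : R) (f g : R -> R).

(** Real-valued integrals of bounded measurable functions [bmf] on [a, b]:
    this class is closed under the algebraic operations, so that integrability
    never has to be discussed separately. *)
Definition ri a b f : R := (\int[@lebesgue_measure R]_(t in `[a, b]) f t)%R.

Definition bmf a b f :=
  measurable_fun `[a, b] f /\ exists M, forall t, a <= t <= b -> `|f t| <= M.

Lemma bmf_integrable a b f : bmf a b f ->
  (@lebesgue_measure R).-integrable `[a, b] (EFin \o f).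
Proof.
move=> [mf [M fM]]; apply: measurable_bounded_integrable => //.
  by rewrite /= lebesgue_measure_itv /=; case: ifP => // _; rewrite -EFinB ltry.
exists M; split; first exact: num_real.
move=> y My x /= /[!in_itv]/= abx; exact: le_trans (fM _ abx) (ltW My).
Qed.

Lemma bmf_cst a b (k : R) : bmf a b (fun=> k).
Proof. by split; [exact: measurable_cst | exists `|k|]. Qed.

Lemma bmfD a b f g : bmf a b f -> bmf a b g -> bmf a b (fun t => f t + g t).
Proof.
move=> [mf [M fM]] [mg [N gN]]; split; first exact: measurable_funD.
exists (M + N) => t h; apply: (le_trans (ler_normD _ _)); apply: lerD; auto.
Qed.

Lemma bmfM a b f g : bmf a b f -> bmf a b g -> bmf a b (fun t => f t * g t).
Proof.
move=> [mf [M fM]] [mg [N gN]]; split; first exact: measurable_funM.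
by exists (M * N) => t h; rewrite normrM; apply: ler_pM => //; auto.
Qed.

Lemma bmfZ a b (k : R) f : bmf a b f -> bmf a b (fun t => k * f t).
Proof. by move=> hf; apply: bmfM => //; exact: bmf_cst. Qed.

Lemma bmfN a b f : bmf a b f -> bmf a b (fun t => - f t).
Proof. by move=> /(bmfZ (-1)); under eq_fun do rewrite mulN1r. Qed.

Lemma bmfB a b f g : bmf a b f -> bmf a b g -> bmf a b (fun t => f t - g t).
Proof. by move=> hf /bmfN; exact: bmfD. Qed.

Lemma bmf_norm a b f : bmf a b f -> bmf a b (fun t => `|f t|).
Proof.
move=> [mf [M fM]]; split; first exact: measurableT_comp.
by exists M => t h; rewrite normr_id; exact: fM.
Qed.

Lemma bmfX a b f n : bmf a b f -> bmf a b (fun t => f t ^+ n).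
Proof.
move=> hf; elim: n => [|n IH].
  by under eq_fun do rewrite expr0; exact: bmf_cst.
by under eq_fun do rewrite exprS; exact: bmfM.
Qed.

Lemma bmf_sum a b (I : Type) (s : seq I) (F : I -> R -> R) :
  (forall i, bmf a b (F i)) -> bmf a b (fun t => \sum_(i <- s) F i t).
Proof.
move=> hF; elim: s => [|i s IH].
  by under eq_fun do rewrite big_nil; exact: bmf_cst.
by under eq_fun do rewrite big_cons; exact: bmfD.
Qed.

Lemma bmf_indic a b (A : set R) : measurable A -> bmf a b (\1_A).
Proof.
move=> mA; split; first exact: measurable_indic.
by exists 1 => t _; rewrite indicE; case: (t \in A); rewrite ?normr1 ?normr0.
Qed.

Lemma riD a b f g : bmf a b f -> bmf a b g ->
  ri a b (fun t => f t + g t) = ri a b f + ri a b g.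
Proof. by move=> hf hg; apply: RintegralD => //; exact: bmf_integrable. Qed.

Lemma riB a b f g : bmf a b f -> bmf a b g ->
  ri a b (fun t => f t - g t) = ri a b f - ri a b g.
Proof. by move=> hf hg; apply: RintegralB => //; exact: bmf_integrable. Qed.

Lemma riZ a b k f : bmf a b f -> ri a b (fun t => k * f t) = k * ri a b f.
Proof. by move=> hf; apply: RintegralZl => //; exact: bmf_integrable. Qed.

Lemma eq_ri a b f g : (forall t, a <= t <= b -> f t = g t) -> ri a b f = ri a b g.
Proof.
by move=> fg; apply: eq_Rintegral => t; rewrite inE /= in_itv /=; exact: fg.
Qed.

Lemma ri_le a b f g : bmf a b f -> bmf a b g ->
  (forall t, a <= t <= b -> f t <= g t) -> ri a b f <= ri a b g.
Proof.
move=> hf hg fg; apply: le_Rintegral; [by []|exact: bmf_integrable|exact: bmf_integrable|].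
by move=> t /=; rewrite in_itv /=; exact: fg.
Qed.

Lemma ri_ge0 a b f : (forall t, a <= t <= b -> 0 <= f t) -> 0 <= ri a b f.
Proof.
by move=> h; apply: Rintegral_ge0 => t /=; rewrite in_itv /=; exact: h.
Qed.

Lemma ri_cst a b k : a <= b -> ri a b (fun=> k) = k * (b - a).
Proof.
move=> ab; rewrite /ri Rintegral_cst//= lebesgue_measure_itv /= lte_fin.
case: (ltgtP a b) ab => //= [->] _.
by rewrite subrr.
Qed.

Lemma ri_abs a b f : bmf a b f -> `|ri a b f| <= ri a b (fun t => `|f t|).
Proof. by move=> hf; apply: le_normr_Rintegral => //; exact: bmf_integrable. Qed.

Lemma ri_bound a b f M : a <= b -> bmf a b f ->
  (forall t, a <= t <= b -> `|f t| <= M) -> `|ri a b f| <= M * (b - a).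
Proof.
move=> ab hf fM; apply: (le_trans (ri_abs hf)); rewrite -ri_cst//.
by apply: ri_le => //; [exact: bmf_norm | exact: bmf_cst].
Qed.

Lemma ri_sum a b (I : Type) (s : seq I) (F : I -> R -> R) : (forall i, bmf a b (F i)) ->
  ri a b (fun t => \sum_(i <- s) F i t) = \sum_(i <- s) ri a b (F i).
Proof.
move=> hF; elim: s => [|i s IH].
  rewrite big_nil; under [X in ri a b X]eq_fun do rewrite big_nil.
  by rewrite /ri /Rintegral integral0.
rewrite big_cons; under [X in ri a b X]eq_fun do rewrite big_cons.
by rewrite riD ?IH//; exact: bmf_sum.
Qed.

Lemma ri_split a b c f : a <= c -> c <= b -> bmf a b f ->
  ri a b f = ri a c f + ri c b f.
Proof.
move=> ac cb hf.
have hi := bmf_integrable hf.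
have := @Rintegral_itvB R f (BLeft a) (BRight b) c hi.
rewrite !bnd_simp => /(_ ac cb) E.
rewrite /ri; apply/eqP; rewrite addrC -subr_eq E; apply/eqP.
apply: Rintegral_itv_obnd_cbnd.
apply: integrableS hi => // x /=; rewrite !in_itv /= => /andP[h1 h2]; apply/andP; split; lra.
Qed.

(** Continuity in epsilon-delta form, which is how it is produced and consumed
    here; [cont_onP] translates it. *)
Definition cont_on a b f := forall t, a <= t <= b -> forall e, 0 < e ->
  exists2 d, 0 < d & forall s, a <= s <= b -> `|s - t| < d -> `|f s - f t| < e.

Lemma cont_onP a b f : cont_on a b f -> {within `[a, b], continuous f}.
Proof.
move=> hf; apply/subspace_continuousP => x /= xab.
apply/cvgrPdist_lt => e e0.
move: xab; rewrite in_itv /= => xab.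
have [d d0 H] := hf _ xab _ e0.
rewrite near_withinE; apply/nbhs_ballP; exists d => //= s xs sab.
by rewrite distrC; apply: H => //; rewrite distrC.
Qed.

Lemma cont_on_bmf a b f : cont_on a b f -> bmf a b f.
Proof.
move=> hf; have [ab|ba] := leP a b; last first.
  split; last by exists 0 => t; lra.
  have -> : `[a, b]%classic = set0 :> set R.
    by apply/seteqP; split => // x /=; rewrite in_itv /=; lra.
  exact: measurable_fun_set0.
have cf := cont_onP hf.
split; first exact: subspace_continuous_measurable_fun.
have [c _ Hc] := EVT_max ab cf.
have [d _ Hd] := EVT_min ab cf.
exists (`|f c| + `|f d|) => t tab.
have t_in : t \in `[a, b] by rewrite in_itv.
have := Hc _ t_in; have := Hd _ t_in.
have := ler_norm (f c); have := ler_norm (- f d); rewrite normrN.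
have := normr_ge0 (f c); have := normr_ge0 (f d).
by move=> *; rewrite ler_norml; apply/andP; split; lra.
Qed.

End RealIntegral.

(** * The modulus, the circle and complex derivatives *)

Section ComplexModulus.
Context {R : realType}.
Implicit Types (z w d : R[i]) (e t s : R).
Local Notation Re := (@complex.Re R).
Local Notation Im := (@complex.Im R).

Lemma cmodE z : `|z| = (cmod z)%:C.
Proof. by []. Qed.

Lemma cmod_ge0 z : 0 <= cmod z.
Proof. by case: z => x y; exact: sqrtr_ge0. Qed.

Lemma cmod0 : cmod (0 : R[i]) = 0.
Proof. exact: ComplexField.Normc.normc0. Qed.

Lemma cmod1 : cmod (1 : R[i]) = 1.
Proof. exact: ComplexField.Normc.normc1. Qed.

Lemma cmod0_eq0 z : cmod z = 0 -> z = 0.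
Proof. exact: ComplexField.Normc.eq0_normc. Qed.

Lemma cmod_gt0 z : (0 < cmod z) = (z != 0).
Proof.
rewrite lt_neqAle cmod_ge0 andbT eq_sym; apply/idP/idP; apply: contra => /eqP.
  by move=> ->; rewrite cmod0.
by move=> /cmod0_eq0 ->.
Qed.

Lemma cmodM z w : cmod (z * w) = cmod z * cmod w.
Proof. exact: ComplexField.Normc.normcM. Qed.

Lemma cmodV z : cmod (z^-1) = (cmod z)^-1.
Proof. exact: ComplexField.Normc.normcV. Qed.

Lemma cmodX z n : cmod (z ^+ n) = cmod z ^+ n.
Proof. by elim: n => [|n IH]; rewrite ?expr0 ?cmod1// !exprS cmodM IH. Qed.

Lemma cmodN z : cmod (- z) = cmod z.
Proof. exact: (@normcN R z). Qed.

Lemma cmodBC z w : cmod (z - w) = cmod (w - z).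
Proof. by rewrite -cmodN opprB. Qed.

Lemma cmodD z w : cmod (z + w) <= cmod z + cmod w.
Proof. exact: (@le_normcD R z w). Qed.

Lemma cmodB z w : cmod (z - w) <= cmod z + cmod w.
Proof. by rewrite -(cmodN w); exact: cmodD. Qed.

Lemma cmod_lerB z w : cmod z - cmod w <= cmod (z - w).
Proof. by rewrite lerBlDr -{1}(subrK w z); exact: cmodD. Qed.

Lemma cmod_real (x : R) : cmod (x%:C) = `|x|.
Proof. by rewrite /cmod /= expr0n /= addr0 sqrtr_sqr. Qed.

Lemma cmod_sqr z : cmod z ^+ 2 = Re z ^+ 2 + Im z ^+ 2.
Proof. by case: z => x y; rewrite /cmod /= sqr_sqrtr// addr_ge0 ?sqr_ge0. Qed.

Lemma cmod_conj z : cmod z^* = cmod z.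
Proof. by case: z => x y; rewrite /cmod /= sqrrN. Qed.

Lemma Re_cmod z : `|Re z| <= cmod z.
Proof.
rewrite -(@ler_pXn2r _ 2) ?nnegrE ?cmod_ge0//.
by rewrite cmod_sqr -normrX ger0_norm ?sqr_ge0// lerDl sqr_ge0.
Qed.

Lemma Im_cmod z : `|Im z| <= cmod z.
Proof.
rewrite -(@ler_pXn2r _ 2) ?nnegrE ?cmod_ge0//.
by rewrite cmod_sqr -normrX ger0_norm ?sqr_ge0// lerDr sqr_ge0.
Qed.

Lemma cmod_ReIm z : cmod z <= `|Re z| + `|Im z|.
Proof.
rewrite -(@ler_pXn2r _ 2) ?nnegrE ?cmod_ge0 ?addr_ge0//.
rewrite cmod_sqr sqrrD !real_normK ?num_real// lerD2r lerDl.
by rewrite mulrn_wge0// mulr_ge0.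
Qed.

Lemma cReD z w : Re (z + w) = Re z + Re w. Proof. by case: z; case: w. Qed.
Lemma cImD z w : Im (z + w) = Im z + Im w. Proof. by case: z; case: w. Qed.
Lemma cReN z : Re (- z) = - Re z. Proof. by case: z. Qed.
Lemma cImN z : Im (- z) = - Im z. Proof. by case: z. Qed.
Lemma cReB z w : Re (z - w) = Re z - Re w. Proof. by rewrite cReD cReN. Qed.
Lemma cImB z w : Im (z - w) = Im z - Im w. Proof. by rewrite cImD cImN. Qed.
Lemma cReM z w : Re (z * w) = Re z * Re w - Im z * Im w.
Proof. by case: z; case: w. Qed.
Lemma cImM z w : Im (z * w) = Re z * Im w + Im z * Re w.
Proof. by case: z => ? ?; case: w => ? ? /=. Qed.

Lemma circle_pt_cmod t : cmod (circle_pt t : R[i]) = 1.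
Proof. by rewrite /cmod /circle_pt /= cos2Dsin2 sqrtr1. Qed.

Lemma circle_pt_neq0 t : (circle_pt t : R[i]) != 0.
Proof. by rewrite -cmod_gt0 circle_pt_cmod. Qed.

Lemma circle_ptD s t : circle_pt (s + t) = circle_pt s * circle_pt t :> R[i].
Proof.
rewrite /circle_pt cosD sinD; apply/eqP; rewrite eq_complex /= eqxx /=.
by rewrite addrC.
Qed.

Lemma circle_pt0 : circle_pt 0 = 1 :> R[i].
Proof. by rewrite /circle_pt cos0 sin0. Qed.

Lemma circle_pt2pi : circle_pt (2 * pi) = 1 :> R[i].
Proof. by rewrite /circle_pt mulr2n mulrDl mul1r cos2pi sin2pi. Qed.

Lemma circle_pt_periodic t : circle_pt (t + 2 * pi) = circle_pt t :> R[i].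
Proof. by rewrite circle_ptD circle_pt2pi mulr1. Qed.

(** By the mean value theorem. *)
Lemma abs_sin_le (x : R) : `|sin x| <= `|x|.
Proof.
wlog x0 : x / 0 <= x => [H|].
  have [/H//|x0] := leP 0 x.
  by rewrite -(normrN x) -(normrN (sin x)) -sinN; apply: H; lra.
have [c _] := @MVT_segment R sin cos 0 x x0 (fun y _ => is_derive_sin y)
  (continuous_subspaceT (@continuous_sin R)).
rewrite sin0 !subr0 => ->; rewrite normrM ler_piMl//; exact: cos_max.
Qed.

Lemma chord_sqr s t : cmod (circle_pt s - circle_pt t : R[i]) ^+ 2 = 4 * sin ((s - t) / 2) ^+ 2.
Proof.
rewrite cmod_sqr /circle_pt /=.
set u := (s + t) / 2; set v := (s - t) / 2.
have -> : s = u + v by rewrite /u /v; field.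
have -> : t = u - v by rewrite /u /v; field.
rewrite cosD cosB sinD sinB.
have h := cos2Dsin2 u.
transitivity (4 * sin v ^+ 2 * (cos u ^+ 2 + sin u ^+ 2)); first by ring.
by rewrite h mulr1.
Qed.

Lemma chordE s t : cmod (circle_pt s - circle_pt t : R[i]) = 2 * `|sin ((s - t) / 2)|.
Proof.
apply/eqP; rewrite -(@eqrXn2 _ 2) ?cmod_ge0 ?mulr_ge0//.
by rewrite chord_sqr exprMn real_normK ?num_real// -natrX.
Qed.

Lemma chord_le s t : cmod (circle_pt s - circle_pt t : R[i]) <= `|s - t|.
Proof.
rewrite chordE; have := abs_sin_le ((s - t) / 2).
by rewrite normrM (@ger0_norm _ (2^-1)) ?invr_ge0//; lra.
Qed.

End ComplexModulus.

Section ComplexDerivative.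
Context {R : realType}.
Implicit Types (z w d : R[i]) (e : R) (f g : R[i] -> R[i]).

(** Complex differentiability stated with the real-valued modulus: the norm of
    [Cplx R] takes complex values, and estimates take place in [R]. *)
Definition cderiv g z d := forall e, 0 < e -> exists2 dl, 0 < dl &
  forall h : R[i], cmod h < dl -> cmod (g (z + h) - g z - d * h) <= e * cmod h.

Definition ccont g z := forall e, 0 < e -> exists2 dl, 0 < dl &
  forall w : R[i], cmod (w - z) < dl -> cmod (g w - g z) < e.

Lemma ccontP g z : ccont g z <->
  forall e, 0 < e -> exists2 dl, 0 < dl & forall h : R[i], cmod h < dl -> cmod (g (z + h) - g z) <= e.
Proof.
split=> H e e0.
  by have [dl dl0 K] := H _ e0; exists dl => // h hd; apply/ltW/K; rewrite addrC addKr.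
have e20 : 0 < e / 2 by rewrite divr_gt0.
have [dl dl0 K] := H _ e20; exists dl => // w hw.
have := K _ hw; rewrite (addrC z) subrK => /le_lt_trans; apply.
by rewrite ltr_pdivrMr// ltr_pMr// ltrDl.
Qed.

Lemma nbhs_cmod z (P : set (Cplx R)) : nbhs (z : Cplx R) P <->
  exists2 e, 0 < e & forall w : R[i], cmod (w - z) < e -> P w.
Proof.
split.
  move=> /nbhs_ballP [e /= e0 H].
  have [er eE] : exists er : R, e = er%:C.
    exists (complex.Re e); move: e0; rewrite ltcE /=.
    by case: (e) => a b /= /andP[/eqP -> _].
  subst e; move: e0; rewrite ltcR => e0; exists er => // w hw; apply: H.
  by rewrite -ball_normE /ball_ /= distrC cmodE ltcR.
move=> [e e0 H]; apply/nbhs_ballP; exists e%:C; first by rewrite /= ltcR.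
by move=> w; rewrite -ball_normE /ball_ /= distrC cmodE ltcR; exact: H.
Qed.

Lemma cvg_cmod {T : Type} (F : set_system T) (FF : Filter F) (f : T -> Cplx R) (l : Cplx R) :
  f x @[x --> F] --> l <-> forall e, 0 < e -> \forall x \near F, cmod (f x - l) < e.
Proof.
split=> H.
  move=> e e0; apply: (H [set w | cmod (w - l) < e]).
  by apply/nbhs_cmod; exists e.
move=> P /nbhs_cmod [e e0 K]; have := H _ e0; apply: filterS => x; exact: K.
Qed.

Lemma derivable_cderiv (g : Cplx R -> Cplx R) (z : Cplx R) :
  derivable g z 1 -> exists d, cderiv g z d.
Proof.
move=> /cvg_ex [d /= H]; exists d => e e0.
have /cvg_cmod/(_ e e0) := H.
rewrite /= near_withinE => /nbhs_cmod [dl dl0 K].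
exists dl => // h hd; have [->|h0] := eqVneq h 0.
  by rewrite addr0 subrr mulr0 subr0 cmod0 mulr0.
have := K h; rewrite subr0 => /(_ hd h0) /ltW.
rewrite (_ : _ - d = h^-1 * (g (z + h) - g z - d * h)); last first.
  have -> : (h *: 1 + z : Cplx R) = z + h.
    by rewrite addrC; congr (_ + _); exact: mulr1.
  rewrite [in RHS]mulrBr (mulrC d) mulKf//.
rewrite cmodM cmodV mulrC ler_pdivrMr// cmod_gt0//.
Qed.

Lemma cderiv_lip g z d : cderiv g z d -> exists2 dl, 0 < dl &
  forall h : R[i], cmod h < dl -> cmod (g (z + h) - g z) <= (cmod d + 1) * cmod h.
Proof.
move=> /(_ 1 ltr01) [dl dl0 H]; exists dl => // h /H hd.
have -> : g (z + h) - g z = (g (z + h) - g z - d * h) + d * h by rewrite subrK.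
apply: (le_trans (cmodD _ _)); rewrite cmodM mulrDl addrC lerD2l; exact: hd.
Qed.

Lemma cderiv_ccont g z d : cderiv g z d -> ccont g z.
Proof.
move=> /cderiv_lip [dl dl0 H]; apply/ccontP => e e0.
have c0 : 0 < cmod d + 1 by rewrite ltr_wpDl ?cmod_ge0.
exists (Num.min dl (e / (cmod d + 1))); first by rewrite lt_min dl0 divr_gt0.
move=> h; rewrite lt_min => /andP[h1 h2]; apply: (le_trans (H _ h1)).
by rewrite mulrC -ler_pdivlMr// ltW.
Qed.

Lemma cderiv_cst (k : R[i]) z : cderiv (fun=> k) z 0.
Proof.
move=> e e0; exists 1 => // h _.
by rewrite subrr mul0r subr0 cmod0 mulr_ge0 ?cmod_ge0// ltW.
Qed.

Lemma cderiv_id z : cderiv id z 1.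
Proof.
move=> e e0; exists 1 => // h _.
by rewrite /= (addrC z) addrK mul1r subrr cmod0 mulr_ge0 ?cmod_ge0// ltW.
Qed.

Lemma cderivD f g z df dg : cderiv f z df -> cderiv g z dg ->
  cderiv (fun w => f w + g w) z (df + dg).
Proof.
move=> hf hg e e0; have e20 : 0 < e / 2 by rewrite divr_gt0.
have [d1 d10 H1] := hf _ e20; have [d2 d20 H2] := hg _ e20.
exists (Num.min d1 d2); first by rewrite lt_min d10.
move=> h; rewrite lt_min => /andP[h1 h2].
rewrite (_ : _ - _ = (f (z + h) - f z - df * h) + (g (z + h) - g z - dg * h)); last by ring.
have := cmodD (f (z + h) - f z - df * h) (g (z + h) - g z - dg * h).
by move: (H1 _ h1) (H2 _ h2); lra.
Qed.

Lemma cderivM f g z df dg : cderiv f z df -> cderiv g z dg ->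
  cderiv (fun w => f w * g w) z (df * g z + f z * dg).
Proof.
move=> hf hg e e0.
set A := cmod (f z) + cmod (g z) + 1 + cmod dg.
have A0 : 0 < A.
  by have := cmod_ge0 (f z); have := cmod_ge0 (g z); have := cmod_ge0 dg; rewrite /A; lra.
set n := Num.min 1 (e / A).
have n0 : 0 < n by rewrite lt_min ltr01 divr_gt0.
have n1 : n <= 1 by rewrite ge_min lexx.
have nA : n * A <= e by rewrite -ler_pdivlMr// ge_min lexx orbT.
have [d1 d10 H1] := hf _ n0; have [d2 d20 H2] := hg _ n0.
have /ccontP /(_ _ n0) [d3 d30 H3] := cderiv_ccont hf.
exists (Num.min (Num.min d1 d2) d3); first by rewrite !lt_min d10 d20 d30.
move=> h; rewrite !lt_min => /andP[/andP[h1 h2] h3].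
have {H1} := H1 _ h1; have {H2} := H2 _ h2; have {H3} := H3 _ h3.
set F := f (z + h) - f z; set E1 := F - _; set E2 := g (z + h) - g z - dg * h => k3 k2 k1.
rewrite (_ : _ - _ = E1 * g z + f z * E2 + F * (E2 + dg * h)); last first.
  by rewrite /E1 /E2 /F; ring.
apply: (le_trans (cmodD _ _)); apply: (le_trans (lerD (cmodD _ _) (lexx _))).
rewrite !cmodM.
have q1 : cmod E1 * cmod (g z) <= n * cmod h * cmod (g z) by rewrite ler_wpM2r ?cmod_ge0.
have q2 : cmod (f z) * cmod E2 <= cmod (f z) * (n * cmod h) by rewrite ler_wpM2l ?cmod_ge0.
have q3 : cmod F * cmod (E2 + dg * h) <= n * ((1 + cmod dg) * cmod h).
  apply: ler_pM; rewrite ?cmod_ge0//.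
  apply: (le_trans (cmodD _ _)); rewrite mulrDl cmodM lerD2r.
  by apply: (le_trans k2); rewrite ler_wpM2r ?cmod_ge0.
have q4 : n * A * cmod h <= e * cmod h by rewrite ler_wpM2r ?cmod_ge0.
apply: le_trans q4; apply: (le_trans (lerD (lerD q1 q2) q3)).
by rewrite le_eqVlt; apply/orP; left; apply/eqP; rewrite /A; ring.
Qed.

Lemma cderivV g z d : g z != 0 -> cderiv g z d ->
  cderiv (fun w => (g w)^-1) z (- d / g z ^+ 2).
Proof.
move=> g0 hg e e0.
have G0 : 0 < cmod (g z) by rewrite cmod_gt0.
set G := cmod (g z) in G0 *.
set A := 2 * (G + cmod d).
have A0 : 0 < A by have := cmod_ge0 d; rewrite /A; lra.
set n := Num.min (G / 2) (e * G ^+ 3 / A).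
have n0 : 0 < n by rewrite lt_min !divr_gt0// mulr_gt0// exprn_gt0.
have nG : n <= G / 2 by rewrite ge_min lexx.
have nA : n * A <= e * G ^+ 3 by rewrite -ler_pdivlMr// ge_min lexx orbT.
have [d1 d10 H1] := hg _ n0.
have /ccontP /(_ _ n0) [d3 d30 H3] := cderiv_ccont hg.
exists (Num.min d1 d3); first by rewrite !lt_min d10 d30.
move=> h; rewrite !lt_min => /andP[h1 h3].
have {H1} := H1 _ h1; have {H3} := H3 _ h3.
set F := g (z + h) - g z; set E := F - _ => k3 k1.
have Gh : G / 2 <= cmod (g (z + h)).
  have := cmod_lerB (g z) (g z - g (z + h)); rewrite subKr cmodBC -/F -/G.
  by move: k3 nG; lra.
have gh0 : g (z + h) != 0 by rewrite -cmod_gt0; apply: lt_le_trans Gh; rewrite divr_gt0.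
rewrite (_ : _ - _ = (d * h * F - g z * E) / (g z ^+ 2 * g (z + h))); last first.
  rewrite /E /F; field; first by rewrite gh0 g0.
rewrite cmodM cmodV cmodM cmodX -/G ler_pdivrMr; last first.
  by rewrite mulr_gt0 ?exprn_gt0 ?cmod_gt0.
apply: (le_trans (cmodB _ _)); rewrite !cmodM -/G.
have q1 : cmod d * cmod h * cmod F <= cmod d * cmod h * n.
  by rewrite ler_wpM2l// mulr_ge0 ?cmod_ge0.
have q2 : G * cmod E <= G * (n * cmod h) by rewrite ler_wpM2l// ltW.
have q3 : e * cmod h * (G ^+ 2 * (G / 2)) <= e * cmod h * (G ^+ 2 * cmod (g (z + h))).
  rewrite ler_wpM2l ?mulr_ge0 ?cmod_ge0 ?(ltW e0)//.
  by rewrite ler_wpM2l// exprn_ge0// ltW.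
have q4 : n * A * cmod h <= e * G ^+ 3 * cmod h by rewrite ler_wpM2r ?cmod_ge0.
apply: le_trans q3; apply: (le_trans (lerD q1 q2)).
suff: 2 * (cmod d * cmod h * n + G * (n * cmod h)) <= 2 * (e * cmod h * (G ^+ 2 * (G / 2))) by lra.
rewrite (_ : 2 * (_ + _) = n * A * cmod h); last by rewrite /A; ring.
by rewrite (_ : 2 * _ = e * G ^+ 3 * cmod h)//; field.
Qed.

Lemma cderivX g z d n : cderiv g z d -> exists d', cderiv (fun w => g w ^+ n) z d'.
Proof.
move=> hg; elim: n => [|n [d' IH]].
  by exists 0; under eq_fun do rewrite expr0; exact: cderiv_cst.
exists (d * g z ^+ n + g z * d').
by have := cderivM hg IH; under eq_fun do rewrite -exprS.
Qed.

Lemma cderiv_dilate g z d (k : R[i]) : cderiv g (k * z) d ->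
  cderiv (fun w => g (k * w)) z (k * d).
Proof.
move=> hg e e0.
have c0 : 0 < cmod k + 1 by rewrite ltr_wpDl ?cmod_ge0.
have e1 : 0 < e / (cmod k + 1) by rewrite divr_gt0.
have [dl dl0 H] := hg _ e1.
exists (dl / (cmod k + 1)); first by rewrite divr_gt0.
move=> h; rewrite ltr_pdivlMr// => hd.
have kh : cmod (k * h) <= cmod h * (cmod k + 1).
  by rewrite cmodM mulrC ler_wpM2l ?cmod_ge0// lerDl.
have := H (k * h) (le_lt_trans kh hd).
have -> : k * (z + h) = k * z + k * h by ring.
have -> : k * d * h = d * (k * h) by ring.
move=> /le_trans; apply.
by rewrite mulrAC ler_pdivrMr// -mulrA ler_wpM2l// ltW.
Qed.

End ComplexDerivative.

(** * Goursat's theorem in polar coordinates and the mean value property *)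

Section Goursat.
Context {R : realType}.
Implicit Types (z w d : R[i]) (g f : R[i] -> R[i]) (r c x y p q e : R).
Local Notation Re := (@complex.Re R).
Local Notation Im := (@complex.Im R).

(** Bisection: a property of rectangles that always passes to one of the four
    quarters survives down to a common point. It serves both the Goursat
    argument and the existence of maxima on the closed disk. *)
Lemma nested_quarters (Bad : nat -> R -> R -> Prop) (r c h k : R) :
  0 <= h -> 0 <= k -> Bad 0%N r c ->
  (forall n x y, Bad n x y -> exists x' y',
     [/\ x' = x \/ x' = x + h / 2 ^+ n.+1,
         y' = y \/ y' = y + k / 2 ^+ n.+1 & Bad n.+1 x' y']) ->
  exists xs ys, forall n, exists x y,
    [/\ Bad n x y, x <= xs <= x + h / 2 ^+ n & y <= ys <= y + k / 2 ^+ n].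
Proof.
move=> h0 k0 B0 step.
pose rel n (p q : R * R) := [/\ q.1 = p.1 \/ q.1 = p.1 + h / 2 ^+ n.+1,
         q.2 = p.2 \/ q.2 = p.2 + k / 2 ^+ n.+1 & Bad n.+1 q.1 q.2].
pose s := fix s n := match n with O => (r, c) | S m => xget (s m) [set q | rel m (s m) q] end.
have Bs n : Bad n (s n).1 (s n).2 /\ rel n (s n) (s n.+1).
  have aux m : Bad m (s m).1 (s m).2 -> rel m (s m) (s m.+1).
    move=> Bm; have [x' [y' H]] := step _ _ _ Bm.
    by have /= := @xgetI _ (s m) [set q | rel m (s m) q] (x', y') H.
  elim: n => [|n [IH1 IH2]]; first by split => //; exact: aux.
  by case: (IH2) => _ _ B1; split => //; exact: aux.
have half (x : R) n : x / 2 ^+ n = x / 2 ^+ n.+1 + x / 2 ^+ n.+1.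
  by rewrite exprS; field; rewrite expf_neq0.
have hp (x : R) n : 0 <= x -> 0 <= x / 2 ^+ n by move=> x0; rewrite divr_ge0// exprn_ge0.
have lim (f : nat -> R) (l : R) : 0 <= l ->
    (forall n, f n.+1 = f n \/ f n.+1 = f n + l / 2 ^+ n.+1) ->
    exists xs, forall n, f n <= xs <= f n + l / 2 ^+ n.
  move=> l0 H.
  have inc n m : f n <= f (n + m)%N /\ f (n + m)%N + l / 2 ^+ (n + m) <= f n + l / 2 ^+ n.
    elim: m => [|m [I1 I2]]; first by rewrite addn0.
    rewrite addnS; have := half l (n + m)%N; have := hp l (n + m).+1 l0.
    by case: (H (n + m)%N) => ->; lra.
  have ub n m : f m <= f n + l / 2 ^+ n.
    have [nm|/ltnW mn] := leqP n m.
      have [_] := inc n (m - n)%N; rewrite subnKC// => I2.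
      by apply: le_trans I2; rewrite lerDl hp.
    have [I1 _] := inc m (n - m)%N; rewrite subnKC// in I1.
    by apply: (le_trans I1); rewrite lerDl hp.
  exists (sup (range f)) => n; apply/andP; split.
    apply: ub_le_sup; last by exists n.
    by exists (f 0%N + l / 2 ^+ 0) => _ [m _ <-]; exact: ub.
  apply: ge_sup; first by exists (f 0%N), 0%N.
  by move=> _ [m _ <-]; exact: ub.
have [xs Hx] := lim (fun n => (s n).1) h h0 (fun n => let: And3 a _ _ := (Bs n).2 in a).
have [ys Hy] := lim (fun n => (s n).2) k k0 (fun n => let: And3 _ a _ := (Bs n).2 in a).
exists xs, ys => n; exists (s n).1, (s n).2; split; [exact: (Bs n).1 | exact: Hx | exact: Hy].
Qed.

Definition polar g (r t : R) : R[i] := g (r%:C * circle_pt t).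

Lemma polar_dist r t r' t' : 0 <= r ->
  cmod (r'%:C * circle_pt t' - r%:C * circle_pt t) <= `|r' - r| + r * `|t' - t|.
Proof.
move=> r0.
have -> : r'%:C * circle_pt t' - r%:C * circle_pt t =
  (r' - r)%:C * circle_pt t' + r%:C * (circle_pt t' - circle_pt t) :> R[i].
  by rewrite rmorphB /=; ring.
apply: (le_trans (cmodD _ _)); rewrite !cmodM !cmod_real circle_pt_cmod mulr1.
by rewrite lerD2l (ger0_norm r0) ler_wpM2l// chord_le.
Qed.

Lemma cmod_polar r t : 0 <= r -> cmod (r%:C * circle_pt t : R[i]) = r.
Proof. by move=> r0; rewrite cmodM cmod_real circle_pt_cmod mulr1 ger0_norm. Qed.

Lemma ccont_polar_t g r (a b : R) (L : R[i] -> R) : 0 <= r ->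
  (forall z, `|L z| <= cmod z) -> (forall z w, L (z - w) = L z - L w) ->
  (forall t, a <= t <= b -> ccont g (r%:C * circle_pt t)) ->
  cont_on a b (fun t => L (polar g r t)).
Proof.
move=> r0 L1 L2 gc t tab e e0; have [d d0 H] := gc _ tab _ e0.
have c0 : 0 < r + 1 by rewrite ltr_wpDl.
exists (d / (r + 1)); first by rewrite divr_gt0.
move=> s _; rewrite ltr_pdivlMr// => hs; rewrite -L2; apply: (le_lt_trans (L1 _)).
apply: H; apply: (le_lt_trans (polar_dist _ _ _ r0)); rewrite subrr normr0 add0r.
by apply: le_lt_trans hs; rewrite mulrC ler_wpM2l// lerDl.
Qed.

Lemma ccont_polar_r g t (a b : R) (L : R[i] -> R) : 0 <= a ->
  (forall z, `|L z| <= cmod z) -> (forall z w, L (z - w) = L z - L w) ->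
  (forall r, a <= r <= b -> ccont g (r%:C * circle_pt t)) ->
  cont_on a b (fun r => L (polar g r t)).
Proof.
move=> r0 L1 L2 gc r rab e e0; have [d d0 H] := gc _ rab _ e0.
exists d => // s _ hs; rewrite -L2; apply: (le_lt_trans (L1 _)).
apply: H; apply: (le_lt_trans (polar_dist _ _ _ _)); first lra.
by rewrite subrr normr0 mulr0 addr0.
Qed.

Lemma cont_on_inv (a b : R) : 0 < a -> cont_on a b (fun r => r^-1).
Proof.
move=> a0 t tab e e0; exists (e * a ^+ 2); first by rewrite mulr_gt0 ?exprn_gt0.
move=> s sab hs.
have s0 : 0 < s by lra.
have t0 : 0 < t by lra.
have -> : s^-1 - t^-1 = (t - s) / (s * t) by field; rewrite !lt0r_neq0.
rewrite normrM normfV (gtr0_norm (mulr_gt0 s0 t0)) ltr_pdivrMr ?mulr_gt0// distrC.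
apply: (lt_le_trans hs); rewrite ler_wpM2l ?(ltW e0)// expr2.
by apply: ler_pM; lra.
Qed.

(** In polar coordinates g(z) dz/z is g dr/r + i g dt. This is the integral of
    its imaginary part around the polar rectangle r1 <= r <= r2, c <= t <= d,
    positively oriented. *)
Definition bdry g (r1 r2 c d : R) : R :=
  ri c d (fun t => Re (polar g r2 t)) - ri c d (fun t => Re (polar g r1 t))
  - (ri r1 r2 (fun r => Im (polar g r d) * r^-1) - ri r1 r2 (fun r => Im (polar g r c) * r^-1)).

Definition annulus_cont g r1 r2 := forall z, r1 <= cmod z <= r2 -> ccont g z.

Lemma bmf_t g r1 r2 r (c d : R) : 0 < r1 -> r1 <= r <= r2 -> annulus_cont g r1 r2 ->
  bmf c d (fun t => Re (polar g r t)).
Proof.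
move=> r10 rr gc; apply/cont_on_bmf/ccont_polar_t; [lra|exact: Re_cmod|exact: cReB|].
by move=> t _; apply: gc; rewrite cmod_polar//; lra.
Qed.

Lemma bmf_r g r1 r2 a b (t : R) : 0 < r1 -> r1 <= a -> b <= r2 -> annulus_cont g r1 r2 ->
  bmf a b (fun r => Im (polar g r t) * r^-1).
Proof.
move=> r10 ra br gc; apply: bmfM; apply/cont_on_bmf; last by apply: cont_on_inv; lra.
apply: ccont_polar_r; [lra|exact: Im_cmod|exact: cImB|].
by move=> r rab; apply: gc; rewrite cmod_polar//; lra.
Qed.

Lemma bdry_split_r g r1 r2 m (c d : R) : 0 < r1 -> r1 <= m <= r2 -> annulus_cont g r1 r2 ->
  bdry g r1 r2 c d = bdry g r1 m c d + bdry g m r2 c d.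
Proof.
move=> r10 /andP[h1 h2] gc; rewrite /bdry.
rewrite (@ri_split _ r1 r2 m (fun r => Im (polar g r d) * r^-1))//; last exact: (bmf_r (r1:=r1) (r2:=r2)).
rewrite (@ri_split _ r1 r2 m (fun r => Im (polar g r c) * r^-1))//; last exact: (bmf_r (r1:=r1) (r2:=r2)).
ring.
Qed.

Lemma bdry_split_t g r1 r2 m (c d : R) : 0 < r1 -> r1 <= r2 -> c <= m <= d -> annulus_cont g r1 r2 ->
  bdry g r1 r2 c d = bdry g r1 r2 c m + bdry g r1 r2 m d.
Proof.
move=> r10 r12 /andP[h1 h2] gc; rewrite /bdry.
rewrite (@ri_split _ c d m (fun t => Re (polar g r2 t)))//; last by apply: (bmf_t (r1:=r1) (r2:=r2)) => //; lra.
rewrite (@ri_split _ c d m (fun t => Re (polar g r1 t)))//; last by apply: (bmf_t (r1:=r1) (r2:=r2)) => //; lra.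
ring.
Qed.

Lemma bdryB g f r1 r2 (c d : R) : 0 < r1 -> r1 <= r2 -> annulus_cont g r1 r2 -> annulus_cont f r1 r2 ->
  bdry (fun z => g z - f z) r1 r2 c d = bdry g r1 r2 c d - bdry f r1 r2 c d.
Proof.
move=> r10 r12 gc fc; rewrite /bdry.
have E1 r : r1 <= r <= r2 -> ri c d (fun t => Re (polar (fun z => g z - f z) r t)) =
   ri c d (fun t => Re (polar g r t)) - ri c d (fun t => Re (polar f r t)).
  move=> rr; rewrite -riB; [|exact: (bmf_t (r1:=r1) (r2:=r2))..].
  by apply: eq_ri => t _; rewrite /polar cReB.
have E2 t : ri r1 r2 (fun r => Im (polar (fun z => g z - f z) r t) * r^-1) =
   ri r1 r2 (fun r => Im (polar g r t) * r^-1) - ri r1 r2 (fun r => Im (polar f r t) * r^-1).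
  rewrite -riB; [|exact: (bmf_r (r1:=r1) (r2:=r2))..].
  by apply: eq_ri => r _; rewrite /polar cImB mulrBl.
rewrite !E1 ?E2; [ring|lra..].
Qed.

Lemma ri_cos_sin (x y c d : R) : c < d ->
  ri c d (fun t => x * cos t - y * sin t) = (x * sin d + y * cos d) - (x * sin c + y * cos c).
Proof.
move=> cd; rewrite /ri /Rintegral.
pose F t : R := x * sin t + y * cos t.
have dF (t : R) : is_derive (t : R) (1 : R) F (x * cos t - y * sin t).
  rewrite /F (_ : x * _ - _ = x *: cos t + y *: (- sin t)); last by rewrite scalerN.
  exact: is_deriveD.
have cF : continuous F.
  by move=> t; apply: differentiable_continuous; apply/derivable1_diffP; case: (dF t).
rewrite (@continuous_FTC2 R _ F c d cd) //.
- apply: continuous_subspaceT => t; apply: cvgB; apply: cvgM; try exact: cvg_cst.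
    exact: continuous_cos.
  exact: continuous_sin.
- split.
  + by move=> t _; case: (dF t).
  + by apply: cvg_at_right_filter; exact: cF.
  + by apply: cvg_at_left_filter; exact: cF.
- by move=> t _; rewrite derive1E; case: (dF t).
Qed.

(** The form is exact in the coordinates (r, t): a primitive is the imaginary
    part of al (ln r + i t) + be z. *)
Lemma bdry_affine (al be : R[i]) r1 r2 (c d : R) : 0 < r1 -> r1 <= r2 -> c < d ->
  bdry (fun z => al + be * z) r1 r2 c d = 0.
Proof.
move=> r10 r12 cd.
have fc : annulus_cont (fun z => al + be * z) r1 r2.
  move=> z _; apply: cderiv_ccont (cderivD (cderiv_cst al z) (cderivM (cderiv_cst be z) (cderiv_id z))).
have Et r t : Re (polar (fun z => al + be * z) r t) = Re al + r * (Re be * cos t - Im be * sin t).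
  by rewrite /polar; cbv beta; rewrite cReD !cReM cImM /=; ring.
have Er r t : r1 <= r -> Im (polar (fun z => al + be * z) r t) * r^-1
    = Im al * r^-1 + (Re be * sin t + Im be * cos t).
  by move=> rr; rewrite /polar; cbv beta; rewrite cImD !cImM cReM /=; field; apply: lt0r_neq0; lra.
have bt : bmf c d (fun t => Re be * cos t - Im be * sin t).
  have := @bmf_t (fun z => be * z) 1 1 1 c d ltr01.
  have -> : (fun t => Re (polar (fun z => be * z) 1 t)) = (fun t => Re be * cos t - Im be * sin t).
    by apply/funext => t; rewrite /polar; cbv beta; rewrite !cReM cImM /=; ring.
  apply; first by rewrite lexx.
  by move=> z _; apply: cderiv_ccont (cderivM (cderiv_cst be z) (cderiv_id z)).
have ET r : ri c d (fun t => Re (polar (fun z => al + be * z) r t)) =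
    Re al * (d - c) + r * ((Re be * sin d + Im be * cos d) - (Re be * sin c + Im be * cos c)).
  under eq_ri do rewrite Et.
  by rewrite riD ?riZ ?ri_cos_sin ?ri_cst ?(ltW cd)//; [exact: bmf_cst|exact: bmfZ].
have bi : bmf r1 r2 (fun r => Im al * r^-1) by apply/bmfZ/cont_on_bmf/cont_on_inv.
have ER t : ri r1 r2 (fun r => Im (polar (fun z => al + be * z) r t) * r^-1) =
   ri r1 r2 (fun r => Im al * r^-1) + (Re be * sin t + Im be * cos t) * (r2 - r1).
  rewrite -ri_cst// -riD//; last exact: bmf_cst.
  by apply: eq_ri => r /andP[rr _]; exact: Er.
rewrite /bdry !ET !ER; ring.
Qed.

Lemma bdry_bound g r1 r2 (c d : R) M : 0 < r1 -> r1 <= r2 -> c <= d -> annulus_cont g r1 r2 ->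
  (forall r t, r1 <= r <= r2 -> c <= t <= d -> cmod (polar g r t) <= M) ->
  `|bdry g r1 r2 c d| <= 2 * M * ((d - c) + (r2 - r1) / r1).
Proof.
move=> r10 r12 cd gc H.
have B1 r : r1 <= r <= r2 -> `|ri c d (fun t => Re (polar g r t))| <= M * (d - c).
  move=> rr; apply: ri_bound => //; first exact: (bmf_t (r1:=r1) (r2:=r2)).
  by move=> t tt; apply: (le_trans (Re_cmod _)); exact: H.
have B2 t : c <= t <= d -> `|ri r1 r2 (fun r => Im (polar g r t) * r^-1)| <= M / r1 * (r2 - r1).
  move=> tt; apply: ri_bound => //; first exact: (bmf_r (r1:=r1) (r2:=r2)).
  move=> r rr; rewrite normrM; apply: ler_pM => //.
    by apply: (le_trans (Im_cmod _)); exact: H.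
  have rp : 0 < r by lra.
  by rewrite gtr0_norm ?invr_gt0// lef_pV2 ?posrE//; lra.
have := B1 r1; have := B1 r2; have := B2 c; have := B2 d; rewrite !lexx r12 cd /=.
move=> /(_ erefl) b1 /(_ erefl) b2 /(_ erefl) b3 /(_ erefl) b4; rewrite /bdry.
apply: (le_trans (ler_normB _ _)); apply: (le_trans (lerD (ler_normB _ _) (ler_normB _ _))).
rewrite [leRHS](_ : _ = M * (d - c) + M * (d - c) + (M / r1 * (r2 - r1) + M / r1 * (r2 - r1))).
  by apply: lerD; apply: lerD.
by field; rewrite lt0r_neq0.
Qed.

Lemma bdry_quarters g x p y q : 0 < x -> 0 <= p -> 0 <= q -> annulus_cont g x (x + p + p) ->
  bdry g x (x + p + p) y (y + q + q) =
     (bdry g x (x + p) y (y + q) + bdry g x (x + p) (y + q) (y + q + q)) +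
     (bdry g (x + p) (x + p + p) y (y + q) + bdry g (x + p) (x + p + p) (y + q) (y + q + q)).
Proof.
move=> x0 p0 q0 gc.
rewrite (@bdry_split_r _ _ _ (x + p))//; last lra.
rewrite (@bdry_split_t g x (x + p) (y + q) y (y + q + q))//; [|lra|lra|]; last by move=> z zz; apply: gc; lra.
rewrite (@bdry_split_t g (x + p) (x + p + p) (y + q) y (y + q + q))//; [lra|lra|lra|].
by move=> z zz; apply: gc; lra.
Qed.

Lemma pigeon4 (b b1 b2 b3 b4 : R) : b <= b1 + b2 + (b3 + b4) ->
  [\/ b <= 4 * b1, b <= 4 * b2, b <= 4 * b3 | b <= 4 * b4].
Proof.
move=> H; have [H1|H1] := leP b (4 * b1); first by constructor 1.
have [H2|H2] := leP b (4 * b2); first by constructor 2.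
have [H3|H3] := leP b (4 * b3); first by constructor 3.
by constructor 4; lra.
Qed.

Lemma goursat_step g x p y q : 0 < x -> 0 <= p -> 0 <= q -> annulus_cont g x (x + p + p) ->
  exists x' y', [/\ x' = x \/ x' = x + p, y' = y \/ y' = y + q &
    `|bdry g x (x + p + p) y (y + q + q)| <= 4 * `|bdry g x' (x' + p) y' (y' + q)|].
Proof.
move=> x0 p0 q0 gc; rewrite bdry_quarters//.
have tri (b1 b2 b3 b4 : R) : `|b1 + b2 + (b3 + b4)| <= `|b1| + `|b2| + (`|b3| + `|b4|).
  by apply: (le_trans (ler_normD _ _)); apply: lerD; exact: ler_normD.
case: (pigeon4 (tri (bdry g x (x + p) y (y + q)) (bdry g x (x + p) (y + q) (y + q + q))
  (bdry g (x + p) (x + p + p) y (y + q)) (bdry g (x + p) (x + p + p) (y + q) (y + q + q)))) => H.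
- by exists x, y; split; [left|left|exact: H].
- by exists x, (y + q); split; [left|right|exact: H].
- by exists (x + p), y; split; [right|left|exact: H].
- by exists (x + p), (y + q); split; [right|right|exact: H].
Qed.

(** Near a point of differentiability g differs from an affine function, whose
    integral vanishes, by a small multiple of the diameter; hence the integral
    around a small rectangle is small of second order. *)
Lemma goursat_local g r1 r2 x p y q xs ys D e : 0 < r1 -> r1 <= x -> x + p <= r2 -> 0 <= p -> 0 < q ->
  x <= xs <= x + p -> y <= ys <= y + q -> 0 < e ->
  (forall z, x <= cmod z <= x + p -> exists d, cderiv g z d) ->
  (forall h : R[i], cmod h <= p + r2 * q ->
    cmod (g (xs%:C * circle_pt ys + h) - g (xs%:C * circle_pt ys) - D * h) <= e * cmod h) ->
  `|bdry g x (x + p) y (y + q)| <= 2 * (e * (p + r2 * q)) * (q + p / r1).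
Proof.
move=> r10 r1x xr2 p0 q0 xsx ysy e0 gd HE.
have x1 : 0 < x by lra.
have xxp : x <= x + p by lra.
have yyq : y < y + q by lra.
have r20 : 0 < r2 by lra.
set zs := xs%:C * circle_pt ys in HE.
pose f z := (g zs - D * zs) + D * z.
have fc : annulus_cont f x (x + p).
  by move=> z _; apply: cderiv_ccont (cderivD (cderiv_cst _ z) (cderivM (cderiv_cst D z) (cderiv_id z))).
have gx : annulus_cont g x (x + p) by move=> z /gd [? /cderiv_ccont].
have E : bdry g x (x + p) y (y + q) = bdry (fun z => g z - f z) x (x + p) y (y + q).
  by rewrite bdryB// bdry_affine ?subr0.
have efc : annulus_cont (fun z => g z - f z) x (x + p).
  move=> z zz; have [d' Hd'] := gd z zz.
  have := cderiv_ccont (cderivD Hd' (cderivD (cderiv_cst (- (g zs - D * zs)) z) (cderivM (cderiv_cst (- D) z) (cderiv_id z)))).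
  by under eq_fun do rewrite /= mulNr -opprD.
rewrite E; apply: le_trans (bdry_bound (M := e * (p + r2 * q)) x1 xxp (ltW yyq) efc _) _.
  move=> r t rr tt; rewrite /polar /f.
  set w := r%:C * circle_pt t - zs.
  have wE : r%:C * circle_pt t = zs + w by rewrite /w addrC subrK.
  have wb : cmod w <= p + r2 * q.
    have xs0 : 0 <= xs by clear -x1 xsx; lra.
    apply: (le_trans (polar_dist _ _ _ xs0)); apply: lerD.
      by clear -rr xsx; rewrite ler_norml; lra.
    by apply: ler_pM => //; [clear -xsx xr2|clear -tt ysy; rewrite ler_norml]; lra.
  rewrite wE (_ : _ - _ = g (zs + w) - g zs - D * w); last by ring.
  apply: le_trans (HE _ wb) _; by rewrite ler_wpM2l// ltW.
have pq : 0 <= 2 * (e * (p + r2 * q)).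
  by rewrite mulr_ge0// mulr_ge0 ?(ltW e0)// addr_ge0// mulr_ge0// ltW.
rewrite (addrC y q) addrK (addrC x p) addrK ler_wpM2l// lerD2l.
by rewrite ler_wpM2l// lef_pV2 ?posrE.
Qed.

Lemma exists_pow_lt (A dl : R) : 0 <= A -> 0 < dl -> exists n, A / 2 ^+ n < dl.
Proof.
move=> A0 dl0; have [N HN] : exists N : nat, A / dl < N%:R.
  by exists (Num.bound (A / dl)); rewrite archi_boundP// divr_ge0// ltW.
exists N; rewrite ltr_pdivrMr ?exprn_gt0// -ltr_pdivrMl// (mulrC dl^-1).
by apply: (lt_le_trans HN); rewrite -natrX ler_nat; apply/ltnW/ltn_expl.
Qed.

(** Bisection finds nested rectangles whose integrals are at least 4^-n times
    the given one in modulus, while [goursat_local] at their common point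
    gives o(4^-n). *)
Lemma goursat g r1 r2 (c d : R) : 0 < r1 -> r1 <= r2 -> c < d ->
  (forall z, r1 <= cmod z <= r2 -> exists d, cderiv g z d) -> bdry g r1 r2 c d = 0.
Proof.
move=> r10 r12 cd gd.
have gc : annulus_cont g r1 r2 by move=> z /gd [? /cderiv_ccont].
set h := r2 - r1; set k := d - c.
have h0 : 0 <= h by rewrite subr_ge0.
have k0 : 0 < k by rewrite subr_gt0.
have half (x : R) n : x / 2 ^+ n = x / 2 ^+ n.+1 + x / 2 ^+ n.+1.
  by rewrite exprS; field; rewrite expf_neq0.
have hp (x : R) n : 0 <= x -> 0 <= x / 2 ^+ n by move=> x0; rewrite divr_ge0// exprn_ge0.
set J0 : R := `|bdry g r1 r2 c d|.
pose Bad n (x y : R) := [/\ r1 <= x, x + h / 2 ^+ n <= r2 &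
   J0 <= 4 ^+ n * `|bdry g x (x + h / 2 ^+ n) y (y + k / 2 ^+ n)|].
have [||||xs [ys HB]] := @nested_quarters Bad r1 c h k.
- by [].
- exact: ltW.
- split; rewrite ?expr0 ?divr1 ?mul1r//; first by rewrite /h addrC subrK.
  by rewrite /h /k !(addrC _ (_ - _)) !subrK.
- move=> n x y [B1 B2 B3].
  have pm := hp h n.+1 h0; have qm := hp k n.+1 (ltW k0).
  have x0 : 0 < x by apply: lt_le_trans B1.
  rewrite (half h n) (half k n) !addrA in B2 B3.
  have [|x' [y' [Hx Hy H]]] := @goursat_step g x (h / 2 ^+ n.+1) y (k / 2 ^+ n.+1) x0 pm qm.
    by move=> z /andP[z1 z2]; apply: gc; rewrite (le_trans B1 z1) (le_trans z2 B2).
  exists x', y'; split => //; split.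
  + by case: Hx => ->//; apply: (le_trans B1); rewrite lerDl.
  + by case: Hx => ->//; apply: le_trans B2; rewrite lerDl.
  + by apply: (le_trans B3); rewrite (exprSr 4 n) -mulrA ler_wpM2l// exprn_ge0.
have xs12 : r1 <= xs <= r2.
  have [x0 [y0 [[B1 B2 _] /andP[Bx1 Bx2] _]]] := HB 0%N.
  by rewrite (le_trans B1 Bx1) (le_trans Bx2 B2).
have [D HD] : exists D, cderiv g (xs%:C * circle_pt ys) D.
  by apply: gd; rewrite cmod_polar//; case/andP: xs12 => /(lt_le_trans r10)/ltW.
have r20 : 0 < r2 by apply: lt_le_trans r12.
set C := 2 * (h + r2 * k) * (k + h / r1).
have Q0 : 0 <= h + r2 * k by rewrite addr_ge0// mulr_ge0// ltW.
have C0 : 0 <= C by rewrite /C mulr_ge0 ?mulr_ge0// addr_ge0 ?(ltW k0)// divr_ge0// ltW.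
suff H : forall e, 0 < e -> J0 <= e * C.
  apply/eqP; rewrite -normr_eq0 -/J0 eq_le normr_ge0 andbT.
  apply/ler_addgt0Pr => e e0; rewrite add0r.
  have c1 : 0 < C + 1 by rewrite ltr_wpDl.
  apply: (le_trans (H (e / (C + 1)) _)); first by rewrite divr_gt0.
  by rewrite mulrAC ler_pdivrMr// ler_wpM2l ?(ltW e0)// lerDl.
move=> e e0; have [dl dl0 HE] := HD _ e0.
have [n Hn] := exists_pow_lt Q0 dl0.
have [x [y [[X1 X2 X3] Bx' By']]] := HB n.
have pqE : h / 2 ^+ n + r2 * (k / 2 ^+ n) = (h + r2 * k) / 2 ^+ n by field; rewrite expf_neq0.
have p0 : 0 <= h / 2 ^+ n by exact: hp.
have q0 : 0 < k / 2 ^+ n by rewrite divr_gt0// exprn_gt0.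
have bnd := @goursat_local g r1 r2 x (h / 2 ^+ n) y (k / 2 ^+ n) xs ys D e r10 X1 X2 p0 q0 Bx' By' e0.
have {}bnd := bnd _ _.
apply: (le_trans X3); have p4 : 0 < (4 : R) ^+ n by rewrite exprn_gt0.
rewrite -ler_pdivlMl//; apply: le_trans (bnd _ _) _.
- by move=> z /andP[z1 z2]; apply: gd; rewrite (le_trans X1 z1) (le_trans z2 X2).
- by move=> w wb; apply: HE; apply: le_lt_trans wb _; rewrite pqE.
rewrite le_eqVlt; apply/orP; left; apply/eqP; rewrite /C.
have -> : (4 : R) = 2 * 2 by rewrite -natrM.
rewrite exprMn; field; by rewrite expf_neq0//= lt0r_neq0.
Qed.

(** On the two rays t = 0 and t = 2 pi the integrals cancel by periodicity, so
    the mean over a circle does not depend on its radius; let the inner radius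
    tend to 0. *)
Lemma mean_value0 g r0 r : (forall z, cmod z < r0 -> exists d, cderiv g z d) ->
  0 < r -> r < r0 -> ri 0 (2 * pi) (fun t => Re (g (r%:C * circle_pt t))) = 2 * pi * Re (g 0).
Proof.
move=> gd rp rr0.
have pi2 : 0 < 2 * pi :> R by rewrite mulr_gt0// pi_gt0.
have step s : 0 < s -> s <= r -> ri 0 (2 * pi) (fun t => Re (g (r%:C * circle_pt t))) =
    ri 0 (2 * pi) (fun t => Re (g (s%:C * circle_pt t))).
  move=> s0 sr; have := @goursat g s r 0 (2 * pi) s0 sr pi2.
  have H z : s <= cmod z <= r -> exists d, cderiv g z d by move=> zz; apply: gd; lra.
  move=> /(_ H); rewrite /bdry /polar circle_pt0 circle_pt2pi subrr subr0 => /eqP.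
  by rewrite subr_eq0 => /eqP.
have [d /cderiv_ccont g0] : exists d, cderiv g 0 d by apply: gd; rewrite cmod0; lra.
apply/eqP; rewrite -subr_eq0 -normr_eq0 eq_le normr_ge0 andbT.
apply/ler_addgt0Pr => e e0; rewrite add0r.
have [dl dl0 H] := g0 _ (divr_gt0 e0 pi2).
set s := Num.min r (dl / 2).
have s0 : 0 < s by rewrite lt_min rp divr_gt0.
have sr : s <= r by rewrite ge_min lexx.
have sd : s < dl by have : s <= dl / 2 by [rewrite ge_min lexx orbT]; lra.
have bt : bmf 0 (2 * pi) (fun t => Re (g (s%:C * circle_pt t))).
  apply: (@bmf_t g s s s) => //; first by rewrite lexx.
  move=> z zz; have [|d' /cderiv_ccont//] := gd z; lra.
rewrite (step s)//.
have -> : 2 * pi * Re (g 0) = ri 0 (2 * pi) (fun=> Re (g 0)).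
  by rewrite ri_cst ?(ltW pi2)// subr0 mulrC.
rewrite -riB//; last exact: bmf_cst.
have -> : e = e / (2 * pi) * (2 * pi - 0) by rewrite subr0 divfK// lt0r_neq0.
apply: ri_bound; [exact: ltW|apply: bmfB => //; exact: bmf_cst|].
move=> t _; rewrite -cReB; apply: (le_trans (Re_cmod _)); apply/ltW/H.
by rewrite subr0 cmod_polar// ltW.
Qed.

Lemma cderiv_shift g (a z d : R[i]) : cderiv g (a + z) d -> cderiv (fun w => g (a + w)) z d.
Proof. by move=> H e /H [dl dl0 K]; exists dl => // h /K; rewrite addrA. Qed.

Lemma mean_value g (a : R[i]) r0 r : (forall z, cmod (z - a) < r0 -> exists d, cderiv g z d) ->
  0 < r -> r < r0 -> ri 0 (2 * pi) (fun t => Re (g (a + r%:C * circle_pt t))) = 2 * pi * Re (g a).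
Proof.
move=> gd rp rr0.
rewrite (@mean_value0 (fun w => g (a + w)) r0 r) ?addr0//.
move=> z zr; have [|d Hd] := gd (a + z); first by rewrite addrAC subrr add0r.
by exists d; exact: cderiv_shift.
Qed.

End Goursat.

(** * Herglotz and Poisson integrals and the maximum principle *)

Section Herglotz.
Context {R : realType}.
Implicit Types (z w h d xi : R[i]) (t e : R) (V W : R -> R) (F G : R -> R[i]).
Local Notation Re := (@complex.Re R).
Local Notation Im := (@complex.Im R).
Local Notation pi := (@pi R).
Local Notation bm := (bmf 0 (2 * pi)).
Local Notation I := (ri 0 (2 * pi)).

Lemma pi2_gt0 : 0 < 2 * pi.
Proof. by rewrite mulr_gt0// pi_gt0. Qed.

Lemma pi2_ge0 : 0 <= 2 * pi.
Proof. exact: ltW pi2_gt0. Qed.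

Definition cbm F := bm (fun t => Re (F t)) /\ bm (fun t => Im (F t)).
Definition ci F : R[i] := I (fun t => Re (F t)) +i* I (fun t => Im (F t)).

Lemma cbm_circle (K : R[i] -> R[i]) : (forall t, ccont K (circle_pt t)) ->
  cbm (fun t => K (circle_pt t)).
Proof.
move=> Kc; have E L : (forall z, `|L z| <= cmod z) -> (forall z w, L (z - w) = L z - L w) ->
    bm (fun t => L (K (circle_pt t))).
  move=> L1 L2; have := @ccont_polar_t R K 1 0 (2 * pi) L ler01 L1 L2.
  rewrite /polar; under eq_fun do rewrite mul1r; move=> H.
  by apply/cont_on_bmf/H => t _; rewrite mul1r.
by split; apply: E; [exact: Re_cmod|exact: cReB|exact: Im_cmod|exact: cImB].
Qed.

Lemma cbmD F G : cbm F -> cbm G -> cbm (fun t => F t + G t).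
Proof.
move=> [f1 f2] [g1 g2]; split.
  by under eq_fun do rewrite cReD; exact: bmfD.
by under eq_fun do rewrite cImD; exact: bmfD.
Qed.

Lemma cbmM F G : cbm F -> cbm G -> cbm (fun t => F t * G t).
Proof.
move=> [f1 f2] [g1 g2]; split.
  by under eq_fun do rewrite cReM; apply: bmfB; exact: bmfM.
by under eq_fun do rewrite cImM; apply: bmfD; exact: bmfM.
Qed.

Lemma cbm_cst (k : R[i]) : cbm (fun=> k).
Proof. by split; exact: bmf_cst. Qed.

Lemma cbm_real V : bm V -> cbm (fun t => (V t)%:C).
Proof. by move=> hV; split => //=; exact: bmf_cst. Qed.

Lemma cbmN F : cbm F -> cbm (fun t => - F t).
Proof. by move=> /(cbmM (cbm_cst (-1))); under eq_fun do rewrite mulN1r. Qed.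

Lemma cbmB F G : cbm F -> cbm G -> cbm (fun t => F t - G t).
Proof. by move=> hF /cbmN; exact: cbmD. Qed.

Lemma ciD F G : cbm F -> cbm G -> ci (fun t => F t + G t) = ci F + ci G.
Proof.
move=> [f1 f2] [g1 g2]; apply/eqP; rewrite eq_complex /=; apply/andP; split; apply/eqP.
  by rewrite -riD//; apply: eq_ri => t _; rewrite cReD.
by rewrite -riD//; apply: eq_ri => t _; rewrite cImD.
Qed.

Lemma ciZ (k : R[i]) F : cbm F -> ci (fun t => k * F t) = k * ci F.
Proof.
move=> [f1 f2]; apply/eqP; rewrite eq_complex cReM cImM /=; apply/andP; split; apply/eqP.
  rewrite -!riZ// -riB//; try exact: bmfZ.
  by apply: eq_ri => t _; rewrite cReM.
rewrite -!riZ// -riD//; try exact: bmfZ.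
by apply: eq_ri => t _; rewrite cImM.
Qed.

Lemma ciN F : cbm F -> ci (fun t => - F t) = - ci F.
Proof.
by move=> hF; rewrite -mulN1r -ciZ//; congr (_ +i* _); apply: eq_ri => t _; rewrite mulN1r.
Qed.

Lemma ciB F G : cbm F -> cbm G -> ci (fun t => F t - G t) = ci F - ci G.
Proof. by move=> hF hG; rewrite ciD ?ciN//; exact: cbmN. Qed.

Lemma eq_ci F G : (forall t, F t = G t) -> ci F = ci G.
Proof. by move=> FG; congr ci; apply/funext. Qed.

Lemma ci_bound F V : cbm F -> bm V -> (forall t, 0 <= t <= 2 * pi -> cmod (F t) <= V t) ->
  cmod (ci F) <= 2 * I V.
Proof.
move=> [f1 f2] hV FV; apply: (le_trans (cmod_ReIm _)) => /=.
have E L : bm (fun t => L (F t)) -> (forall z, `|L z| <= cmod z) -> `|I (fun t => L (F t))| <= I V.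
  move=> hL L1; apply: (le_trans (ri_abs hL)); apply: ri_le => //; first exact: bmf_norm.
  by move=> t tt; apply: (le_trans (L1 _)); exact: FV.
have := E _ f1 Re_cmod; have := E _ f2 Im_cmod; lra.
Qed.

Lemma circle_sub_ge z t : 1 - cmod z <= cmod (circle_pt t - z).
Proof. by have := cmod_lerB (circle_pt t) z; rewrite circle_pt_cmod. Qed.

Lemma circle_sub_neq0 z t : cmod z < 1 -> circle_pt t - z != 0.
Proof. by move=> z1; rewrite -cmod_gt0; apply: lt_le_trans (circle_sub_ge z t); rewrite subr_gt0. Qed.

(** The Herglotz kernel, with derivative [hk'] in z; on the circle its real
    part is the Poisson kernel [pk]. *)
Definition hk z xi : R[i] := (xi + z) / (xi - z).
Definition hk' z xi : R[i] := 2 * xi / (xi - z) ^+ 2.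

Lemma cbm_hk z : cmod z < 1 -> cbm (fun t => hk z (circle_pt t)).
Proof.
move=> z1; apply: cbm_circle => t; apply: cderiv_ccont.
apply: cderivM; first exact: (cderivD (cderiv_id _) (cderiv_cst z _)).
by apply: cderivV (cderivD (cderiv_id _) (cderiv_cst (- z) _)); exact: circle_sub_neq0.
Qed.

Lemma cbm_hk' z : cmod z < 1 -> cbm (fun t => hk' z (circle_pt t)).
Proof.
move=> z1; apply: cbm_circle => t.
have [d Hd] := cderivX 2 (cderivD (cderiv_id (circle_pt t)) (cderiv_cst (- z) _)).
apply: cderiv_ccont; apply: cderivM; first exact: (cderivM (cderiv_cst 2 _) (cderiv_id _)).
by apply: cderivV Hd; rewrite expf_neq0//; exact: circle_sub_neq0.
Qed.

Definition herglotz V z : R[i] := ci (fun t => hk z (circle_pt t) * (V t)%:C) / (2 * pi)%:C.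
Definition herglotz' V z : R[i] := ci (fun t => hk' z (circle_pt t) * (V t)%:C) / (2 * pi)%:C.

(** A quadratic remainder uniform in the boundary point, so that it can be
    integrated to differentiate [herglotz] under the integral sign. *)
Lemma hk_taylor z h t : cmod z < 1 -> cmod h <= (1 - cmod z) / 2 ->
  cmod (hk (z + h) (circle_pt t) - hk z (circle_pt t) - hk' z (circle_pt t) * h) <=
  4 / (1 - cmod z) ^+ 3 * cmod h ^+ 2.
Proof.
move=> z1 hz; set d := 1 - cmod z in hz *.
have d0 : 0 < d by rewrite subr_gt0.
have zh1 : cmod (z + h) < 1 by apply: (le_lt_trans (cmodD _ _)); rewrite /d in d0 hz; lra.
set xi : R[i] := circle_pt t.
have n1 : xi - z != 0 := circle_sub_neq0 t z1.
have n2 : xi - (z + h) != 0 := circle_sub_neq0 t zh1.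
have -> : hk (z + h) xi - hk z xi - hk' z xi * h = 2 * xi * h ^+ 2 / ((xi - z) ^+ 2 * (xi - (z + h))).
  by rewrite /hk /hk'; field; rewrite n1 n2.
have b1 : d <= cmod (xi - z) := circle_sub_ge z t.
have b2 : d / 2 <= cmod (xi - (z + h)).
  apply: le_trans (circle_sub_ge (z + h) t); have := cmodD z h; rewrite /d in hz *; lra.
rewrite cmodM cmodV (cmodM (2 * xi)) (cmodM 2) (cmodM (_ ^+ 2)) !cmodX (circle_pt_cmod t) mulr1.
have -> : cmod (2 : R[i]) = 2 by rewrite (_ : (2 : R[i]) = (2 : R)%:C) ?cmod_real ?ger0_norm// rmorph_nat.
rewrite ler_pdivrMr; last by rewrite mulr_gt0 ?exprn_gt0 ?cmod_gt0.
have b3 : d ^+ 2 * (d / 2) <= cmod (xi - z) ^+ 2 * cmod (xi - (z + h)).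
  apply: ler_pM => //; rewrite ?exprn_ge0 ?divr_ge0 ?(ltW d0)//.
  by rewrite ler_pXn2r ?nnegrE ?cmod_ge0 ?(ltW d0).
have H : 0 <= 4 / d ^+ 3 * cmod h ^+ 2.
  by rewrite mulr_ge0 ?exprn_ge0 ?cmod_ge0// divr_ge0// exprn_ge0// ltW.
apply: le_trans (ler_wpM2l H b3).
rewrite le_eqVlt; apply/orP; left; apply/eqP; field; exact: lt0r_neq0.
Qed.

Lemma herglotz_taylor V z h : bm V -> cmod z < 1 -> cmod h <= (1 - cmod z) / 2 ->
  cmod (herglotz V (z + h) - herglotz V z - herglotz' V z * h) <=
  8 / (1 - cmod z) ^+ 3 * I (fun t => `|V t|) * cmod h ^+ 2.
Proof.
move=> hV z1 hz.
have d0 : 0 < 1 - cmod z by rewrite subr_gt0.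
have zh1 : cmod (z + h) < 1 by apply: (le_lt_trans (cmodD _ _)); lra.
have cV := cbm_real hV.
have c1 := cbmM (cbm_hk zh1) cV; have c2 := cbmM (cbm_hk z1) cV; have c3 := cbmM (cbm_hk' z1) cV.
have c3' := cbmM (cbm_cst h) c3.
have E : herglotz V (z + h) - herglotz V z - herglotz' V z * h =
  ci (fun t => (hk (z + h) (circle_pt t) - hk z (circle_pt t) - hk' z (circle_pt t) * h) * (V t)%:C) / (2 * pi)%:C.
  rewrite /herglotz /herglotz' -mulrBl mulrAC -mulrBl; congr (_ / _).
  rewrite -ciB// (mulrC (ci _) h) -ciZ// -ciB//; last exact: cbmB.
  by apply: eq_ci => t; ring.
rewrite E cmodM cmodV cmod_real (gtr0_norm pi2_gt0) ler_pdivrMr ?pi2_gt0//.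
set K := 4 / (1 - cmod z) ^+ 3 * cmod h ^+ 2.
have K0 : 0 <= K by rewrite mulr_ge0 ?exprn_ge0 ?cmod_ge0// divr_ge0// exprn_ge0// ltW.
have aV := bmf_norm hV.
apply: le_trans (@ci_bound _ (fun t => K * `|V t|) _ _ _) _.
- apply: cbmM => //; apply: cbmB; first by apply: cbmB; exact: cbm_hk.
  by apply: cbmM; [exact: cbm_hk'|exact: cbm_cst].
- exact: bmfZ.
- by move=> t _; rewrite cmodM cmod_real ler_wpM2r//; exact: hk_taylor.
rewrite riZ//.
have IV0 : 0 <= I (fun t => `|V t|) by apply: ri_ge0.
have -> : 2 * (K * I (fun t => `|V t|)) = 8 / (1 - cmod z) ^+ 3 * I (fun t => `|V t|) * cmod h ^+ 2.
  by rewrite /K; field; exact: lt0r_neq0.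
rewrite ler_peMr//; last by have := pi_ge2 R; lra.
by rewrite !mulr_ge0 ?exprn_ge0 ?cmod_ge0// ?invr_ge0 ?exprn_ge0// ltW.
Qed.

Lemma taylor_cderiv (f : R[i] -> R[i]) z d (c r : R) : 0 < r ->
  (forall h, cmod h <= r -> cmod (f (z + h) - f z - d * h) <= c * cmod h ^+ 2) -> cderiv f z d.
Proof.
move=> r0 H e e0.
have c1 : 0 < `|c| + 1 by rewrite ltr_wpDl.
exists (Num.min r (e / (`|c| + 1))); first by rewrite lt_min r0 divr_gt0.
move=> h; rewrite lt_min => /andP[h1 h2]; apply: (le_trans (H _ (ltW h1))).
rewrite expr2 mulrA ler_wpM2r ?cmod_ge0//.
apply: (@le_trans _ _ ((`|c| + 1) * cmod h)).
  by rewrite ler_wpM2r ?cmod_ge0//; have := ler_norm c; lra.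
by rewrite mulrC -ler_pdivlMr// ltW.
Qed.

Lemma cderiv_herglotz V z : bm V -> cmod z < 1 -> cderiv (herglotz V) z (herglotz' V z).
Proof.
move=> hV z1; apply: (@taylor_cderiv _ _ _ _ ((1 - cmod z) / 2)); first by rewrite divr_gt0// subr_gt0.
by move=> h hz; exact: herglotz_taylor.
Qed.

Definition pk z xi : R := (1 - cmod z ^+ 2) / cmod (xi - z) ^+ 2.

Lemma Re_hk z xi : cmod xi = 1 -> Re (hk z xi) = pk z xi.
Proof.
move=> x1; rewrite /hk /pk.
have : cmod xi ^+ 2 = 1 by rewrite x1 expr1n.
rewrite !cmod_sqr cReB cImB; case: xi {x1} => a b; case: z => x y /= => H.
rewrite -H; set N := _ ^+ 2 + _ ^+ 2.
have [N0|N0] := eqVneq N 0; first by rewrite N0 invr0 !mulr0 oppr0 mulr0 subr0.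
by field.
Qed.

Definition poisson V z : R := I (fun t => pk z (circle_pt t) * V t) / (2 * pi).

Lemma bm_pk z : cmod z < 1 -> bm (fun t => pk z (circle_pt t)).
Proof.
move=> /cbm_hk [h1 _]; suff <- : (fun t => Re (hk z (circle_pt t))) = (fun t => pk z (circle_pt t)) by [].
by apply/funext => t; rewrite Re_hk// circle_pt_cmod.
Qed.

Lemma pk_ge0 z xi : cmod z < 1 -> 0 <= pk z xi.
Proof.
by move=> z1; rewrite divr_ge0 ?exprn_ge0 ?cmod_ge0// subr_ge0 expr_le1// ?cmod_ge0// ltW.
Qed.

Lemma Re_herglotz V z : bm V -> cmod z < 1 -> Re (herglotz V z) = poisson V z.
Proof.
move=> hV z1; rewrite /herglotz /poisson.
have -> : ((2 * pi)%:C)^-1 = ((2 * pi)^-1)%:C :> R[i] by rewrite rmorphV//= unitfE lt0r_neq0// pi2_gt0.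
rewrite cReM /= mulr0 subr0; congr (_ / _).
by apply: eq_ri => t _; rewrite cReM /= mulr0 subr0 Re_hk// circle_pt_cmod.
Qed.

Lemma poissonD V W z : bm V -> bm W -> cmod z < 1 -> poisson (fun t => V t + W t) z = poisson V z + poisson W z.
Proof.
move=> hV hW z1; rewrite /poisson -mulrDl -riD; [|apply: bmfM => //; exact: bm_pk..].
by congr (_ / _); apply: eq_ri => t _; rewrite mulrDr.
Qed.

Lemma poissonZ (k : R) V z : bm V -> cmod z < 1 -> poisson (fun t => k * V t) z = k * poisson V z.
Proof.
move=> hV z1; rewrite /poisson mulrA -riZ; last by apply: bmfM => //; exact: bm_pk.
by congr (_ / _); apply: eq_ri => t _; rewrite mulrCA.
Qed.

Lemma poissonN V z : bm V -> cmod z < 1 -> poisson (fun t => - V t) z = - poisson V z.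
Proof.
move=> hV z1; rewrite -mulN1r -poissonZ//; congr poisson; apply/funext => t; by rewrite mulN1r.
Qed.

Lemma poissonB V W z : bm V -> bm W -> cmod z < 1 -> poisson (fun t => V t - W t) z = poisson V z - poisson W z.
Proof. by move=> hV hW z1; rewrite poissonD ?poissonN//; exact: bmfN. Qed.

Lemma poisson_le V W z : bm V -> bm W -> cmod z < 1 -> (forall t, 0 <= t <= 2 * pi -> V t <= W t) ->
  poisson V z <= poisson W z.
Proof.
move=> hV hW z1 VW; rewrite /poisson ler_wpM2r ?invr_ge0 ?pi2_ge0//.
apply: ri_le; [apply: bmfM => //; exact: bm_pk..|].
by move=> t tt; rewrite ler_wpM2l ?pk_ge0//; exact: VW.
Qed.

(** On the circle pk z is the real part of f(xi) = (1 + z^* xi) / (1 - z^*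
    xi), which is holomorphic on a larger disk with f(0) = 1. *)
Lemma ri_pk z : cmod z < 1 -> I (fun t => pk z (circle_pt t)) = 2 * pi.
Proof.
move=> z1; have zp : 0 < 1 + cmod z by rewrite ltr_wpDr ?cmod_ge0.
pose f (eta : R[i]) : R[i] := (1 + z^* * eta) / (1 - z^* * eta).
have fd (eta : R[i]) : cmod eta < 2 / (1 + cmod z) -> exists d, cderiv f eta d.
  rewrite ltr_pdivlMr// => eta1.
  eexists; apply: cderivM; first exact: (cderivD (cderiv_cst 1 _) (cderivM (cderiv_cst z^* _) (cderiv_id _))).
  have := (cderivD (cderiv_cst 1 eta) (cderivM (cderiv_cst (- z^*) eta) (cderiv_id eta))).
  under [X in cderiv X]eq_fun do rewrite /= mulNr.
  apply: cderivV; rewrite -cmod_gt0; apply: lt_le_trans (cmod_lerB _ _).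
  rewrite cmod1 subr_gt0 cmodM cmod_conj.
  have [->|e0] := eqVneq (cmod eta) 0; first by rewrite mulr0.
  have : 0 < cmod eta by rewrite lt_neqAle eq_sym e0 cmod_ge0.
  by move: eta1 z1 (cmod_ge0 z); nra.
have := mean_value0 fd ltr01; rewrite ltr_pdivlMr// mul1r => /(_ ltac:(lra)).
rewrite {2}/f !mulr0 addr0 subr0 divr1 => E0.
transitivity (I (fun t => Re (f (1%:C * circle_pt t)))); last by rewrite E0 mulr1.
apply: eq_ri => t _; rewrite mul1r -Re_hk ?circle_pt_cmod// /f /hk.
have xx : circle_pt t * (circle_pt t)^* = 1 :> R[i].
  have := cos2Dsin2 t; rewrite /circle_pt => c; apply/eqP; rewrite eq_complex /=.
  by rewrite !mulrN opprK -!expr2 c eqxx /= mulrC addNr.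
have n1 : circle_pt t - z != 0 := circle_sub_neq0 t z1.
have E : (1 + z^* * circle_pt t) / (1 - z^* * circle_pt t) = ((circle_pt t + z) / (circle_pt t - z))^*.
  have n2 : (circle_pt t)^* - z^* != 0 by rewrite -rmorphB /= conjc_eq0.
  have n3 : circle_pt t != 0 :> R[i] := circle_pt_neq0 t.
  rewrite rmorphM /= conjc_inv rmorphD rmorphB /= -[in LHS]xx.
  rewrite (mulrC z^*) -mulrDr -mulrBr invfM mulrACA divff// mul1r//.
by rewrite E; case: (_ / _).
Qed.

Lemma poisson_cst (k : R) z : cmod z < 1 -> poisson (fun=> k) z = k.
Proof.
move=> z1; rewrite /poisson.
under eq_ri do rewrite mulrC.
by rewrite riZ ?ri_pk ?mulfK ?lt0r_neq0 ?pi2_gt0//; exact: bm_pk.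
Qed.

(** Bisection of a square containing the disk: keep a subsquare in which every
    value of u on the disk is reached or exceeded. By continuity u is maximal
    at the common point. *)
Lemma disk_max (u : R[i] -> R) :
  (forall z, cmod z <= 1 -> forall e, 0 < e -> exists2 dl, 0 < dl &
     forall w, cmod w <= 1 -> cmod (w - z) < dl -> `|u w - u z| < e) ->
  exists2 m, cmod m <= 1 & forall z, cmod z <= 1 -> u z <= u m.
Proof.
move=> uc.
pose sq n (x y : R) (w : R[i]) := [/\ cmod w <= 1, x <= Re w <= x + 2 / 2 ^+ n & y <= Im w <= y + 2 / 2 ^+ n].
pose Bad n (x y : R) := forall z, cmod z <= 1 -> exists2 w, sq n x y w & u z <= u w.
have half n : 2 / 2 ^+ n = 2 / 2 ^+ n.+1 + 2 / 2 ^+ n.+1 :> R.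
  by rewrite exprS; field; rewrite expf_neq0.
have [||||xs [ys H]] := @nested_quarters R Bad (-1) (-1) 2 2 => //.
- move=> z z1; exists z => //; split => //.
    by have := Re_cmod z; rewrite ler_norml expr0 divr1; lra.
  by have := Im_cmod z; rewrite ler_norml expr0 divr1; lra.
- move=> n x y B; apply: contrapT => nB.
  set p := 2 / 2 ^+ n.+1 in nB.
  have key x' y' : x' = x \/ x' = x + p -> y' = y \/ y' = y + p ->
      exists2 z, cmod z <= 1 & forall w, sq n.+1 x' y' w -> u w < u z.
    move=> hx hy; apply: contrapT => nE; apply: nB; exists x', y'; split => // z z1.
    apply: contrapT => nw; apply: nE; exists z => // w sw.
    by rewrite ltNge; apply/negP => zw; apply: nw; exists w.
  have [z1 d1 H1] := key x y (or_introl erefl) (or_introl erefl).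
  have [z2 d2 H2] := key x (y + p) (or_introl erefl) (or_intror erefl).
  have [z3 d3 H3] := key (x + p) y (or_intror erefl) (or_introl erefl).
  have [z4 d4 H4] := key (x + p) (y + p) (or_intror erefl) (or_intror erefl).
  have [zm dm Hm] : exists2 z, cmod z <= 1 & [/\ u z1 <= u z, u z2 <= u z, u z3 <= u z & u z4 <= u z].
    have two (a b : R[i]) : cmod a <= 1 -> cmod b <= 1 -> exists2 c, cmod c <= 1 & u a <= u c /\ u b <= u c.
      by move=> ha hb; have [ab|/ltW ab] := leP (u a) (u b); [exists b|exists a].
    have [a ha [a1 a2]] := two _ _ d1 d2; have [b hb [b1 b2]] := two _ _ d3 d4.
    have [c hc [c1 c2]] := two _ _ ha hb; exists c => //; split; [exact: le_trans c1|exact: le_trans c1|exact: le_trans c2|exact: le_trans c2].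
  have [w [w1 wx wy] uw] := B zm dm; case: Hm => m1 m2 m3 m4.
  rewrite (half n) -/p !addrA in wx wy.
  have [xl|xl] := leP (Re w) (x + p); have [yl|yl] := leP (Im w) (y + p).
  + have := H1 w; suff sw : sq n.+1 x y w by move=> /(_ sw); lra.
    by split; rewrite -/p; [|case/andP: wx => -> _|case/andP: wy => -> _].
  + have := H2 w; suff sw : sq n.+1 x (y + p) w by move=> /(_ sw); lra.
    by split; rewrite -/p; [|case/andP: wx => -> _|rewrite ltW//; case/andP: wy].
  + have := H3 w; suff sw : sq n.+1 (x + p) y w by move=> /(_ sw); lra.
    by split; rewrite -/p; [|rewrite ltW//; case/andP: wx|case/andP: wy => -> _].
  + have := H4 w; suff sw : sq n.+1 (x + p) (y + p) w by move=> /(_ sw); lra.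
    by split; rewrite -/p; [|rewrite ltW//; case/andP: wx|rewrite ltW//; case/andP: wy].
pose m : R[i] := xs +i* ys.
have near dl z : 0 < dl -> cmod z <= 1 -> exists w, [/\ cmod w <= 1, cmod (w - m) < dl & u z <= u w].
  move=> dl0 z1; have [n Hn] := @exists_pow_lt R 4 dl ltac:(lra) dl0.
  have [x [y [B hx hy]]] := H n; have [w [w1 wx wy] uw] := B z z1.
  exists w; split => //; apply: le_lt_trans (cmod_ReIm _) _; apply: le_lt_trans Hn.
  have -> : 4 / 2 ^+ n = 2 / 2 ^+ n + 2 / 2 ^+ n :> R by field; rewrite expf_neq0.
  rewrite cReB cImB /=; apply: lerD; rewrite ler_norml; move: wx wy hx hy; set q := 2 / _; lra.
have m1 : cmod m <= 1.
  apply/ler_addgt0Pr => e e0; have [w [w1 wm _]] := near e 0 e0 (ltW (eq_ind_r (fun x => x < 1) ltr01 cmod0)).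
  have := cmod_lerB m (m - w); rewrite subKr cmodBC; lra.
exists m => // z z1; apply/ler_addgt0Pr => e e0.
have [dl dl0 K] := uc m m1 e e0; have [w [w1 wm uw]] := near dl z dl0 z1.
by have := K w w1 wm; rewrite ltr_norml; lra.
Qed.

Definition ccont_disk (u : R[i] -> R) := forall z, cmod z <= 1 -> forall e, 0 < e ->
  exists2 dl, 0 < dl & forall w, cmod w <= 1 -> cmod (w - z) < dl -> `|u w - u z| < e.

(** Local in the radius: the minorant used for |g|^q holds only on small
    circles, and small circles suffice for the maximum principle. *)
Definition submean (u : R[i] -> R) a := exists2 r0, 0 < r0 &
  forall r, 0 < r -> r < r0 -> 2 * pi * u a <= I (fun t => u (a + r%:C * circle_pt t)).

Lemma bm_disk_circle (u : R[i] -> R) a r : ccont_disk u -> 0 < r -> cmod a + r <= 1 ->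
  bm (fun t => u (a + r%:C * circle_pt t)).
Proof.
move=> uc r0 ar; apply: cont_on_bmf => t _ e e0.
have inD s : cmod (a + r%:C * circle_pt s) <= 1.
  by apply: (le_trans (cmodD _ _)); rewrite cmod_polar// ltW.
have [dl dl0 H] := uc _ (inD t) _ e0.
exists (dl / r); first by rewrite divr_gt0.
move=> s _ st; apply: H => //.
rewrite opprD addrACA subrr add0r -mulrBr cmodM cmod_real gtr0_norm//.
by rewrite mulrC -ltr_pdivlMr//; apply: le_lt_trans st; exact: chord_le.
Qed.

Lemma ri_cmod2_circle a r : I (fun t => cmod (a + r%:C * circle_pt t) ^+ 2) = 2 * pi * (cmod a ^+ 2 + r ^+ 2).
Proof.
have E t : cmod (a + r%:C * circle_pt t) ^+ 2 =
   (cmod a ^+ 2 + r ^+ 2) + 2 * r * (Re a * cos t - (- Im a) * sin t).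
  rewrite !cmod_sqr cReD cImD cReM cImM /= !mul0r subr0 addr0.
  by have := cos2Dsin2 t; nra.
under eq_ri do rewrite E.
have b1 : bm (fun t => Re a * cos t - (- Im a) * sin t).
  have [h _] := @cbm_circle (fun z => a^* * z) (fun t => cderiv_ccont (cderivM (cderiv_cst (a^*) _) (cderiv_id _))).
  move: h; congr bm; apply/funext => t; rewrite cReM; by case: (a).
rewrite riD; [|exact: bmf_cst|exact: bmfZ].
have c2 : cos (2 * pi) = 1 by rewrite mulr2n mulrDl mul1r cos2pi.
have s2 : sin (2 * pi) = 0 by rewrite mulr2n mulrDl mul1r sin2pi.
rewrite riZ// ri_cst ?pi2_ge0// ri_cos_sin ?pi2_gt0// c2 s2 cos0 sin0.
ring.
Qed.

(** Adding a small multiple of |z|^2 - 1 makes the submean inequality strict,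
    which excludes an interior maximum. *)
Theorem max_principle (u : R[i] -> R) : ccont_disk u ->
  (forall z, cmod z < 1 -> submean u z) -> (forall z, cmod z = 1 -> u z <= 0) ->
  forall z, cmod z <= 1 -> u z <= 0.
Proof.
move=> uc us ub z z1; apply/ler_addgt0Pr => e e0; rewrite add0r.
pose v w := u w + e * (cmod w ^+ 2 - 1).
have vc : ccont_disk v.
  move=> w w1 e' e'0; have e2 : 0 < e' / 2 by rewrite divr_gt0.
  have [dl dl0 H] := uc w w1 _ e2.
  exists (Num.min dl (e' / 2 / (2 * e))); first by rewrite lt_min dl0 !divr_gt0// mulr_gt0.
  move=> x x1; rewrite lt_min => /andP[xd xe]; have := H x x1 xd.
  have b : `|e * (cmod x ^+ 2 - cmod w ^+ 2)| < e' / 2.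
    rewrite subr_sqr normrM gtr0_norm// normrM -ltr_pdivlMl//.
    have k1 : `|cmod x - cmod w| <= cmod (x - w).
      by rewrite ler_norml; have := cmod_lerB x w; have := cmod_lerB w x; rewrite (cmodBC w); lra.
    have k2 : `|cmod x + cmod w| <= 2 by rewrite ger0_norm ?addr_ge0 ?cmod_ge0//; lra.
    apply: (@le_lt_trans _ _ (cmod (x - w) * 2)); first exact: ler_pM.
    by rewrite -ltr_pdivlMr//; move: xe; congr (_ < _); field; exact: lt0r_neq0.
  move=> a; have -> : v x - v w = (u x - u w) + e * (cmod x ^+ 2 - cmod w ^+ 2) by rewrite /v; ring.
  by apply: (le_lt_trans (ler_normD _ _)); lra.
have [m m1 Hm] := disk_max vc.
have vm : v m <= 0.
  have [me|mne] := eqVneq (cmod m) 1.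
    by rewrite /v me expr1n subrr mulr0 addr0; exact: ub.
  have ml : cmod m < 1 by rewrite lt_neqAle mne.
  have [r0 r00 Hr] := us m ml.
  set r := Num.min (r0 / 2) ((1 - cmod m) / 2).
  have rp : 0 < r by rewrite lt_min !divr_gt0// subr_gt0.
  have rr0 : r < r0 by have : r <= r0 / 2 by [rewrite ge_min lexx]; lra.
  have rm : cmod m + r <= 1 by have : r <= (1 - cmod m) / 2 by [rewrite ge_min lexx orbT]; lra.
  have bu := bm_disk_circle uc rp rm; have bv := bm_disk_circle vc rp rm.
  have bs : bm (fun t => cmod (m + r%:C * circle_pt t) ^+ 2).
    have := bmfD (bmfZ e^-1 (bmfB bv bu)) (bmf_cst 0 (2 * pi) 1).
    congr bm; apply/funext => t; rewrite /v; field; exact: lt0r_neq0.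
  have : I (fun t => v (m + r%:C * circle_pt t)) <= I (fun=> v m).
    apply: ri_le => //; first exact: bmf_cst.
    move=> t _; apply: Hm; apply: (le_trans (cmodD _ _)); by rewrite cmod_polar// ltW.
  rewrite ri_cst ?pi2_ge0// subr0 {1}/v riD//; last by apply: bmfZ; apply: bmfB => //; exact: bmf_cst.
  rewrite riZ; last by apply: bmfB => //; exact: bmf_cst.
  rewrite riB//; last exact: bmf_cst.
  rewrite ri_cmod2_circle ri_cst ?pi2_ge0//.
  have := Hr r rp rr0; have := pi2_gt0; rewrite /v.
  set P := 2 * pi; set Q := I _; move=> P0 hQ hh.
  have k : 0 < P * e * r ^+ 2 by rewrite mulr_gt0 ?exprn_gt0// mulr_gt0.
  clear -k hQ hh; nra.
have := le_trans (Hm z z1) vm; rewrite /v.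
have : 0 <= e * cmod z ^+ 2 by rewrite mulr_ge0 ?exprn_ge0 ?cmod_ge0// ltW.
by lra.
Qed.

Lemma ccont_disk_D (u v : R[i] -> R) : ccont_disk u -> ccont_disk v -> ccont_disk (fun z => u z + v z).
Proof.
move=> hu hv z z1 e e0; have e2 : 0 < e / 2 by rewrite divr_gt0.
have [d1 p1 H1] := hu z z1 _ e2; have [d2 p2 H2] := hv z z1 _ e2.
exists (Num.min d1 d2); first by rewrite lt_min p1.
move=> w w1; rewrite lt_min => /andP[wd1 wd2].
have := H1 w w1 wd1; have := H2 w w1 wd2.
rewrite opprD addrACA => a b; apply: (le_lt_trans (ler_normD _ _)); lra.
Qed.

Lemma ccont_disk_N (u : R[i] -> R) : ccont_disk u -> ccont_disk (fun z => - u z).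
Proof.
move=> hu z z1 e e0; have [d1 p1 H1] := hu z z1 _ e0; exists d1 => // w w1 wd.
by rewrite -opprD normrN; exact: H1.
Qed.

Definition poisson_ext (v : R[i] -> R) z : R :=
  if cmod z < 1 then poisson (fun t => v (circle_pt t)) z else v z.

Definition circle_cont (v : R[i] -> R) := forall z, cmod z = 1 -> forall e, 0 < e ->
  exists2 dl, 0 < dl & forall w, cmod w = 1 -> cmod (w - z) < dl -> `|v w - v z| < e.

Lemma circle_cont_bm (v : R[i] -> R) : circle_cont v -> bm (fun t => v (circle_pt t)).
Proof.
move=> vc; apply: cont_on_bmf => t _ e e0.
have [dl dl0 H] := vc _ (circle_pt_cmod t) _ e0; exists dl => // s _ st.
by apply: H; [exact: circle_pt_cmod|apply: le_lt_trans st; exact: chord_le].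
Qed.

(** Away from the point approached the Poisson kernel tends to zero uniformly,
    and it has total mass one. *)
Lemma poisson_boundary (v : R[i] -> R) xi e : circle_cont v -> cmod xi = 1 -> 0 < e ->
  exists2 dl, 0 < dl & forall z, cmod z < 1 -> cmod (z - xi) < dl ->
    `|poisson (fun t => v (circle_pt t)) z - v xi| < e.
Proof.
move=> vc x1 e0; have e2 : 0 < e / 2 by rewrite divr_gt0.
have bv := circle_cont_bm vc.
have [_ [M HM]] := bv.
have [dl dl0 H] := vc _ x1 _ e2.
set N : R := `|M| + `|v xi|.
have N0 : 0 <= N by rewrite addr_ge0.
set c := 8 * N / dl ^+ 2.
have dl2 : 0 < dl ^+ 2 by rewrite exprn_gt0.
have c0 : 0 <= c by rewrite divr_ge0 ?(ltW dl2)// mulr_ge0.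
exists (Num.min (dl / 2) (e / 2 / (c + 1))).
  by rewrite lt_min !divr_gt0// ltr_wpDl.
move=> z z1; rewrite lt_min => /andP[zd ze].
have b0 : bm (fun=> v xi) by exact: bmf_cst.
have bd : bm (fun t => v (circle_pt t) - v xi) by exact: bmfB.
rewrite -[v xi](poisson_cst (v xi) z1) -poissonB//.
have dz : 1 - cmod z <= cmod (z - xi) by have := cmod_lerB xi z; rewrite x1 cmodBC.
have key t : 0 <= t <= 2 * pi -> `|pk z (circle_pt t) * (v (circle_pt t) - v xi)| <=
    e / 2 * pk z (circle_pt t) + c * cmod (z - xi).
  move=> tt; rewrite normrM ger0_norm ?pk_ge0//.
  have p0 := @pk_ge0 z (circle_pt t) z1.
  have q0 : 0 <= c * cmod (z - xi) by rewrite mulr_ge0 ?cmod_ge0.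
  have [near|far] := ltP (cmod (circle_pt t - xi)) dl.
    have := H _ (circle_pt_cmod t) near => hh; rewrite mulrC.
    have : `|v (circle_pt t) - v xi| * pk z (circle_pt t) <= e / 2 * pk z (circle_pt t) by rewrite ler_wpM2r// ltW.
    lra.
  have vN : `|v (circle_pt t) - v xi| <= N.
    apply: (le_trans (ler_normB _ _)); rewrite lerD2r; apply: le_trans (ler_norm M); exact: HM.
  have pf : pk z (circle_pt t) <= 8 / dl ^+ 2 * cmod (z - xi).
    have far2 : dl / 2 <= cmod (circle_pt t - z).
      have := cmodD (circle_pt t - z) (z - xi); rewrite addrA subrK; lra.
    rewrite /pk ler_pdivrMr; last by rewrite exprn_gt0//; apply: lt_le_trans far2; rewrite divr_gt0.
    have f2 : (dl / 2) ^+ 2 <= cmod (circle_pt t - z) ^+ 2 by rewrite ler_pXn2r ?nnegrE ?cmod_ge0 ?divr_ge0 ?(ltW dl0).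
    have g2 : 1 - cmod z ^+ 2 <= 2 * cmod (z - xi) by have := cmod_ge0 z; nra.
    have h0 : 0 <= 8 / dl ^+ 2 * cmod (z - xi) by rewrite mulr_ge0 ?cmod_ge0// divr_ge0// exprn_ge0// ltW.
    apply: (le_trans g2); apply: le_trans (ler_wpM2l h0 f2).
    by rewrite le_eqVlt; apply/orP; left; apply/eqP; field; exact: lt0r_neq0.
  have : pk z (circle_pt t) * `|v (circle_pt t) - v xi| <= 8 / dl ^+ 2 * cmod (z - xi) * N by exact: ler_pM.
  have -> : 8 / dl ^+ 2 * cmod (z - xi) * N = c * cmod (z - xi) by rewrite /c; ring.
  have : 0 <= e / 2 * pk z (circle_pt t) by rewrite mulr_ge0// ltW.
  lra.
rewrite /poisson normrM (gtr0_norm (x := (2 * pi)^-1)) ?invr_gt0 ?pi2_gt0//.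
rewrite ltr_pdivrMr ?pi2_gt0//.
have bpd : bm (fun t => pk z (circle_pt t) * (v (circle_pt t) - v xi)) by apply: bmfM => //; exact: bm_pk.
apply: (le_lt_trans (ri_abs bpd)).
apply: (@le_lt_trans _ _ (I (fun t => e / 2 * pk z (circle_pt t) + c * cmod (z - xi)))).
  apply: ri_le => //; first exact: bmf_norm.
  by apply: bmfD; [apply: bmfZ; exact: bm_pk|exact: bmf_cst].
rewrite riD; [|by apply: bmfZ; exact: bm_pk|exact: bmf_cst].
rewrite riZ ?ri_pk ?ri_cst ?pi2_ge0//; last exact: bm_pk.
rewrite subr0 -mulrDl ltr_pM2r ?pi2_gt0//.
have : c * cmod (z - xi) < e / 2.
  apply: le_lt_trans (_ : (c + 1) * cmod (z - xi) < _); first by rewrite ler_wpM2r ?cmod_ge0// lerDl.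
  by rewrite mulrC -ltr_pdivlMr// ltr_wpDl.
lra.
Qed.

Lemma poisson_ext_cont (v : R[i] -> R) : circle_cont v -> ccont_disk (poisson_ext v).
Proof.
move=> vc z zle e e0; have bv := circle_cont_bm vc.
have [z1|z1] := ltP (cmod z) 1.
  have /ccontP /(_ _ (divr_gt0 e0 (@ltr0n R 2))) [dl dl0 H] := cderiv_ccont (cderiv_herglotz bv z1).
  exists (Num.min dl (1 - cmod z)); first by rewrite lt_min dl0 subr_gt0.
  move=> w _; rewrite lt_min => /andP[wd wz].
  have w1 : cmod w < 1 by have := cmodD z (w - z); rewrite addrC subrK; lra.
  rewrite /poisson_ext z1 w1 -!Re_herglotz// -cReB.
  apply: (le_lt_trans (Re_cmod _)); have := H _ wd; rewrite (addrC z) subrK => h; lra.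
have zE : cmod z = 1 by apply/eqP; rewrite eq_le zle z1.
have [d1 p1 H1] := vc _ zE _ e0; have [d2 p2 H2] := poisson_boundary vc zE e0.
exists (Num.min d1 d2); first by rewrite lt_min p1.
move=> w wle; rewrite lt_min => /andP[wd1 wd2]; rewrite /poisson_ext zE ltxx.
case: ifPn => [w1|]; first exact: H2.
by rewrite -leNgt => w1; apply: H1 => //; apply/eqP; rewrite eq_le wle.
Qed.

(** The difference of u and the Poisson extension of its boundary values
    satisfies the hypotheses of the maximum principle. *)
Theorem poisson_majorant (u : R[i] -> R) z : ccont_disk u ->
  (forall w, cmod w < 1 -> submean u w) -> cmod z < 1 ->
  u z <= poisson (fun t => u (circle_pt t)) z.
Proof.
move=> uc us z1.
have vc : circle_cont u.
  move=> x xE e e0; have [dl dl0 H] := uc x (eq_ind_r (fun y => y <= 1) (lexx _) xE) e e0.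
  by exists dl => // w wE; apply: H; rewrite wE.
have bv := circle_cont_bm vc.
pose D w := u w + - poisson_ext u w.
have Dc : ccont_disk D by apply: ccont_disk_D => //; apply: ccont_disk_N; exact: poisson_ext_cont.
suff : D z <= 0 by rewrite /D /poisson_ext z1 subr_le0.
apply: max_principle (ltW z1) => // w w1; last by rewrite /D /poisson_ext w1 ltxx subrr.
have [r0 r00 Hr] := us w w1.
exists (Num.min r0 (1 - cmod w)); first by rewrite lt_min r00 subr_gt0.
move=> r rp; rewrite lt_min => /andP[rr0 rw].
have wr : cmod w + r <= 1 by lra.
rewrite /D riB; [|exact: bm_disk_circle|apply: bm_disk_circle => //; exact: poisson_ext_cont].
have -> : I (fun t => poisson_ext u (w + r%:C * circle_pt t)) = 2 * pi * poisson_ext u w.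
  rewrite {2}/poisson_ext w1 -Re_herglotz//.
  rewrite -(@mean_value R (herglotz (fun t => u (circle_pt t))) w (1 - cmod w) r)//.
    apply: eq_ri => t _; have i1 : cmod (w + r%:C * circle_pt t) < 1.
      by apply: (le_lt_trans (cmodD _ _)); rewrite cmod_polar ?(ltW rp)//; lra.
    by rewrite /poisson_ext i1 Re_herglotz.
  move=> x xw; exists (herglotz' (fun t => u (circle_pt t)) x); apply: cderiv_herglotz => //.
  by have := cmodD w (x - w); rewrite addrC subrK; lra.
by rewrite mulrBr lerD2r; exact: Hr.
Qed.

End Herglotz.

(** * Subharmonicity of powers of the modulus *)

Section Subharmonic.
Context {R : realType}.
Implicit Types (z w h d xi a : R[i]) (t e q r x y s k m : R) (g : R[i] -> R[i]).
Local Notation Re := (@complex.Re R).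
Local Notation Im := (@complex.Im R).
Local Notation pi := (@pi R).
Local Notation bm := (bmf 0 (2 * pi)).

Lemma ln1p_taylor s : `|s| <= 1 / 2 -> `|ln (1 + s) - s + s ^+ 2 / 2| <= 2 * `|s| ^+ 3.
Proof.
move=> hs.
pose f (t : R) : R := ln (1 + t) - t + t ^+ 2 / 2.
pose df (t : R) : R := t ^+ 2 / (1 + t).
have df1 (t : R) : -1 < t -> is_derive (t : R) (1 : R) f (df t).
  move=> t1; have t10 : 0 < 1 + t by lra.
  have d1 : is_derive (t : R) (1 : R) (fun t : R => 1 + t) 1.
    by rewrite -[X in is_derive _ _ _ X]add0r; exact: is_deriveD.
  have d2 : is_derive (t : R) (1 : R) (fun t : R => ln (1 + t)) (1 * (1 + t)^-1).
    rewrite mulrC; apply: (@is_derive1_comp R (@ln R) (fun t : R => 1 + t)) => //.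
    exact: is_derive1_ln.
  have d3 : is_derive (t : R) (1 : R) (fun t : R => t ^+ 2 / 2) (t).
    by apply: is_derive_eq; rewrite /GRing.scale /=; by field.
  rewrite /df (_ : _ / _ = 1 * (1 + t)^-1 - 1 + t); last by field; exact: lt0r_neq0.
  apply: is_deriveD.
have mvt (a b : R) : -1 < a -> a <= b -> exists2 c, c \in `[a, b] & f b - f a = df c * (b - a).
  move=> a1 ab; apply: MVT_segment => //.
    by move=> x; rewrite in_itv /= => /andP[ax _]; apply: df1; lra.
  apply: derivable_within_continuous => x; rewrite in_itv /= => /andP[ax _].
  by have [] := df1 x ltac:(lra).
have f0 : f 0 = 0 by rewrite /f addr0 ln1 subr0 expr0n /= mul0r addr0.
move: hs; rewrite ler_norml => hs.
have bnd c : `|c| <= `|s| -> -1/2 <= c -> `|df c * s| <= 2 * `|s| ^+ 3.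
  move=> cs c12; rewrite normrM exprSr mulrA ler_wpM2r// /df normrM normrX mulrC.
  have c1 : 0 < 1 + c by lra.
  apply: ler_pM; [by []|by rewrite exprn_ge0| |by rewrite ler_pXn2r ?nnegrE].
  by rewrite normfV (gtr0_norm c1) invf_ple ?posrE//; lra.
have [s0|s0] := leP 0 s.
  have [c] := mvt 0 s ltac:(lra) s0; rewrite in_itv /= f0 !subr0 /f => /andP[c0 cs] ->.
  by apply: bnd; [rewrite !ger0_norm|lra].
have [c] := mvt s 0 ltac:(lra) (ltW s0); rewrite in_itv /= f0 !sub0r /f => /andP[c0 cs] E.
rewrite -normrN E mulrN normrN.
apply: bnd; last lra.
by rewrite !ler0_norm//; lra.
Qed.

Lemma expR_quad y : -2 <= y -> 1 + y + y ^+ 2 / 4 <= expR y.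
Proof.
move=> y2; have -> : expR y = expR (y / 2) ^+ 2 by rewrite -expRM_natl -mulr_natl; congr expR; field.
have h := expR_ge1Dx (y / 2).
rewrite [leLHS](_ : _ = (1 + y / 2) ^+ 2); last by field.
by rewrite ler_pXn2r ?nnegrE ?expR_ge0//; lra.
Qed.

(** The right-hand side is harmonic in w, so integrating this bound over
    circles around 0 turns it into the submean inequality. The coefficient c
    of the second harmonic is chosen so that the quadratic remainder is
    positive definite. *)
Lemma powR_quadratic_minorant q : 0 < q -> exists2 dl, 0 < dl & exists c, forall w, cmod w < dl ->
  1 + q * Re w + c * Re (w ^+ 2) <= cmod (1 + w) `^ q.
Proof.
move=> q0; set k := q / 2.
have k0 : 0 < k by rewrite divr_gt0.
exists (Num.min (1 / 6) (Num.min (k / (114 + 30 * 60 * k)) (30 * k)^-1)).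
  rewrite !lt_min; apply/andP; split; first by rewrite divr_gt0.
  apply/andP; split; last by rewrite invr_gt0 mulr_gt0.
  by apply: divr_gt0 => //; rewrite ltr_wpDr// !mulr_ge0// ltW.
(* |1 + w|^q = exp (k ln (1 + s)) with s = 2 x + m^2; with [expR_quad] the
   two sides then differ to second order by k^2 / 2 times x^2 + y^2 *)
exists (k ^+ 2 / 2 - k); case=> x y.
rewrite !lt_min => /andP[m6 /andP[mk mk2]].
set m := cmod _ in m6 mk mk2.
have m0 : 0 <= m by exact: cmod_ge0.
have mE : x ^+ 2 + y ^+ 2 = m ^+ 2 by rewrite /m cmod_sqr.
have xm : `|x| <= m by exact: (Re_cmod (x +i* y)).
set s := 2 * x + m ^+ 2.
have sE : cmod (1 + (x +i* y)) ^+ 2 = 1 + s by rewrite cmod_sqr /= add0r /s -mE; ring.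
have xb : - m <= x <= m by rewrite -ler_norml.
have sm : `|s| <= 3 * m by rewrite ler_norml /s; nra.
have s12 : `|s| <= 1 / 2 by lra.
have s1 : 0 < 1 + s by move: s12; rewrite ler_norml; lra.
have -> : cmod (1 + (x +i* y)) `^ q = expR (k * ln (1 + s)).
  have c0 : 0 < cmod (1 + (x +i* y)).
    by rewrite lt_neqAle cmod_ge0 andbT eq_sym -sqrf_eq0 sE lt0r_neq0.
  rewrite /powR gt_eqF// -sE lnXn// /k; congr expR; rewrite -mulr_natl; by field.
have := ln1p_taylor s12; set l := ln _ => hl.
have s3 : `|s| ^+ 3 <= 27 * m ^+ 3.
  have -> : 27 * m ^+ 3 = (3 * m) ^+ 3 by ring.
  by rewrite ler_pXn2r ?nnegrE// mulr_ge0.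
have {}hl : `|l - s + s ^+ 2 / 2| <= 54 * m ^+ 3 by lra.
have hs : `|s - s ^+ 2 / 2 - (2 * x - x ^+ 2 + y ^+ 2)| <= 3 * m ^+ 3.
  have -> : s - s ^+ 2 / 2 - (2 * x - x ^+ 2 + y ^+ 2) = - (2 * x * m ^+ 2 + m ^+ 4 / 2).
    have -> : y ^+ 2 = m ^+ 2 - x ^+ 2 by rewrite -mE; ring.
    by rewrite /s; field.
  rewrite normrN ler_norml; have m2 : 0 <= m ^+ 2 by rewrite exprn_ge0.
  have e1 : m ^+ 4 = m * m ^+ 3 by rewrite -exprS.
  have e2 : m ^+ 3 = m * m ^+ 2 by rewrite -exprS.
  have m3 : 0 <= m ^+ 3 by rewrite exprn_ge0.
  by apply/andP; split; nra.
have hl1 : `|l - (2 * x - x ^+ 2 + y ^+ 2)| <= 57 * m ^+ 3.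
  have -> : l - (2 * x - x ^+ 2 + y ^+ 2) = (l - s + s ^+ 2 / 2) + (s - s ^+ 2 / 2 - (2 * x - x ^+ 2 + y ^+ 2)) by ring.
  by apply: (le_trans (ler_normD _ _)); lra.
have hl2 : `|l - 2 * x| <= 58 * m ^+ 2.
  have m32 : m ^+ 3 <= m ^+ 2 / 6 by rewrite exprS; have := exprn_ge0 2 m0; nra.
  move: hl1; rewrite !ler_norml; have := sqr_ge0 x; have := sqr_ge0 y; lra.
have kl : -2 <= k * l.
  have lm : - (60 * m) <= l by move: hl2; rewrite ler_norml; nra.
  have : k * (60 * m) <= 2.
    have : m * (30 * k) <= 1 by rewrite -ler_pdivlMr ?mulr_gt0// mul1r ltW.
    by lra.
  by move: lm k0; nra.
apply: le_trans (expR_quad kl).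
have l2 : 4 * x ^+ 2 - 60 * 60 * m ^+ 3 <= l ^+ 2.
  set u := l - 2 * x in hl2; have -> : l = 2 * x + u by rewrite /u; ring.
  have ux : `|x * u| <= m * (58 * m ^+ 2) by rewrite normrM; exact: ler_pM.
  move: ux; rewrite ler_norml (_ : m * (58 * m ^+ 2) = 58 * m ^+ 3); last by ring.
  have := sqr_ge0 u; have := exprn_ge0 3 m0; nra.
have km : (57 * k + 30 * 30 * k ^+ 2) * m <= k ^+ 2 / 2.
  have : m * (114 + 30 * 60 * k) <= k by rewrite -ler_pdivlMr ?(ltW mk)//; lra.
  by move: k0; nra.
have fin : k * (57 * m ^+ 3) + k ^+ 2 * (30 * 30 * m ^+ 3) <= k ^+ 2 / 2 * m ^+ 2.
  have -> : k * (57 * m ^+ 3) + k ^+ 2 * (30 * 30 * m ^+ 3) = (57 * k + 30 * 30 * k ^+ 2) * m * m ^+ 2 by ring.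
  by rewrite ler_wpM2r ?exprn_ge0.
have a1 : k * (2 * x - x ^+ 2 + y ^+ 2 - 57 * m ^+ 3) <= k * l.
  by rewrite ler_wpM2l ?(ltW k0)//; move: hl1; rewrite ler_norml; lra.
have a2 : k ^+ 2 * (4 * x ^+ 2 - 60 * 60 * m ^+ 3) <= k ^+ 2 * l ^+ 2 by rewrite ler_wpM2l ?exprn_ge0 ?(ltW k0).
have -> : Re ((x +i* y) ^+ 2) = x ^+ 2 - y ^+ 2 by [].
have -> : q = 2 * k by rewrite /k; field.
have -> : (k * l) ^+ 2 = k ^+ 2 * l ^+ 2 by ring.
have -> : Re (x +i* y) = x by [].
rewrite -mE in fin; clear -fin a1 a2; clearbody k l; lra.
Qed.

(** At a zero of g there is nothing to prove. Elsewhere write g = g(a) (1 + w)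
    and integrate the minorant; w and w^2 have mean value zero. *)
Lemma submean_norm_powR g a r q : 0 < q -> 0 < r ->
  (forall z, cmod (z - a) < r -> exists d, cderiv g z d) ->
  submean (fun z => cmod (g z) `^ q) a.
Proof.
move=> q0 r0 gd; have [ga|ga] := eqVneq (g a) 0.
  exists 1 => // s s0 _; rewrite ga cmod0 powR0 ?mulr0 ?lt0r_neq0//.
  by apply: ri_ge0 => t _; exact: powR_ge0.
have [dl dl0 [c Hc]] := powR_quadratic_minorant q0.
pose w z := g z / g a - 1.
have wd z : cmod (z - a) < r -> exists d, cderiv w z d.
  move=> /gd [d Hd]; exists (d * (g a)^-1 + g z * 0 + 0).
  exact: cderivD (cderivM Hd (cderiv_cst _ z)) (cderiv_cst (-1) z).
have wa : w a = 0 by rewrite /w divff// subrr.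
have w2d z : cmod (z - a) < r -> exists d, cderiv (fun z => w z ^+ 2) z d.
  by move=> /wd [d Hd]; exact: cderivX Hd.
have [da /cderiv_ccont /(_ _ dl0)] := wd a ltac:(by rewrite subrr cmod0).
rewrite wa => -[d1 d10 H1].
exists (Num.min r d1); first by rewrite lt_min r0.
move=> s s0; rewrite lt_min => /andP[sr sd].
have inr t : cmod (a + s%:C * circle_pt t - a) = s by rewrite addrC addKr cmod_polar// ltW.
have bw L (f : R[i] -> R[i]) : (forall z, `|L z| <= cmod z) -> (forall z w, L (z - w) = L z - L w) ->
    (forall z, cmod (z - a) < r -> exists d, cderiv f z d) -> bm (fun t => L (f (a + s%:C * circle_pt t))).
  move=> L1 L2 fd.
  have := @ccont_polar_t R (fun z => f (a + z)) s 0 (2 * pi) L (ltW s0) L1 L2.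
  rewrite /polar => H; apply/cont_on_bmf/H => t _.
  have [d Hd] := fd (a + s%:C * circle_pt t) ltac:(by rewrite inr).
  exact: cderiv_ccont (cderiv_shift Hd).
have G0 : 0 < cmod (g a) by rewrite cmod_gt0.
have key t : cmod (g a) `^ q * (1 + q * Re (w (a + s%:C * circle_pt t)) + c * Re (w (a + s%:C * circle_pt t) ^+ 2))
    <= cmod (g (a + s%:C * circle_pt t)) `^ q.
  set z := a + _.
  have -> : cmod (g z) = cmod (g a) * cmod (1 + w z).
    by rewrite -cmodM /w addrCA subrr addr0 mulrCA mulfV// mulr1.
  rewrite powRM ?cmod_ge0// ler_wpM2l ?powR_ge0//; apply: Hc.
  by rewrite -[w z]subr0; apply: H1; rewrite inr.
have b1 := bw Re w (@Re_cmod R) (@cReB R) wd.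
have b2 := bw Re (fun z => w z ^+ 2) (@Re_cmod R) (@cReB R) w2d.
have bg : bm (fun t => cmod (g (a + s%:C * circle_pt t)) `^ q).
  have b3 := bw Re g (@Re_cmod R) (@cReB R) gd.
  have b4 := bw Im g (@Im_cmod R) (@cImB R) gd.
  have [mf [M HM]] := bmfD (bmfX 2 b3) (bmfX 2 b4).
  have E : (fun t => cmod (g (a + s%:C * circle_pt t)) `^ q) =
     (fun u : R => u `^ (q / 2)) \o (fun t => Re (g (a + s%:C * circle_pt t)) ^+ 2 + Im (g (a + s%:C * circle_pt t)) ^+ 2).
    apply/funext => t /=; rewrite -cmod_sqr -powR_mulrn ?cmod_ge0// -powRrM; congr (_ `^ _); by field.
  rewrite E; split.
    by apply: measurableT_comp mf; exact: measurable_powR.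
  exists (M `^ (q / 2)) => t tt /=.
  have := HM t tt; rewrite ger0_norm ?addr_ge0 ?sqr_ge0// => hm.
  rewrite ger0_norm ?powR_ge0// ge0_ler_powR ?nnegrE ?divr_ge0 ?(ltW q0) ?addr_ge0 ?sqr_ge0//.
  by apply: le_trans hm; rewrite addr_ge0 ?sqr_ge0.
have c0 := bmf_cst 0 (2 * pi) 1.
apply: le_trans (ri_le _ bg (fun t _ => key t)); last by apply: bmfZ; apply: bmfD; [apply: bmfD => //|]; exact: bmfZ.
rewrite riZ; last by apply: bmfD; [apply: bmfD => //|]; exact: bmfZ.
rewrite riD; [|by apply: bmfD => //; exact: bmfZ|exact: bmfZ].
rewrite riD//; last exact: bmfZ.
rewrite !riZ// (mean_value wd s0 sr) (mean_value w2d s0 sr) wa expr0n /= !mulr0 !addr0.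
by rewrite ri_cst ?pi2_ge0// subr0 mul1r mulrC.
Qed.

Lemma powR_cont q x e : 0 < q -> 0 <= x -> 0 < e ->
  exists2 dl, 0 < dl & forall y, 0 <= y -> `|y - x| < dl -> `|y `^ q - x `^ q| < e.
Proof.
move=> q0; rewrite le_eqVlt => /orP[/eqP <- e0|x0 e0].
  exists (e `^ q^-1); first by rewrite powR_gt0.
  move=> y y0; rewrite subr0 ger0_norm// => ye.
  rewrite powR0 ?lt0r_neq0// subr0 ger0_norm ?powR_ge0//.
  have -> : e = (e `^ q^-1) `^ q by rewrite -powRrM mulVf ?lt0r_neq0// powRr1// ltW.
  by apply: gt0_ltr_powR => //; rewrite nnegrE// powR_ge0.
have [dv _] := is_derive1_powR q x0.
have cp : {for x, continuous ((@powR R)^~ q)}.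
  by apply: differentiable_continuous; apply/derivable1_diffP.
have /cvgrPdist_lt /(_ _ e0) := cp.
move=> /nbhs_ballP [dl /= dl0 H]; exists dl => // y _ yx.
by rewrite distrC; apply: H; rewrite /ball /= distrC.
Qed.

Lemma cmod_dist z w : `|cmod z - cmod w| <= cmod (z - w).
Proof.
by rewrite ler_norml; have := cmod_lerB z w; have := cmod_lerB w z; rewrite (cmodBC w); lra.
Qed.

Lemma ccont_disk_norm_powR g r0 q : 1 < r0 -> 0 < q ->
  (forall z, cmod z < r0 -> exists d, cderiv g z d) -> ccont_disk (fun z => cmod (g z) `^ q).
Proof.
move=> r1 q0 gd z z1 e e0.
have [d /cderiv_ccont gc] := gd z (le_lt_trans z1 r1).
have [dl dl0 H] := powR_cont q0 (cmod_ge0 (g z)) e0.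
have [d2 d20 K] := gc _ dl0; exists d2 => // w _ wz.
apply: H; first exact: cmod_ge0.
by apply: le_lt_trans (K _ wz); exact: cmod_dist.
Qed.

Theorem norm_powR_poisson g r0 q z : 1 < r0 -> 0 < q ->
  (forall z, cmod z < r0 -> exists d, cderiv g z d) -> cmod z < 1 ->
  cmod (g z) `^ q <= poisson (fun t => cmod (g (circle_pt t)) `^ q) z.
Proof.
move=> r1 q0 gd z1; apply: (@poisson_majorant R (fun z => cmod (g z) `^ q)) => //.
  exact: ccont_disk_norm_powR gd.
move=> w w1; apply: (@submean_norm_powR g w (r0 - 1)) => //; first by rewrite subr_gt0.
move=> x xw; apply: gd; have := cmodD w (x - w); rewrite addrC subrK; lra.
Qed.

Lemma ccont_disk_Re g r0 : 1 < r0 ->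
  (forall z, cmod z < r0 -> exists d, cderiv g z d) -> ccont_disk (fun z => Re (g z)).
Proof.
move=> r1 gd z z1 e e0; have [d /cderiv_ccont /(_ _ e0) [dl dl0 H]] := gd z (le_lt_trans z1 r1).
by exists dl => // w _ wz; rewrite -cReB; apply: (le_lt_trans (Re_cmod _)); exact: H.
Qed.

Lemma Re_poisson_le g r0 z : 1 < r0 -> (forall z, cmod z < r0 -> exists d, cderiv g z d) ->
  cmod z < 1 -> Re (g z) <= poisson (fun t => Re (g (circle_pt t))) z.
Proof.
move=> r1 gd z1; apply: (@poisson_majorant R (fun z => Re (g z))) => //; first exact: ccont_disk_Re gd.
move=> w w1; exists (r0 - 1); first by rewrite subr_gt0.
move=> r rp rr; rewrite (mean_value (r0 := r0 - 1) (g := g) (a := w))//.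
move=> x xw; apply: gd; have := cmodD w (x - w); rewrite addrC subrK; lra.
Qed.

Theorem Re_poisson g r0 z : 1 < r0 -> (forall z, cmod z < r0 -> exists d, cderiv g z d) ->
  cmod z < 1 -> Re (g z) = poisson (fun t => Re (g (circle_pt t))) z.
Proof.
move=> r1 gd z1; apply/eqP; rewrite eq_le (Re_poisson_le r1 gd z1) /=.
have gd' w : cmod w < r0 -> exists d, cderiv (fun z => -1 * g z) w d.
  by move=> /gd [d Hd]; exists (0 * g w + -1 * d); exact: cderivM (cderiv_cst (-1) w) Hd.
have := Re_poisson_le r1 gd' z1; rewrite mulN1r cReN.
have -> : (fun t => Re (-1 * g (circle_pt t))) = (fun t => - Re (g (circle_pt t))).
  by apply/funext => t; rewrite mulN1r cReN.
rewrite poissonN ?lerN2//.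
have H t : ccont g (circle_pt t).
  have [|d /cderiv_ccont //] := gd (circle_pt t); by rewrite circle_pt_cmod.
by case: (cbm_circle H).
Qed.

End Subharmonic.

(** * The non-tangential maximal inequality in L2 *)

Section MaximalFunction.
Context {R : realType}.
Implicit Types (z w xi : R[i]) (t e r be : R) (V W : R -> R).
Local Notation Re := (@complex.Re R).
Local Notation pi := (@pi R).
Local Notation bm := (bmf 0 (2 * pi)).
Local Notation I := (ri 0 (2 * pi)).

Lemma cauchy_schwarz V W : bm V -> bm W ->
  I (fun t => V t * W t) ^+ 2 <= I (fun t => V t ^+ 2) * I (fun t => W t ^+ 2).
Proof.
move=> hV hW; set a := I (fun t => V t ^+ 2); set b := I (fun t => V t * W t); set c := I (fun t => W t ^+ 2).
have a0 : 0 <= a by apply: ri_ge0 => t _; exact: sqr_ge0.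
have c0 : 0 <= c by apply: ri_ge0 => t _; exact: sqr_ge0.
have H s : 0 <= a - 2 * s * b + s ^+ 2 * c.
  have : 0 <= I (fun t => (V t - s * W t) ^+ 2) by apply: ri_ge0 => t _; exact: sqr_ge0.
  have -> : (fun t => (V t - s * W t) ^+ 2) = (fun t => (V t ^+ 2 - 2 * s * (V t * W t)) + s ^+ 2 * W t ^+ 2).
    by apply/funext => t; ring.
  have b1 := bmfX 2 hV; have b2 := bmfX 2 hW; have b3 := bmfM hV hW.
  rewrite riD; [|apply: bmfB => //; exact: bmfZ|exact: bmfZ].
  by rewrite riB//; [rewrite !riZ|exact: bmfZ].
have [c00|cn0] := eqVneq c 0.
  rewrite c00 mulr0; have [->|bn0] := eqVneq b 0; first by rewrite expr0n.
  have := H ((a + 1) / (2 * b)); rewrite c00 mulr0 addr0.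
  have -> : 2 * ((a + 1) / (2 * b)) * b = a + 1 by field.
  by lra.
have cp : 0 < c by rewrite lt_neqAle eq_sym cn0.
have := H (b / c); have -> : a - 2 * (b / c) * b + (b / c) ^+ 2 * c = (a * c - b ^+ 2) / c by field.
by rewrite pmulr_lge0 ?invr_gt0// subr_ge0.
Qed.

(** When z is at least as far from the circle as z', replacing z' by a
    boundary point xi whose cone contains z' changes distances from z only by
    a bounded factor. *)
Lemma pk_shift z z' xi be : cmod z < 1 -> cmod z' < 1 -> cmod xi = 1 -> 0 <= be ->
  cmod (z' - xi) <= be * (1 - cmod z') -> cmod z <= cmod z' ->
  (1 - cmod z ^+ 2 * cmod z' ^+ 2) / cmod (1 - z * z'^*) ^+ 2 <= 4 * (1 + be) ^+ 2 * pk z xi.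
Proof.
move=> z1 z'1 x1 b0 hz' zz'.
set N := cmod (1 - z * z'^*).
have N1 : 1 - cmod z' <= N.
  have := cmod_lerB 1 (z * z'^*); rewrite cmod1 cmodM cmod_conj -/N.
  have := cmod_ge0 z; have := cmod_ge0 z'; nra.
have N0 : 0 < N by apply: lt_le_trans N1; rewrite subr_gt0.
have x0 : 0 < cmod (xi - z) by have := cmod_lerB xi z; rewrite x1; lra.
have h1 : cmod (xi - z) <= (1 + be) * N.
  have -> : cmod (xi - z) = cmod (1 - z * xi^*).
    have xx : xi * xi^* = 1.
      case: (xi) x1 => a b /(congr1 (fun x => x ^+ 2)); rewrite cmod_sqr expr1n /= => ab.
      by apply/eqP; rewrite eq_complex /= mulrN opprK -!expr2 ab eqxx /= mulrN mulrC addNr.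
    have -> : 1 - z * xi^* = xi^* * (xi - z) by rewrite -xx; ring.
    by rewrite cmodM cmod_conj x1 mul1r.
  have -> : 1 - z * xi^* = (1 - z * z'^*) + z * (z' - xi)^* by rewrite rmorphB /=; ring.
  apply: (le_trans (cmodD _ _)); rewrite cmodM cmod_conj mulrDl mul1r lerD2l.
  apply: (@le_trans _ _ (cmod (z' - xi))); first by rewrite ler_piMl ?cmod_ge0// ltW.
  by apply: (le_trans hz'); rewrite ler_wpM2l.
rewrite /pk ler_pdivrMr ?exprn_gt0//.
have h2 : cmod (xi - z) ^+ 2 <= (1 + be) ^+ 2 * N ^+ 2.
  rewrite -exprMn ler_pXn2r ?nnegrE ?cmod_ge0//.
  by rewrite mulr_ge0 ?(ltW N0)// addr_ge0.
have h3 : 1 - cmod z ^+ 2 * cmod z' ^+ 2 <= 4 * (1 - cmod z ^+ 2).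
  have := cmod_ge0 z; have := cmod_ge0 z'; move: z1 z'1 zz'; set a := cmod z; set b := cmod z' => *.
  have : 1 - b ^+ 2 <= 1 - a ^+ 2 by nra.
  have : b ^+ 2 <= 1 by nra.
  have : a ^+ 2 <= 1 by nra.
  by nra.
have X0 : 0 < cmod (xi - z) ^+ 2 by rewrite exprn_gt0.
have d0 : 0 <= 1 - cmod z ^+ 2 by rewrite subr_ge0 expr_le1 ?cmod_ge0// ltW.
rewrite [leRHS](_ : _ = 4 * (1 - cmod z ^+ 2) * ((1 + be) ^+ 2 * N ^+ 2) / cmod (xi - z) ^+ 2); last first.
  by field; exact: lt0r_neq0.
rewrite ler_pdivlMr//.
apply: le_trans (ler_pM _ _ h3 h2) _; last by rewrite le_eqVlt; apply/orP; left; apply/eqP; ring.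
  by have := cmod_ge0 z; have := cmod_ge0 z'; nra.
exact: exprn_ge0 (cmod_ge0 _).
Qed.

(** On the circle pk z' is the real part of f(xi) = (1 + z'^* xi) / (1 - z'^*
    xi), which is holomorphic on a larger disk; so its Poisson integral at z
    is Re f(z). *)
Lemma ri_pkpk z z' : cmod z < 1 -> cmod z' < 1 ->
  I (fun t => pk z (circle_pt t) * pk z' (circle_pt t)) =
  2 * pi * ((1 - cmod z ^+ 2 * cmod z' ^+ 2) / cmod (1 - z * z'^*) ^+ 2).
Proof.
move=> z1 z'1; have z'p : 0 < 1 + cmod z' by rewrite ltr_wpDr ?cmod_ge0.
pose f (eta : R[i]) : R[i] := (1 + z'^* * eta) / (1 - z'^* * eta).
have n1 (eta : R[i]) : cmod eta < 2 / (1 + cmod z') -> 1 - z'^* * eta != 0.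
  rewrite ltr_pdivlMr// => eta1.
  rewrite -cmod_gt0; apply: lt_le_trans (cmod_lerB _ _).
  rewrite cmod1 subr_gt0 cmodM cmod_conj.
  have [->|e0] := eqVneq (cmod eta) 0; first by rewrite mulr0.
  have : 0 < cmod eta by rewrite lt_neqAle eq_sym e0 cmod_ge0.
  by move: eta1 z'1 (cmod_ge0 z'); nra.
have fd (eta : R[i]) : cmod eta < 2 / (1 + cmod z') -> exists d, cderiv f eta d.
  move=> eta1.
  eexists; apply: cderivM; first exact: (cderivD (cderiv_cst 1 _) (cderivM (cderiv_cst z'^* _) (cderiv_id _))).
  have := (cderivD (cderiv_cst 1 eta) (cderivM (cderiv_cst (- z'^*) eta) (cderiv_id eta))).
  under [X in cderiv X]eq_fun do rewrite /= mulNr.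
  by apply: cderivV; exact: n1.
have r1 : 1 < 2 / (1 + cmod z') by rewrite ltr_pdivlMr// mul1r; lra.
have Ref eta : cmod eta <= 1 -> Re (f eta) = (1 - cmod eta ^+ 2 * cmod z' ^+ 2) / cmod (1 - eta * z'^*) ^+ 2.
  move=> e1; have := n1 eta (le_lt_trans e1 r1).
  rewrite -cmod_gt0 /f mulrC => /lt0r_neq0; rewrite mulrC (mulrC z'^*) -(sqrf_eq0 (cmod _)) !cmod_sqr.
  case: eta {e1} => a b; case: (z') => x y /=.
  rewrite ?(mulrN, opprK, sub0r, add0r).
  set D := _ ^+ 2 + _ ^+ 2 => D0.
  rewrite -[RHS](_ : ((1 + (a * x + b * y)) * (1 - (a * x + b * y)) - (b * x - a * y) ^+ 2) / D = _); last first.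
    by congr (_ / _); ring.
  rewrite /D in D0 *; field; exact: D0.
have := Re_poisson r1 fd z1; rewrite Ref ?ltW// /poisson => ->.
rewrite [RHS]mulrC divfK ?lt0r_neq0 ?pi2_gt0//; apply: eq_ri => t _; congr (_ * _).
rewrite Ref ?circle_pt_cmod// expr1n mul1r /pk; congr (_ / _ ^+ 2).
have xx : (circle_pt t : R[i])^* * circle_pt t = 1.
  have := cos2Dsin2 t; rewrite /circle_pt => c; apply/eqP; rewrite eq_complex /=.
  by rewrite !mulNr opprK -!expr2 c eqxx /= mulrC addrN.
rewrite -(cmod_conj (_ - _)) rmorphB /=.
rewrite -[RHS](_ : cmod ((circle_pt t : R[i])^* - z'^*) * cmod (circle_pt t : R[i]) = _).
  by rewrite circle_pt_cmod mulr1.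
by rewrite -cmodM mulrBl xx (mulrC z'^*).
Qed.

Lemma poisson_ge0 V z : cmod z < 1 -> (forall t, 0 <= t <= 2 * pi -> 0 <= V t) -> 0 <= poisson V z.
Proof.
move=> z1 V0; rewrite /poisson divr_ge0 ?pi2_ge0//; apply: ri_ge0 => t tt.
by rewrite mulr_ge0 ?pk_ge0//; exact: V0.
Qed.

Section TTstar.
Variables (n : nat) (z : 'I_n -> R[i]) (S : 'I_n -> set R) (V : R -> R) (be : R).
Hypotheses (hz : forall j, cmod (z j) < 1) (mS : forall j, measurable (S j))
  (dS : forall j k t, S j t -> S k t -> j = k) (b0 : 0 <= be)
  (cone : forall j t, S j t -> cmod (z j - circle_pt t) <= be * (1 - cmod (z j)))
  (bV : bm V) (V0 : forall t, 0 <= t <= 2 * pi -> 0 <= V t).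

Let P j t := pk (z j) (circle_pt t).
Let c j := poisson V (z j).
Let a j := c j * I (\1_(S j)).
Let w t := \sum_j c j * \1_(S j) t.
Let Q t := \sum_j a j * P j t.
Let B := 2 * pi * (4 * (1 + be) ^+ 2).

Let bS j : bm (\1_(S j)). Proof. exact: bmf_indic. Qed.
Let bP j : bm (P j). Proof. exact: bm_pk. Qed.
Let P_ge0 j t : 0 <= P j t. Proof. exact: pk_ge0. Qed.
Let c_ge0 j : 0 <= c j. Proof. exact: poisson_ge0. Qed.
Let indic_ge0 j t : 0 <= \1_(S j) t :> R. Proof. by rewrite indicE. Qed.
Let a_ge0 j : 0 <= a j. Proof. by rewrite mulr_ge0//; apply: ri_ge0. Qed.
Let bw : bm w. Proof. by apply: bmf_sum => j; exact: bmfZ. Qed.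
Let bQ : bm Q. Proof. by apply: bmf_sum => j; exact: bmfZ. Qed.
Let B0 : 0 <= B.
Proof. by apply: mulr_ge0; [exact: pi2_ge0|apply: mulr_ge0 => //; apply: exprn_ge0; exact: addr_ge0]. Qed.
Let b j k := I (fun t => c k * \1_(S k) t * P j t).
Let bb j k : bm (fun t => c k * \1_(S k) t * P j t).
Proof. by apply: bmfM => //; exact: bmfZ. Qed.
Let b_ge0 j k : 0 <= b j k.
Proof. by apply: ri_ge0 => t _; apply: mulr_ge0 => //; exact: mulr_ge0. Qed.
Let K j k := I (fun t => P j t * P k t).

(** On S k, the kernel P j is bounded below by a multiple of its inner product with
    P k, by [pk_shift], if z j is the point nearer to the origin; [Q2_le] uses this
    in one of the two orders for each pair. *)
Let half j k : cmod (z j) <= cmod (z k) -> a k * K j k <= B * b j k.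
Proof.
move=> zz.
have -> : a k * K j k = I (fun t => c k * K j k * \1_(S k) t) by rewrite riZ// /a mulrAC.
rewrite -[B * b j k]riZ//.
apply: ri_le; [exact: bmfZ|exact: bmfZ|].
move=> t _; rewrite indicE; have [tS|_] := boolP (t \in S k); last by rewrite !mulr0 mul0r mulr0.
rewrite /= !mulr1 (mulrCA B (c k)); apply: ler_wpM2l => //.
rewrite /K ri_pkpk// /B -(mulrA (2 * pi)); apply: ler_wpM2l; first exact: pi2_ge0.
apply: pk_shift => //; first exact: circle_pt_cmod.
by apply: cone; rewrite inE in tS.
Qed.

Let Ksym j k : K j k = K k j.
Proof. by apply: eq_ri => t _; rewrite mulrC. Qed.

Let Q2_le : I (fun t => Q t ^+ 2) <= 2 * B * I (fun t => w t * Q t).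
Proof.
have E1 : I (fun t => Q t ^+ 2) = \sum_j \sum_k a j * a k * K j k.
  have -> : (fun t => Q t ^+ 2) = (fun t => \sum_j \sum_k a j * a k * (P j t * P k t)).
    apply/funext => t; rewrite expr2 /Q big_distrlr /=.
    by apply: eq_bigr => j _; apply: eq_bigr => k _; rewrite mulrACA.
  rewrite ri_sum; last by move=> j; apply: bmf_sum => k; apply: bmfZ; exact: bmfM.
  apply: eq_bigr => j _; rewrite ri_sum; last by move=> k; apply: bmfZ; exact: bmfM.
  by apply: eq_bigr => k _; rewrite riZ//; exact: bmfM.
have E2 : I (fun t => w t * Q t) = \sum_j \sum_k a j * b j k.
  have -> : (fun t => w t * Q t) = (fun t => \sum_j \sum_k a j * (c k * \1_(S k) t * P j t)).
    apply/funext => t; rewrite mulrC /Q /w big_distrlr /=.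
    by apply: eq_bigr => j _; apply: eq_bigr => k _; ring.
  rewrite ri_sum; last by move=> j; apply: bmf_sum => k; exact: bmfZ.
  apply: eq_bigr => j _; rewrite ri_sum; last by move=> k; exact: bmfZ.
  by apply: eq_bigr => k _; rewrite riZ.
have key j k : a j * a k * K j k <= B * (a j * b j k + a k * b k j).
  rewrite mulrDr; have [zz|/ltW zz] := leP (cmod (z j)) (cmod (z k)).
    have h1 : a j * a k * K j k <= B * (a j * b j k).
      have -> : B * (a j * b j k) = a j * (B * b j k) by ring.
      by rewrite -mulrA; apply: ler_wpM2l => //; exact: half.
    have h2 : 0 <= B * (a k * b k j) by apply: mulr_ge0 => //; exact: mulr_ge0.
    by apply: (le_trans h1); rewrite lerDl.
  have h1 : a j * a k * K j k <= B * (a k * b k j).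
    have -> : B * (a k * b k j) = a k * (B * b k j) by ring.
    by rewrite (mulrC (a j)) -mulrA Ksym; apply: ler_wpM2l => //; exact: half.
  have h2 : 0 <= B * (a j * b j k) by apply: mulr_ge0 => //; exact: mulr_ge0.
  by apply: (le_trans h1); rewrite lerDr.
rewrite E1 E2; apply: (@le_trans _ _ (\sum_j \sum_k B * (a j * b j k + a k * b k j))).
  by apply: ler_sum => j _; apply: ler_sum => k _.
have E3 : \sum_j \sum_k B * (a j * b j k + a k * b k j) =
   B * (\sum_j \sum_k a j * b j k + \sum_j \sum_k a k * b k j).
  rewrite -big_split /= mulr_sumr; apply: eq_bigr => j _.
  by rewrite -big_split /= mulr_sumr.
by rewrite E3 (exchange_big (GRing.zero)) /= || rewrite E3 [X in _ + X]exchange_big /=; rewrite -mulr2n -mulr_natl; lra.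
Qed.

(** This is the L2 bound for V |-> sum_j poisson V (z j) 1_(S j), which picks
    one point of the cone over each boundary parameter. With w the image of V,
    the square norm of w is a multiple of the pairing of V with Q, the adjoint
    image of w, and [Q2_le] bounds the square norm of Q by the pairing of w
    with Q. Two applications of the Cauchy-Schwarz inequality close the
    estimate. *)
Lemma TTstar_bound :
  \sum_j poisson V (z j) ^+ 2 * I (\1_(S j)) <= (8 * (1 + be) ^+ 2) ^+ 2 * I (fun t => V t ^+ 2).
Proof.
set X := \sum_j _.
have X0 : 0 <= X by apply: sumr_ge0 => j _; rewrite mulr_ge0 ?sqr_ge0//; apply: ri_ge0.
have Ew : I (fun t => w t ^+ 2) = X.
  have -> : (fun t => w t ^+ 2) = (fun t => \sum_j c j ^+ 2 * \1_(S j) t).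
    apply/funext => t; rewrite /w; have [[j Sj]|nS] := pselect (exists j, S j t).
      have E k : k != j -> \1_(S k) t = 0 :> R.
        move=> kj; rewrite indicE; case: (boolP (t \in S k)) => //; rewrite inE => Sk.
        by rewrite (dS Sk Sj) eqxx in kj.
      rewrite (bigD1 j)//= big1 ?addr0; last by move=> k /E ->; rewrite mulr0.
      rewrite (bigD1 j)//= big1 ?addr0; last by move=> k /E ->; rewrite mulr0.
      by rewrite indicE mem_set// !mulr1.
    have E k : \1_(S k) t = 0 :> R.
      by rewrite indicE memNset// => Sk; apply: nS; exists k.
    by rewrite !big1 ?expr0n// => k _; rewrite E mulr0.
  rewrite ri_sum; last by move=> j; exact: bmfZ.
  by apply: eq_bigr => j _; rewrite riZ.
have EX : X = I (fun t => Q t * V t) / (2 * pi).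
  have -> : (fun t => Q t * V t) = (fun t => \sum_j a j * (P j t * V t)).
    by apply/funext => t; rewrite /Q mulr_suml; apply: eq_bigr => j _; rewrite mulrA.
  rewrite ri_sum; last by move=> j; apply: bmfZ; exact: bmfM.
  rewrite mulr_suml; apply: eq_bigr => j _.
  rewrite riZ; last exact: bmfM.
  by rewrite /a -mulrA -/(c j) -[I _ / _]/(c j); ring.
have Q2 := Q2_le.
set Y := I (fun t => Q t ^+ 2) in Q2.
have Y0 : 0 <= Y by apply: ri_ge0 => t _; exact: sqr_ge0.
have h1 := cauchy_schwarz bw bQ; rewrite Ew -/Y in h1.
have h2 := cauchy_schwarz bQ bV; rewrite -/Y in h2.
set U := I (fun t => w t * Q t) in Q2 h1.
set Z := I (fun t => V t ^+ 2) in h2 *.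
have Z0 : 0 <= Z by apply: ri_ge0 => t _; exact: sqr_ge0.
have YX : Y <= 4 * B ^+ 2 * X.
  have U0 : 0 <= U.
    by apply: ri_ge0 => t _; rewrite mulr_ge0//; apply: sumr_ge0 => j _; exact: mulr_ge0.
  have BU : 0 <= 2 * B * U by apply: mulr_ge0 => //; exact: mulr_ge0.
  have h3 : Y ^+ 2 <= (2 * B * U) ^+ 2 by rewrite ler_pXn2r ?nnegrE.
  have h4 : (2 * B * U) ^+ 2 <= 4 * B ^+ 2 * (X * Y).
    have -> : (2 * B * U) ^+ 2 = 4 * B ^+ 2 * U ^+ 2 by ring.
    by apply: ler_wpM2l => //; apply: mulr_ge0 => //; exact: sqr_ge0.
  have [->|Yn] := eqVneq Y 0; first by apply: mulr_ge0 => //; apply: mulr_ge0 => //; exact: sqr_ge0.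
  have Yp : 0 < Y by rewrite lt_neqAle eq_sym Yn.
  rewrite -(ler_pM2r Yp); have -> : 4 * B ^+ 2 * X * Y = 4 * B ^+ 2 * (X * Y) by ring.
  by rewrite -expr2; exact: le_trans h3 h4.
have pp := @pi2_gt0 R.
have h5 : (X * (2 * pi)) ^+ 2 <= 4 * B ^+ 2 * X * Z.
  rewrite {1}EX divfK ?lt0r_neq0//; apply: (le_trans h2).
  by rewrite ler_wpM2r.
have [->|Xn] := eqVneq X 0; first by apply: mulr_ge0 => //; exact: sqr_ge0.
have Xp : 0 < X by rewrite lt_neqAle eq_sym Xn.
have q0 : 0 < X * (2 * pi) ^+ 2 by rewrite mulr_gt0// exprn_gt0.
rewrite -(ler_pM2l q0); move: h5; rewrite exprMn.
rewrite (_ : X ^+ 2 * (2 * pi) ^+ 2 = X * (2 * pi) ^+ 2 * X); last by ring.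
move=> /le_trans; apply; rewrite le_eqVlt; apply/orP; left; apply/eqP; rewrite /B; ring.
Qed.

End TTstar.

Definition shadow be z : set R := [set t | cmod (z - circle_pt t) < be * (1 - cmod z)].

Lemma measurable_shadow be z : measurable (shadow be z).
Proof.
apply: open_measurable; apply/openP || rewrite openE => t /= ht; apply/nbhs_ballP.
exists (be * (1 - cmod z) - cmod (z - circle_pt t)); first by rewrite /= subr_gt0.
move=> s; rewrite /ball /= /shadow /= => st.
have := cmodD (z - circle_pt t) (circle_pt t - circle_pt s); rewrite addrA subrK.
by have := chord_le t s; lra.
Qed.

Section NontangentialMaximal.
Variables (be : R) (zs : nat -> R[i]) (F : nat -> R).
Hypotheses (be0 : 0 <= be) (hz : forall k, cmod (zs k) < 1) (F0 : forall k, 0 <= F k).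
Let A k := shadow be (zs k).

(** A finite maximum of multiples of indicators of shadows, so that it is
    bounded and measurable; the supremum over all points of a dense sequence
    is its limit in n. *)
Fixpoint ntmax n t : R :=
  if n is m.+1 then Num.max (ntmax m t) (F m * \1_(A m) t) else 0.

Lemma ntmaxS n t : ntmax n.+1 t = Num.max (ntmax n t) (F n * \1_(A n) t).
Proof. by []. Qed.

Lemma ntmax_ge0 n t : 0 <= ntmax n t.
Proof.
elim: n => [|n IH]; first by [].
by rewrite ntmaxS le_max IH.
Qed.

Lemma ntmax_nd n m t : (n <= m)%N -> ntmax n t <= ntmax m t.
Proof.
move=> /subnK <-; elim: (m - n)%N => [|k IH]; first by rewrite add0n.
by rewrite addSn ntmaxS le_max IH.
Qed.

Lemma ntmax_ge n k t : (k < n)%N -> A k t -> F k <= ntmax n t.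
Proof.
move=> kn Ak; apply: le_trans (ntmax_nd t kn).
by rewrite ntmaxS le_max indicE mem_set// mulr1 lexx orbT.
Qed.

Lemma bm_ntmax n : bm (ntmax n).
Proof.
elim: n => [|n [mn [M HM]]].
  have -> : ntmax 0 = fun=> 0 by apply/funext.
  exact: bmf_cst.
have [mA [N HN]] := bmfZ (F n) (bmf_indic 0 (2 * pi) (measurable_shadow be (zs n))).
have -> : ntmax n.+1 = fun t => Num.max (ntmax n t) (F n * \1_(A n) t) by apply/funext => t; rewrite ntmaxS.
split; first exact: measurable_maxr.
exists (M + N) => t tt; have := HM t tt; have := HN t tt.
have := normr_ge0 (ntmax n t); have := normr_ge0 (F n * \1_(A n) t).
by rewrite /A /Num.max; case: ifP => _; lra.
Qed.

(** Linearisation: at each boundary parameter the maximum is attained at one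
    of finitely many points of the cone. Choosing the largest value and then
    the least index makes the choice measurable, and [TTstar_bound] applies to
    it. *)
Lemma ntmax_bound V n : bm V -> (forall t, 0 <= t <= 2 * pi -> 0 <= V t) ->
  (forall k, (k < n)%N -> F k <= poisson V (zs k)) ->
  I (fun t => ntmax n t ^+ 2) <= (8 * (1 + be) ^+ 2) ^+ 2 * I (fun t => V t ^+ 2).
Proof.
move=> bV V0 FV.
(* larger value first, ties broken by the least index *)
pose better (k j : 'I_n) := (F j < F k) || ((F k == F j) && (k < j)%N).
pose S (j : 'I_n) := A j `\` \big[setU/set0]_(k < n | better k j) A k.
have SE j t : S j t -> A j t /\ forall k, better k j -> ~ A k t.
  move=> [Aj nA]; split => // k kj Ak; apply: nA.
  by rewrite (bigD1 k)//=; left.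
have mS j : measurable (S j).
  apply: measurableD; first exact: measurable_shadow.
  by apply: bigsetU_measurable => k _; exact: measurable_shadow.
have dS j k t : S j t -> S k t -> j = k.
  move=> /SE [Aj bj] /SE [Ak bk]; apply/eqP; rewrite -val_eqE /= eqn_leq.
  apply/andP; split; rewrite leqNgt; apply/negP => jk.
    have [h|h|h] := ltgtP (F j) (F k).
    - by apply: (bj k) => //; rewrite /better h.
    - by apply: (bk j) => //; rewrite /better h.
    - by apply: (bj k) => //; rewrite /better h eqxx jk orbT.
  have [h|h|h] := ltgtP (F j) (F k).
  - by apply: (bj k) => //; rewrite /better h.
  - by apply: (bk j) => //; rewrite /better h.
  - by apply: (bk j) => //; rewrite /better h eqxx jk orbT.
have cone j t : S j t -> cmod (zs j - circle_pt t) <= be * (1 - cmod (zs j)).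
  by move=> /SE [Aj _]; exact: ltW.
apply: le_trans (TTstar_bound (fun j => hz j) mS dS be0 cone bV V0).
have bS j : bm (\1_(S j)) by exact: bmf_indic.
have -> : \sum_(j < n) poisson V (zs j) ^+ 2 * I \1_(S j) =
   I (fun t => \sum_(j < n) poisson V (zs j) ^+ 2 * \1_(S j) t).
  rewrite ri_sum; last by move=> j; exact: bmfZ.
  by apply: eq_bigr => j _; rewrite riZ.
apply: ri_le; [apply: bmfX; exact: bm_ntmax|by apply: bmf_sum => j; exact: bmfZ|].
move=> t _.
have t0 (j : 'I_n) : 0 <= poisson V (zs j) ^+ 2 * \1_(S j) t.
  by apply: mulr_ge0; [exact: sqr_ge0|rewrite indicE].
have [[i0 Ai0]|nA] := pselect (exists i : 'I_n, A i t); last first.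
  have -> : ntmax n t = 0.
    have nA' k : (k < n)%N -> ~ A k t by move=> kn Ak; apply: nA; exists (Ordinal kn).
    suff H m : (m <= n)%N -> ntmax m t = 0 by exact: H.
    elim: m => // m IH mn; rewrite ntmaxS IH ?(ltnW mn)//.
    by rewrite indicE memNset ?mulr0 ?maxxx//; exact: nA'.
  by rewrite expr0n; apply: sumr_ge0.
have [j1 Aj1 Hj1] : exists2 j1 : 'I_n, A j1 t & forall k : 'I_n, A k t -> F k <= F j1.
  have Ai0' : t \in A i0 by rewrite inE.
  case: (@arg_maxP _ _ _ i0 (fun i : 'I_n => t \in A i) (fun i : 'I_n => F i) Ai0') => j; rewrite inE => Aj Hj.
  by exists j => // k Ak; apply: Hj; rewrite inE.
have [j Sj Fj] : exists2 j : 'I_n, S j t & F j = F j1.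
  pose P (i : 'I_n) := (t \in A i) && (F i == F j1).
  have Pj1 : P j1 by rewrite /P eqxx andbT inE.
  case: (@arg_minnP _ j1 P (fun i : 'I_n => i : nat) Pj1) => j /andP[]; rewrite inE => Aj /eqP Fj Hj.
  exists j => //; split => // B; have [k kj Ak] : exists2 k, better k j & A k t.
    move: B; elim/big_ind: _ => //; first by move=> x y hx hy [/hx|/hy].
    by move=> k kj Ak; exists k.
  move: kj; rewrite /better Fj => /orP[h|/andP[/eqP h kj]].
    by have := Hj1 k Ak; rewrite leNgt h.
  by have := Hj k; rewrite /P h eqxx andbT inE => /(_ Ak); rewrite leqNgt kj.
have le1 : ntmax n t <= F j.
  rewrite Fj; suff H m : (m <= n)%N -> ntmax m t <= F j1 by exact: H.
  elim: m => [_|m IH mn]; first exact: F0.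
  rewrite ntmaxS ge_max IH ?(ltnW mn)//= indicE.
  case: (boolP (t \in A m)); rewrite ?mulr1 ?mulr0; last by move=> _; exact: F0.
  by rewrite inE => Am; exact: (Hj1 (Ordinal mn)).
rewrite (bigD1 j)//=; apply: (@le_trans _ _ (poisson V (zs j) ^+ 2 * \1_(S j) t)); last first.
  by rewrite lerDl; apply: sumr_ge0.
rewrite indicE mem_set// mulr1; apply: lerXn2r; rewrite ?nnegrE ?ntmax_ge0//.
  by apply: le_trans (FV j (ltn_ord j)); exact: F0.
exact: le_trans le1 (FV j (ltn_ord j)).
Qed.

End NontangentialMaximal.

(** Monotone convergence for bounded functions, with the limit taken in the
    extended reals; the last clause says that the limit is the least majorant. *)
Lemma monotone_majorant (f : nat -> R -> R) (C : R) : (forall n, bm (f n)) ->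
  (forall n t, 0 <= f n t) -> (forall n m t, (n <= m)%N -> f n t <= f m t) ->
  (forall n, I (f n) <= C) ->
  exists M : R -> \bar R, [/\ measurable_fun `[0, 2 * pi] M, forall t, (0 <= M t)%E,
    forall n t, ((f n t)%:E <= M t)%E,
    (\int[@lebesgue_measure R]_(t in `[0%R, (2 * pi)%R]) M t <= C%:E)%E &
    forall t (c : R), (forall n, f n t <= c) -> (M t <= c%:E)%E].
Proof.
move=> bf f0 fnd fC.
pose g n t := (f n t)%:E.
have mg n : measurable_fun `[0, 2 * pi] (g n) by apply/measurable_EFinP; case: (bf n).
have g0 n t : (0 <= g n t)%E by rewrite lee_fin.
have gnd t : nondecreasing_seq (g ^~ t) by move=> n m nm; rewrite lee_fin; exact: fnd.
have gc t : cvgn (g ^~ t) by apply: ereal_nondecreasing_is_cvgn; exact: gnd.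
exists (fun t => limn (g ^~ t)); split.
- apply: (emeasurable_fun_cvg g) => // t _; exact: gc.
- by move=> t; apply: lime_ge; [exact: gc|exact: nearW].
- move=> n t; apply: lime_ge; first exact: gc.
  by exists n => // m nm; exact: gnd.
- rewrite monotone_convergence//.
    apply: lime_le.
      apply: ereal_nondecreasing_is_cvgn => n m nm; apply: ge0_le_integral; try by [].
      - exact: mg.
      - exact: mg.
      - by move=> t _; exact: gnd.
    apply: nearW => n; have := fC n; rewrite /ri /Rintegral -lee_fin fineK//.
    exact: integrable_fin_num (bmf_integrable (bf n)).
- by move=> t c fc; apply: lime_le; [exact: gc|apply: nearW => n; rewrite lee_fin].
Qed.

End MaximalFunction.

(** * Fatou's theorem for real parts bounded in quadratic mean *)

Section NontangentialLimits.
Context {R : realType}.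
Implicit Types (z w xi : R[i]) (t e r be : R) (V W : R -> R) (g : R[i] -> R[i]).
Local Notation Re := (@complex.Re R).
Local Notation Im := (@complex.Im R).
Local Notation pi := (@pi R).
Local Notation bm := (bmf 0 (2 * pi)).
Local Notation I := (ri 0 (2 * pi)).
Local Notation mu := (@lebesgue_measure R).

(** Near-minimisers of the norm over a decreasing sequence of convex sets form
    a Cauchy sequence, by the parallelogram law; this replaces weak
    compactness. *)
Lemma near_minimizers_cauchy (C : nat -> (R -> R) -> Prop) (M : R) :
  (forall n V, C n V -> bm V) ->
  (forall n m V, (n <= m)%N -> C m V -> C n V) ->
  (forall n V W, C n V -> C n W -> C n (fun t => (V t + W t) / 2)) ->
  (forall n, exists2 V, C n V & I (fun t => V t ^+ 2) <= M) ->
  exists w : nat -> R -> R, (forall n, C n (w n)) /\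
    forall e, 0 < e -> exists N, forall n m, (N <= n)%N -> (N <= m)%N ->
      I (fun t => (w n t - w m t) ^+ 2) < e.
Proof.
move=> Cb Cd Cm Cn.
pose Q n := [set I (fun t => V t ^+ 2) | V in [set V | C n V]].
pose d n := inf (Q n).
have Q0 n : lbound (Q n) 0.
  by move=> _ [V _ <-]; apply: ri_ge0 => t _; exact: sqr_ge0.
have Qn n : Q n !=set0.
  by have [V CV _] := Cn n; exists (I (fun t => V t ^+ 2)); exists V.
have dle n V : C n V -> d n <= I (fun t => V t ^+ 2).
  by move=> CV; apply: ge_inf; [exists 0; exact: Q0|exists V].
have dM n : d n <= M by have [V CV VM] := Cn n; apply: le_trans VM; exact: dle.
have dnd n m : (n <= m)%N -> d n <= d m.
  move=> nm; apply: lb_le_inf; first exact: Qn.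
  by move=> _ [V CV <-]; apply: dle; exact: Cd CV.
have ex n : exists V, C n V /\ I (fun t => V t ^+ 2) < d n + n.+1%:R^-1.
  have [_ [V CV <-] h] := @inf_adherent R (Q n) (n.+1%:R^-1) ltac:(by rewrite invr_gt0 ltr0n) (conj (Qn n) (ex_intro _ 0 (Q0 n))).
  by exists V.
have [w Hw] := choice ex.
exists w; split; first by move=> n; case: (Hw n).
move=> e e0; set D := sup (range d).
have rb : has_sup (range d).
  by split; [exists (d 0%N), 0%N|exists M => _ [n _ <-]].
have [_ [N1 _ <-] h1] := sup_adherent (divr_gt0 e0 (@ltr0n R 8)) rb.
have [N2 h2] : exists N2 : nat, 8 / e < N2%:R.
  by exists (Num.bound (8 / e)); rewrite archi_boundP// divr_ge0// ltW.
exists (maxn N1 N2) => n m; rewrite !geq_max => /andP[n1 n2] /andP[m1 m2].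
have dD k : d k <= D by apply: ub_le_sup; [case: rb|exists k].
have bn := Cb _ _ (Hw n).1; have bmm := Cb _ _ (Hw m).1.
have mid := dle N1 _ (Cm _ _ _ (Cd _ _ _ n1 (Hw n).1) (Cd _ _ _ m1 (Hw m).1)).
have small k : (N2 <= k)%N -> k.+1%:R^-1 < e / 8.
  move=> hk; rewrite invf_plt ?posrE ?ltr0n ?divr_gt0// invf_div.
  by apply: (lt_le_trans h2); rewrite ler_nat; exact: leqW.
have par : I (fun t => (w n t - w m t) ^+ 2) =
   2 * I (fun t => w n t ^+ 2) + 2 * I (fun t => w m t ^+ 2) - 4 * I (fun t => ((w n t + w m t) / 2) ^+ 2).
  have b1 := bmfX 2 bn; have b2 := bmfX 2 bmm.
  have b3 : bm (fun t => ((w n t + w m t) / 2) ^+ 2).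
    by apply: bmfX; apply: bmfM; [exact: bmfD|exact: bmf_cst].
  rewrite -!riZ// -riD; [|exact: bmfZ..].
  rewrite -riB; [|by apply: bmfD; exact: bmfZ|exact: bmfZ].
  by apply: eq_ri => t _; field.
have := (Hw n).2; have := (Hw m).2; have := small n n2; have := small m m2.
have := dD n; have := dD m; rewrite par.
move: h1 mid; rewrite -/D; set x := I _; set y := I _; set v := I _.
move: (n.+1%:R^-1) (m.+1%:R^-1) => a b; lra.
Qed.

Lemma dense_sequence : exists zs : nat -> R[i], (forall k, cmod (zs k) < 1) /\
  forall z e, cmod z < 1 -> 0 < e -> exists k, cmod (zs k - z) < e.
Proof.
pose pt (q : rat * rat) : R[i] := (ratr q.1) +i* (ratr q.2).
pose zs n : R[i] := if unpickle n is Some q then (if cmod (pt q) < 1 then pt q else 0) else 0.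
exists zs; split.
  by move=> k; rewrite /zs; case: unpickle => [q|]; [case: ifP => //|]; rewrite cmod0 ltr01.
move=> z e z1 e0; set d := Num.min e (1 - cmod z).
have d0 : 0 < d by rewrite lt_min e0 subr_gt0.
have [x Hx] : exists q : rat, ratr q \in `](Re z), (Re z + d / 2)[.
  by apply: rat_in_itvoo; rewrite ltrDl divr_gt0.
have [y Hy] : exists q : rat, ratr q \in `](Im z), (Im z + d / 2)[.
  by apply: rat_in_itvoo; rewrite ltrDl divr_gt0.
have dist : cmod (pt (x, y) - z) < d.
  apply: (le_lt_trans (cmod_ReIm _)); rewrite cReB cImB /=.
  move: Hx Hy; rewrite !in_itv /= => /andP[a1 a2] /andP[b1 b2].
  by rewrite !ger0_norm; lra.
have pt1 : cmod (pt (x, y)) < 1.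
  have : d <= 1 - cmod z by rewrite ge_min lexx orbT.
  by have := cmodD z (pt (x, y) - z); rewrite addrC subrK; lra.
exists (pickle (x, y)); rewrite /zs pickleK pt1.
by apply: lt_le_trans dist _; rewrite ge_min lexx.
Qed.

(** The exceptional set is required to be measurable, so that countable
    conjunctions need no completeness of the measure. *)
Definition aec (P : R -> Prop) := exists N : set R, [/\ measurable N, mu N = 0%E &
  forall t, 0 <= t <= 2 * pi -> ~ N t -> P t].

Lemma aec_and (P Q : R -> Prop) : aec P -> aec Q -> aec (fun t => P t /\ Q t).
Proof.
move=> [N [mN N0 HN]] [M [mM M0 HM]]; exists (N `|` M); split.
- exact: measurableU.
- by rewrite measureU0.
- by move=> t tt nt; split; [apply: HN|apply: HM] => // h; apply: nt; [left|right].
Qed.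

Lemma aec_imp (P Q : R -> Prop) : (forall t, 0 <= t <= 2 * pi -> P t -> Q t) -> aec P -> aec Q.
Proof. by move=> PQ [N [mN N0 HN]]; exists N; split => // t tt nt; apply: PQ => //; exact: HN. Qed.

Lemma aec_all (P : nat -> R -> Prop) : (forall n, aec (P n)) -> aec (fun t => forall n, P n t).
Proof.
move=> H; have [N HN] := choice H.
exists (\bigcup_n N n); split.
- by apply: bigcupT_measurable => n; case: (HN n).
- apply/eqP; rewrite eq_le measure_ge0 andbT.
  rewrite le_eqVlt; apply/orP; left; apply/eqP; apply: measure_negligible.
    by apply: bigcupT_measurable => n; case: (HN n).
  by apply: negligible_bigcup => n; case: (HN n) => mN N0 _; exists (N n); split.
- by move=> t tt nt n; case: (HN n) => _ _; apply => // h; apply: nt; exists n.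
Qed.

Definition cone be z t : Prop := cmod z < 1 /\ cmod (z - circle_pt t) < be * (1 - cmod z).

Definition ntlim be (u : R[i] -> R) t (l : R) := forall e, 0 < e -> exists2 dl, 0 < dl &
  forall z, cone be z t -> cmod (z - circle_pt t) < dl -> `|u z - l| < e.

Lemma radial_dist r t : 0 <= r <= 1 -> cmod (r%:C * circle_pt t - circle_pt t) = 1 - r :> R.
Proof.
move=> /andP[r0 r1].
have -> : r%:C * circle_pt t - circle_pt t = (r - 1)%:C * circle_pt t :> R[i].
  by rewrite rmorphB /= rmorph1 mulrBl mul1r.
by rewrite cmodM cmod_real circle_pt_cmod mulr1 distrC ger0_norm// subr_ge0.
Qed.

Lemma radial_cone be r t : 1 < be -> 0 <= r < 1 -> cone be (r%:C * circle_pt t) t.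
Proof.
move=> be1 /andP[r0 r1]; split; first by rewrite cmod_polar.
by rewrite radial_dist ?r0 ?(ltW r1)// cmod_polar// ltr_pMl// subr_gt0.
Qed.

Lemma cone_near be t dl : 1 < be -> 0 < dl -> exists2 z, cone be z t & cmod (z - circle_pt t) < dl.
Proof.
move=> be1 dl0; set r : R := 1 - Num.min (1 / 2) (dl / 2).
have m0 : 0 < Num.min (1 / 2) (dl / 2) by rewrite lt_min !divr_gt0.
have m1 : Num.min (1 / 2) (dl / 2) <= 1 / 2 by rewrite ge_min lexx.
have m2 : Num.min (1 / 2) (dl / 2) <= dl / 2 by rewrite ge_min lexx orbT.
exists (r%:C * circle_pt t); first by apply: radial_cone => //; rewrite /r; lra.
by rewrite radial_dist /r; lra.
Qed.

Lemma ntlim_cauchy be (u : R[i] -> R) t : 1 < be ->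
  (forall e, 0 < e -> exists c, exists2 dl, 0 < dl &
    forall z, cone be z t -> cmod (z - circle_pt t) < dl -> `|u z - c| <= e) ->
  exists l, ntlim be u t l.
Proof.
move=> be1 H.
pose L := [set x | exists2 dl, 0 < dl & forall z, cone be z t -> cmod (z - circle_pt t) < dl -> x <= u z].
have ub e c dl x : 0 < dl -> (forall z, cone be z t -> cmod (z - circle_pt t) < dl -> `|u z - c| <= e) ->
    L x -> x <= c + e.
  move=> dl0 Hc [d2 d20 Hx].
  have [z cz] := @cone_near be t (Num.min dl d2) be1 ltac:(by rewrite lt_min dl0).
  rewrite lt_min => /andP[z1 z2]; have := Hx z cz z2; have := Hc z cz z1; rewrite ler_norml; lra.
have lb e c dl : 0 < dl -> (forall z, cone be z t -> cmod (z - circle_pt t) < dl -> `|u z - c| <= e) -> L (c - e).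
  by move=> dl0 Hc; exists dl => // z cz zd; have := Hc z cz zd; rewrite ler_norml; lra.
exists (sup L) => e e0.
have [c [dl dl0 Hc]] := H (e / 3) ltac:(by rewrite divr_gt0).
have cL : c - e / 3 <= sup L.
  by apply: ub_le_sup; [exists (c + e / 3) => x; exact: ub Hc|exact: lb Hc].
have Lc : sup L <= c + e / 3.
  by apply: ge_sup; [exists (c - e / 3); exact: lb Hc|move=> x; exact: ub Hc].
exists dl => // z cz zd; have := Hc z cz zd; rewrite ler_norml ltr_norml; lra.
Qed.

Definition dil (k : nat) : R := 1 - k.+2%:R^-1.

Lemma dil_itv k : 0 < dil k < 1.
Proof.
rewrite /dil ltrBlDr ltrDl invr_gt0 ltr0n andbT subr_gt0.
by rewrite invf_lt1 ?ltr1n// ltr0n.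
Qed.

Lemma dil_lim e : 0 < e -> exists N, forall k, (N <= k)%N -> 1 - dil k < e.
Proof.
move=> e0; exists (Num.bound e^-1) => k hk.
rewrite /dil subKr invf_plt ?posrE ?ltr0n//.
apply: (lt_le_trans (archi_boundP _)); first by rewrite invr_ge0 ltW.
by rewrite ler_nat; apply: (leq_trans hk); rewrite !leqW.
Qed.

Lemma holo_dilate g (r : R) : 0 < r < 1 -> (forall z, cmod z < 1 -> exists d, cderiv g z d) ->
  1 < r^-1 /\ forall z, cmod z < r^-1 -> exists d, cderiv (fun z => g (r%:C * z)) z d.
Proof.
move=> /andP[r0 r1] gd; split; first by rewrite invf_gt1.
move=> z zr; have [|d Hd] := gd (r%:C * z).
  by rewrite cmodM cmod_real gtr0_norm// mulrC -ltr_pdivlMr// div1r.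
by exists (r%:C * d); exact: cderiv_dilate.
Qed.

Lemma dilate_cvg (u : R[i] -> R) z e : (forall dl, 0 < dl -> exists2 eta, 0 < eta &
    forall w, cmod (w - z) < eta -> `|u w - u z| < dl) -> cmod z < 1 -> 0 < e ->
  exists N, forall k, (N <= k)%N -> `|u ((dil k)%:C * z) - u z| <= e.
Proof.
move=> uc z1 e0; have [eta eta0 H] := uc e e0; have [N HN] := dil_lim eta0.
exists N => k /HN hk; apply/ltW/H.
have E (x : R) : x%:C * z - z = (x - 1)%:C * z by rewrite rmorphB /= rmorph1 mulrBl mul1r.
rewrite E cmodM cmod_real distrC ger0_norm; last by case/andP: (dil_itv k) => _ /ltW; rewrite subr_ge0.
apply: le_lt_trans hk; rewrite ler_piMr ?(ltW z1)// subr_ge0.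
by case/andP: (dil_itv k) => _ /ltW.
Qed.

Lemma Re_cont g z d : cderiv g z d -> forall dl, 0 < dl -> exists2 eta, 0 < eta &
  forall w, cmod (w - z) < eta -> `|Re (g w) - Re (g z)| < dl.
Proof.
move=> /cderiv_ccont gc dl dl0; have [eta eta0 H] := gc _ dl0; exists eta => // w wz.
by rewrite -cReB; apply: (le_lt_trans (Re_cmod _)); exact: H.
Qed.

Lemma bm_disk_sub g r : 0 <= r -> (forall z, cmod z <= r -> exists d, cderiv g z d) ->
  bm (fun t => Re (g (r%:C * circle_pt t))).
Proof.
move=> r0 gd; apply: cont_on_bmf; apply: ccont_polar_t => //; [exact: Re_cmod|exact: cReB|].
move=> t _; have [|d /cderiv_ccont//] := gd (r%:C * circle_pt t); by rewrite cmod_polar.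
Qed.

(** A harmonic function bounded in quadratic mean is a limit of Poisson
    integrals of continuous functions that are Cauchy in quadratic mean: take
    near-minimisers of the norm over the functions whose Poisson integral
    approximates u = Re g at least as well as the dilates from index n on, a
    midpoint-convex condition. *)
Lemma cauchy_boundary g M : (forall z, cmod z < 1 -> exists d, cderiv g z d) ->
  (forall r, 0 < r < 1 -> I (fun t => Re (g (r%:C * circle_pt t)) ^+ 2) <= M) ->
  exists v : nat -> R[i] -> R, [/\ forall n, circle_cont (v n),
    forall e, 0 < e -> exists N, forall n m, (N <= n)%N -> (N <= m)%N ->
      I (fun t => (v n (circle_pt t) - v m (circle_pt t)) ^+ 2) < e &
    forall z e, cmod z < 1 -> 0 < e -> exists N, forall n, (N <= n)%N ->
      `|poisson (fun t => v n (circle_pt t)) z - Re (g z)| <= e].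
Proof.
move=> gd gM; pose u z := Re (g z).
pose C (n : nat) (V : R -> R) := exists v, [/\ circle_cont v, V = (fun t => v (circle_pt t)) &
  forall z e, cmod z < 1 -> (forall k, (n <= k)%N -> `|u ((dil k)%:C * z) - u z| <= e) -> `|poisson V z - u z| <= e].
have [|||n|w [Cw Hw]] := @near_minimizers_cauchy C M.
- by move=> n V [v [vc -> _]]; exact: circle_cont_bm.
- move=> n m V nm [v [vc VE H]]; exists v; split => // z e z1 He; apply: H => // k mk.
  by apply: He; exact: leq_trans mk.
- move=> n V W [v [vc VE HV]] [w [wc WE HW]]; exists (fun z => (v z + w z) / 2); split.
  + move=> z zE e e0; have [d1 p1 H1] := vc z zE e e0; have [d2 p2 H2] := wc z zE e e0.
    exists (Num.min d1 d2); first by rewrite lt_min p1.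
    move=> x xE; rewrite lt_min => /andP[x1 x2]; have := H1 x xE x1; have := H2 x xE x2.
    by rewrite !ltr_norml; lra.
  + by rewrite VE WE.
  + move=> z e z1 He; have := HV z e z1 He; have := HW z e z1 He.
    have bV : bm V by rewrite VE; exact: circle_cont_bm.
    have bW : bm W by rewrite WE; exact: circle_cont_bm.
    have -> : poisson (fun t => (V t + W t) / 2) z = (poisson V z + poisson W z) / 2.
      rewrite -poissonD// mulrC -poissonZ//; last exact: bmfD.
      by congr poisson; apply/funext => t; rewrite mulrC.
    by rewrite !ler_norml; lra.
- have rn := dil_itv n; have [r1 rd] := holo_dilate rn gd.
  exists (fun t => u ((dil n)%:C * circle_pt t)); last exact: gM.
  exists (fun z => u ((dil n)%:C * z)); split => //.
    move=> z zE e e0; have [d Hd] := rd z ltac:(by rewrite zE).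
    have [eta eta0 H] := Re_cont Hd e0; exists eta => // x _ xz; exact: H.
  move=> z e z1 He; rewrite -(Re_poisson r1 rd z1); exact: He.
have [v Hv] := choice Cw.
exists v; split.
- by move=> n; case: (Hv n).
- move=> e /Hw [N HN]; exists N => n m nn nm.
  by have := HN n m nn nm; case: (Hv n) => _ -> _; case: (Hv m) => _ -> _.
- move=> z e z1 e0; have [d /Re_cont gc] := gd z z1.
  have [N HN] := dilate_cvg gc z1 e0; exists N => n nn.
  case: (Hv n) => _ E H; have := H z e z1 _; rewrite E; apply.
  by move=> k nk; apply: HN; exact: leq_trans nk.
Qed.

Lemma sq_add (a b : R) : (a + b) ^+ 2 <= 2 * a ^+ 2 + 2 * b ^+ 2.
Proof. by have := sqr_ge0 (a - b); nra. Qed.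

(** Cones are open, so suprema of continuous functions over them are suprema
    over a countable set. *)
Lemma cont_cone_sup be (u : R[i] -> R) (zs : nat -> R[i]) t c :
  (forall z e, cmod z < 1 -> 0 < e -> exists k, cmod (zs k - z) < e) ->
  (forall z, cmod z < 1 -> forall dl, 0 < dl -> exists2 eta, 0 < eta &
    forall w, cmod (w - z) < eta -> `|u w - u z| < dl) ->
  0 < be -> (forall k, cone be (zs k) t -> u (zs k) <= c) -> forall z, cone be z t -> u z <= c.
Proof.
move=> dz uc be0 H z [z1 zc]; apply/ler_addgt0Pr => e e0.
have [eta eta0 K] := uc z z1 e e0.
set s := be * (1 - cmod z) - cmod (z - circle_pt t).
have s0 : 0 < s by rewrite subr_gt0.
set d := Num.min eta (Num.min (1 - cmod z) (s / (1 + be))).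
have b1 : 0 < 1 + be by lra.
have d0 : 0 < d by rewrite !lt_min eta0 subr_gt0 z1 divr_gt0.
have [k] := dz z d z1 d0; rewrite !lt_min => /and3P[k1 k2]; rewrite ltr_pdivlMr// => k3.
have m1 : cmod (zs k) <= cmod z + cmod (zs k - z) by have := cmodD z (zs k - z); rewrite addrC subrK.
have m2 : cmod (zs k - circle_pt t) <= cmod (zs k - z) + cmod (z - circle_pt t).
  by have := cmodD (zs k - z) (z - circle_pt t); rewrite addrA subrK.
have ck : cone be (zs k) t.
  split; first lra.
  move: k3 m1 m2; rewrite /s; set a := cmod (zs k - z); set b := cmod (zs k); set q := cmod (zs k - circle_pt t) => *.
  have : be * b <= be * (cmod z + a) by rewrite ler_wpM2l// ltW.
  lra.
have := H k ck; have := K _ k1; rewrite ltr_norml; lra.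
Qed.

(** Chebyshev's inequality along a subsequence: a family whose suprema are
    arbitrarily small in quadratic mean has small members at almost every
    point. *)
Lemma aec_exists_le (f : nat -> nat -> R -> R) (dl : R) : 0 < dl ->
  (forall n m, bm (f n m)) -> (forall n m t, 0 <= f n m t) ->
  (forall n m k t, (m <= k)%N -> f n m t <= f n k t) ->
  (forall e, 0 < e -> exists n, forall m, I (fun t => f n m t ^+ 2) <= e) ->
  aec (fun t => exists n, forall m, f n m t <= dl).
Proof.
move=> dl0 bf f0 fnd fe.
have ex (j : nat) : exists nM : nat * (R -> \bar R), [/\ measurable_fun `[0, 2 * pi] nM.2,
    forall t, (0 <= nM.2 t)%E, forall m t, ((f nM.1 m t ^+ 2)%:E <= nM.2 t)%E &
    (\int[mu]_(t in `[0%R, (2 * pi)%R]) nM.2 t <= (j.+1%:R^-1)%:E)%E].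
  have [n Hn] := fe j.+1%:R^-1 ltac:(by rewrite invr_gt0 ltr0n).
  have [||||M [mM M0 fM IM _]] := @monotone_majorant R (fun m t => f n m t ^+ 2) (j.+1%:R^-1).
  - by move=> m; apply: bmfX; exact: bf.
  - by move=> m t; exact: sqr_ge0.
  - by move=> m k t mk; rewrite lerXn2r ?nnegrE//; exact: fnd.
  - exact: Hn.
  by exists (n, M).
have [nM HnM] := choice ex.
pose S (j : nat) : set R := `[0, 2 * pi]%classic `&` [set t | ((dl ^+ 2)%:E <= (nM j).2 t)%E].
have mS j : measurable (S j) by apply: emeasurable_fun_c_infty => //; case: (HnM j).
have muS j : ((dl ^+ 2)%:E * mu (S j) <= (j.+1%:R^-1)%:E)%E.
  have [mM M0 _ IM] := HnM j; apply: le_trans IM.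
  have <- : (\int[mu]_(t in S j) (dl ^+ 2)%:E = (dl ^+ 2)%:E * mu (S j))%E by exact: (integral_cst mu (mS j) (dl ^+ 2)%:E).
  apply: (@le_trans _ _ (\int[mu]_(t in S j) (nM j).2 t)%E).
    apply: ge0_le_integral; [exact: mS|by move=> t _; rewrite lee_fin sqr_ge0|exact: measurable_cst|by apply: measurable_funS mM => //; exact: subIsetl|by move=> t []].
  by apply: ge0_subset_integral => //; [exact: mS|exact: subIsetl].
exists (\bigcap_j S j); split.
- exact: bigcapT_measurable.
- apply/eqP; rewrite eq_le measure_ge0 andbT; apply/lee_addgt0Pr => e e0; rewrite add0e.
  have d2 : 0 < dl ^+ 2 by rewrite exprn_gt0.
  have [j Hj] : exists j : nat, j.+1%:R^-1 < dl ^+ 2 * e.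
    exists (Num.bound (dl ^+ 2 * e)^-1); rewrite invf_plt ?posrE ?ltr0n ?mulr_gt0//.
    by apply: (lt_le_trans (archi_boundP _)); rewrite ?ler_nat// invr_ge0 mulr_ge0// ltW.
  apply: (@le_trans _ _ (mu (S j))).
    by apply: le_measure; rewrite ?inE; [exact: bigcapT_measurable|exact: mS|move=> t; apply].
  rewrite -(@lee_pmul2l _ ((dl ^+ 2)%:E))// ?lte_fin//.
  by apply: (le_trans (muS j)); rewrite -EFinM lee_fin ltW.
- move=> t tt nt; have [j nS] : exists j, ~ S j t.
    by apply: contrapT => h; apply: nt => j _; apply: contrapT => h2; apply: h; exists j.
  exists (nM j).1 => m; have [_ _ fM _] := HnM j.
  rewrite leNgt; apply/negP => lt1; apply: nS; split; first by rewrite /= in_itv /=.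
  by apply: le_trans (fM m t); rewrite lee_fin lerXn2r ?nnegrE// ltW.
Qed.

(** By the maximal inequality, the supremum over the cone of the difference
    between Re g and the Poisson integral of v n is small in L2 for large n,
    hence small at almost every point for some n; and the Poisson integral of
    the continuous function v n has limits everywhere. *)
Theorem ntlim_L2 g be M : 1 < be -> (forall z, cmod z < 1 -> exists d, cderiv g z d) ->
  (forall r, 0 < r < 1 -> I (fun t => Re (g (r%:C * circle_pt t)) ^+ 2) <= M) ->
  aec (fun t => exists l, ntlim be (fun z => Re (g z)) t l).
Proof.
move=> be1 gd gM; have [v [vc vC vP]] := cauchy_boundary gd gM.
have be0 : 0 <= be by lra.
have [zs [zs1 zsd]] := dense_sequence.
pose w n t := v n (circle_pt t).
have bw n : bm (w n) by exact: circle_cont_bm.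
pose D n z := `|Re (g z) - poisson (w n) z|.
pose F n k := D n (zs k).
pose K := (8 * (1 + be) ^+ 2) ^+ 2 : R.
have K0 : 0 <= K by exact: sqr_ge0.
have key e : 0 < e -> exists N, forall n, (N <= n)%N -> forall m, I (fun t => ntmax be zs (F n) m t ^+ 2) <= e.
  move=> e0; set e1 := e / (4 * (K + 1)).
  have K1 : 0 < K + 1 by lra.
  have e10 : 0 < e1 by rewrite divr_gt0// mulr_gt0.
  have [N HN] := vC e1 e10; exists N => n nN m.
  have pp := @pi2_gt0 R.
  have [eta eta0 Heta] : exists2 eta : R, 0 < eta & 2 * pi * eta ^+ 2 <= e1.
    exists (Num.min 1 (e1 / (2 * pi))); first by rewrite lt_min ltr01 divr_gt0.
    set x := Num.min _ _; have x1 : x <= 1 by rewrite ge_min lexx.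
    have x2 : x <= e1 / (2 * pi) by rewrite ge_min lexx orbT.
    have x0 : 0 <= x by rewrite le_min ler01 divr_ge0 ?(ltW pp)// ltW.
    have : x * (2 * pi) <= e1 by rewrite -ler_pdivlMr.
    move: pp; set P := 2 * pi => pp h.
    by apply: le_trans h; rewrite mulrC ler_wpM2r ?(ltW pp)// expr2 ler_piMr.
  have [q qN Hq] : exists2 q, (N <= q)%N & forall k, (k < m)%N -> `|poisson (w q) (zs k) - Re (g (zs k))| <= eta.
    have [f Hf] := choice (fun k => vP (zs k) eta (zs1 k) eta0).
    exists (maxn N (\max_(k < m) f k)); first exact: leq_maxl.
    move=> k km; apply: Hf; apply: leq_trans (leq_maxr _ _).
    exact: (@leq_bigmax _ (fun k : 'I_m => f k) (Ordinal km)).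
  pose V t := `|w q t - w n t| + eta.
  have bV : bm V by apply: bmfD; [apply: bmf_norm; exact: bmfB|exact: bmf_cst].
  have V0 t : 0 <= t <= 2 * pi -> 0 <= V t by move=> _; rewrite addr_ge0// ltW.
  have FV k : (k < m)%N -> F n k <= poisson V (zs k).
    move=> km; rewrite /F /D.
    have bd : bm (fun t => w q t - w n t) by exact: bmfB.
    rewrite poissonD ?poisson_cst//; [|exact: bmf_norm|exact: bmf_cst].
    have h1 : `|poisson (w q) (zs k) - poisson (w n) (zs k)| <= poisson (fun t => `|w q t - w n t|) (zs k).
      rewrite -poissonB// ler_norml -poissonN//; last exact: bmf_norm.
      apply/andP; split; apply: poisson_le => //; try exact: bmf_norm.
      + by apply: bmfN; exact: bmf_norm.
      + by move=> t _; rewrite lerNl -normrN ler_norm.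
      + by move=> t _; exact: ler_norm.
    have := Hq k km; move: h1; rewrite !ler_norml; lra.
  have F0 k : 0 <= F n k by exact: normr_ge0.
  apply: le_trans (ntmax_bound be0 zs1 F0 bV V0 FV) _; rewrite -/K.
  have b2 := bmfX 2 (bmfB (bw q) (bw n)).
  have : I (fun t => V t ^+ 2) <= 2 * e1 + 2 * e1.
    apply: (@le_trans _ _ (I (fun t => 2 * (w q t - w n t) ^+ 2 + 2 * eta ^+ 2))).
      apply: ri_le; [exact: bmfX|by apply: bmfD; [exact: bmfZ|exact: bmf_cst]|].
      by move=> t _; apply: (le_trans (sq_add _ _)); rewrite real_normK ?num_real.
    rewrite riD ?ri_cst ?riZ ?pi2_ge0//; [|exact: bmfZ|exact: bmf_cst].
    apply: lerD; first by rewrite ler_wpM2l// ltW//; exact: HN.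
    by rewrite subr0 -mulrA ler_wpM2l// mulrC.
  move=> h; apply: (@le_trans _ _ (K * (2 * e1 + 2 * e1))); first by rewrite ler_wpM2l.
  have -> : K * (2 * e1 + 2 * e1) = K / (K + 1) * e by rewrite /e1; field; exact: lt0r_neq0.
  by rewrite ler_piMl ?(ltW e0)// ler_pdivrMr// mul1r; lra.
have aesmall (i : nat) : aec (fun t => exists n, forall m, ntmax be zs (F n) m t <= i.+1%:R^-1).
  apply: aec_exists_le; rewrite ?invr_gt0 ?ltr0n//.
  - by move=> n m; exact: bm_ntmax.
  - by move=> n m t; exact: ntmax_ge0.
  - by move=> n m k t mk; exact: ntmax_nd.
  - by move=> e /key[N HN]; exists N => m; exact: HN.
have := aec_all aesmall; apply: aec_imp => t tt Ht.
apply: ntlim_cauchy => // e e0.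
have [i Hi] : exists i : nat, i.+1%:R^-1 < e / 2.
  exists (Num.bound (e / 2)^-1); rewrite invf_plt ?posrE ?ltr0n ?divr_gt0//.
  by apply: (lt_le_trans (archi_boundP _)); rewrite ?ler_nat// invr_ge0 divr_ge0// ltW.
have [n Hn] := Ht i.
have Dc z : cmod z < 1 -> forall dl, 0 < dl -> exists2 eta, 0 < eta &
    forall w, cmod (w - z) < eta -> `|D n w - D n z| < dl.
  move=> z1 dl dl0; have [d /Re_cont /(_ _ (divr_gt0 dl0 (@ltr0n R 2))) [e1 e10 H1]] := gd z z1.
  have /Re_cont /(_ _ (divr_gt0 dl0 (@ltr0n R 2))) [e2 e20 H2] := cderiv_herglotz (bw n) z1.
  exists (Num.min (1 - cmod z) (Num.min e1 e2)); first by rewrite !lt_min e10 e20 subr_gt0 z1.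
  move=> x; rewrite !lt_min => /and3P[x1 /H1 h1 /H2]; rewrite !Re_herglotz//; last first.
    by have := cmodD z (x - z); rewrite addrC subrK; lra.
  move=> h2; apply: (le_lt_trans (ler_dist_dist _ _)).
  by move: h1 h2; rewrite !ltr_norml; lra.
have Dle z : cone be z t -> D n z <= e / 2.
  apply: (cont_cone_sup zsd Dc) => [|k ck]; first lra.
  apply: le_trans (ltW Hi); apply: le_trans (Hn k.+1).
  by apply: ntmax_ge => //; case: ck.
have [dl dl0 Hdl] := poisson_boundary (vc n) (circle_pt_cmod t) (divr_gt0 e0 (@ltr0n R 2)).
exists (v n (circle_pt t)), dl => // z cz zd.
have := Dle z cz; have := Hdl z (proj1 cz) zd; rewrite /D ltr_norml !ler_norml; lra.
Qed.

End NontangentialLimits.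

(** * Non-tangential limits in the Hardy class *)

Section HardyLimits.
Context {R : realType}.
Implicit Types (z w xi : R[i]) (t e r be : R) (V W : R -> R) (g : R[i] -> R[i]).
Local Notation Re := (@complex.Re R).
Local Notation Im := (@complex.Im R).
Local Notation pi := (@pi R).
Local Notation bm := (bmf 0 (2 * pi)).
Local Notation I := (ri 0 (2 * pi)).

Lemma real_cauchy (x : nat -> R) :
  (forall e, 0 < e -> exists N, forall n m, (N <= n)%N -> (N <= m)%N -> `|x n - x m| <= e) ->
  exists l, forall e, 0 < e -> exists N, forall n, (N <= n)%N -> `|x n - l| <= e.
Proof.
move=> H; pose L := [set y | exists N, forall n, (N <= n)%N -> y <= x n].
exists (sup L) => e e0; have [N HN] := H e e0; exists N => n nN.
have Ll y : L y -> y <= x n + e.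
  move=> [M HM]; have := HM (maxn N M) (leq_maxr _ _).
  by have := HN (maxn N M) n (leq_maxl _ _) nN; rewrite ler_norml; lra.
have lL : L (x n - e) by exists N => m mN; have := HN n m nN mN; rewrite ler_norml; lra.
have : x n - e <= sup L by apply: ub_le_sup => //; exists (x n + e) => y; exact: Ll.
have : sup L <= x n + e by apply: ge_sup; [exists (x n - e)|move=> y; exact: Ll].
by rewrite ler_norml; lra.
Qed.

Lemma complex_cauchy (x : nat -> R[i]) :
  (forall e, 0 < e -> exists N, forall n m, (N <= n)%N -> (N <= m)%N -> cmod (x n - x m) <= e) ->
  exists l : R[i], forall e, 0 < e -> exists N, forall n, (N <= n)%N -> cmod (x n - l) <= e.
Proof.
move=> H.
have [a Ha] : exists l, forall e, 0 < e -> exists N, forall n, (N <= n)%N -> `|Re (x n) - l| <= e.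
  apply: real_cauchy => e /H [N HN]; exists N => n m nN mN.
  by rewrite -cReB; apply: le_trans (Re_cmod _) _; exact: HN.
have [b Hb] : exists l, forall e, 0 < e -> exists N, forall n, (N <= n)%N -> `|Im (x n) - l| <= e.
  apply: real_cauchy => e /H [N HN]; exists N => n m nN mN.
  by rewrite -cImB; apply: le_trans (Im_cmod _) _; exact: HN.
exists (a +i* b) => e e0.
have [N1 H1] := Ha (e / 2) ltac:(by rewrite divr_gt0).
have [N2 H2] := Hb (e / 2) ltac:(by rewrite divr_gt0).
exists (maxn N1 N2) => n; rewrite geq_max => /andP[/H1 h1 /H2 h2].
apply: (le_trans (cmod_ReIm _)); rewrite cReB cImB /=; lra.
Qed.

Lemma herglotzB V W z : bm V -> bm W -> cmod z < 1 ->
  herglotz V z - herglotz W z = herglotz (fun t => V t - W t) z.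
Proof.
move=> bV bW z1; rewrite /herglotz -mulrBl -ciB; [|by apply: cbmM; [exact: cbm_hk|exact: cbm_real]..].
by congr (_ / _); apply: eq_ci => t; rewrite rmorphB mulrBr.
Qed.

Lemma herglotz'B V W z : bm V -> bm W -> cmod z < 1 ->
  herglotz' V z - herglotz' W z = herglotz' (fun t => V t - W t) z.
Proof.
move=> bV bW z1; rewrite /herglotz' -mulrBl -ciB; [|by apply: cbmM; [exact: cbm_hk'|exact: cbm_real]..].
by congr (_ / _); apply: eq_ci => t; rewrite rmorphB mulrBr.
Qed.

Lemma kernel_bound (K : R -> R[i]) (c : R) V : cbm K -> bm V -> (forall t, cmod (K t) <= c) ->
  cmod (ci (fun t => K t * (V t)%:C) / (2 * pi)%:C) <= c * I (fun t => `|V t|).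
Proof.
move=> cK bV Kc; have aV := bmf_norm bV.
have c0 : 0 <= c by apply: le_trans (Kc 0); exact: cmod_ge0.
rewrite cmodM cmodV cmod_real (gtr0_norm pi2_gt0) ler_pdivrMr ?pi2_gt0//.
apply: le_trans (@ci_bound _ _ (fun t => c * `|V t|) _ _ _) _.
- by apply: cbmM => //; exact: cbm_real.
- exact: bmfZ.
- by move=> t _; rewrite cmodM cmod_real ler_wpM2r.
rewrite riZ// mulrC ler_wpM2l//; first by apply: mulr_ge0 => //; exact: ri_ge0.
by have := pi_ge2 R; lra.
Qed.

Lemma herglotz_bound V z : bm V -> cmod z < 1 ->
  cmod (herglotz V z) <= 2 / (1 - cmod z) * I (fun t => `|V t|).
Proof.
move=> bV z1; apply: kernel_bound => //; first exact: cbm_hk.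
move=> t; have d0 : 0 < 1 - cmod z by rewrite subr_gt0.
have n0 : 0 < cmod (circle_pt t - z) by apply: lt_le_trans d0 _; exact: circle_sub_ge.
rewrite /hk cmodM cmodV; apply: ler_pM; rewrite ?cmod_ge0 ?invr_ge0 ?(ltW n0)//.
  by apply: (le_trans (cmodD _ _)); rewrite circle_pt_cmod; lra.
by rewrite lef_pV2 ?posrE//; exact: circle_sub_ge.
Qed.

Lemma herglotz'_bound V z : bm V -> cmod z < 1 ->
  cmod (herglotz' V z) <= 2 / (1 - cmod z) ^+ 2 * I (fun t => `|V t|).
Proof.
move=> bV z1; apply: kernel_bound => //; first exact: cbm_hk'.
move=> t; have d0 : 0 < 1 - cmod z by rewrite subr_gt0.
have n0 : 0 < cmod (circle_pt t - z) by apply: lt_le_trans d0 _; exact: circle_sub_ge.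
rewrite /hk' cmodM cmodV cmodX (cmodM 2) (circle_pt_cmod t) mulr1.
have -> : cmod (2 : R[i]) = 2 by rewrite (_ : (2 : R[i]) = (2 : R)%:C) ?cmod_real ?ger0_norm// rmorph_nat.
rewrite ler_wpM2l// lef_pV2 ?posrE ?exprn_gt0//.
by rewrite ler_pXn2r ?nnegrE ?(ltW d0) ?(ltW n0)//; exact: circle_sub_ge.
Qed.

Lemma l1_l2 V : bm V -> I (fun t => `|V t|) ^+ 2 <= I (fun t => V t ^+ 2) * (2 * pi).
Proof.
move=> bV; have := cauchy_schwarz (bmf_norm bV) (bmf_cst 0 (2 * pi) 1).
have -> : I (fun t => `|V t| * 1) = I (fun t => `|V t|) by apply: eq_ri => t _; rewrite mulr1.
have -> : I (fun t => `|V t| ^+ 2) = I (fun t => V t ^+ 2) by apply: eq_ri => t _; rewrite real_normK ?num_real.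
by rewrite expr1n ri_cst ?pi2_ge0// mul1r subr0.
Qed.

(** Herglotz transforms depend continuously on the density in mean, locally
    uniformly in the disk and together with their derivatives, with quadratic
    Taylor remainders that pass to the limit. *)
Lemma herglotz_limit (w : nat -> R -> R) : (forall n, bm (w n)) ->
  (forall e, 0 < e -> exists N, forall n m, (N <= n)%N -> (N <= m)%N ->
    I (fun t => `|w n t - w m t|) <= e) ->
  exists U, (forall z, cmod z < 1 -> exists d, cderiv U z d) /\
    forall r e, r < 1 -> 0 < e -> exists N, forall n, (N <= n)%N -> forall z, cmod z <= r ->
      cmod (herglotz (w n) z - U z) <= e.
Proof.
move=> bw wC.
have scale (k e : R) : 0 < k -> 0 < e -> exists N, forall n m, (N <= n)%N -> (N <= m)%N ->
    k * I (fun t => `|w n t - w m t|) <= e.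
  move=> k0 e0; have [N HN] := wC (e / k) (divr_gt0 e0 k0); exists N => n m nN mN.
  by rewrite mulrC -ler_pdivlMr//; exact: HN.
have exU z : exists l : R[i], cmod z < 1 -> forall e, 0 < e -> exists N, forall n, (N <= n)%N -> cmod (herglotz (w n) z - l) <= e.
  have [z1|z1] := ltP (cmod z) 1; last by exists 0.
  have d0 : 0 < 1 - cmod z by rewrite subr_gt0.
  have [|l Hl] := @complex_cauchy (fun n => herglotz (w n) z); last by exists l.
  move=> e e0; have [N HN] := scale (2 / (1 - cmod z)) e (divr_gt0 (@ltr0n R 2) d0) e0.
  exists N => n m nN mN; rewrite herglotzB//.
  by apply: le_trans (herglotz_bound _ z1) _; [exact: bmfB|exact: HN].
have exU' z : exists l : R[i], cmod z < 1 -> forall e, 0 < e -> exists N, forall n, (N <= n)%N -> cmod (herglotz' (w n) z - l) <= e.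
  have [z1|z1] := ltP (cmod z) 1; last by exists 0.
  have d0 : 0 < 1 - cmod z by rewrite subr_gt0.
  have [|l Hl] := @complex_cauchy (fun n => herglotz' (w n) z); last by exists l.
  move=> e e0; have [N HN] := scale (2 / (1 - cmod z) ^+ 2) e (divr_gt0 (@ltr0n R 2) (exprn_gt0 2 d0)) e0.
  exists N => n m nN mN; rewrite herglotz'B//.
  by apply: le_trans (herglotz'_bound _ z1) _; [exact: bmfB|exact: HN].
have [U HU] := choice exU; have [U' HU'] := choice exU'.
have [N0 HN0] := wC 1 ltr01.
set B := I (fun t => `|w N0 t|) + 1.
have wB n : (N0 <= n)%N -> I (fun t => `|w n t|) <= B.
  move=> nN; apply: le_trans (_ : I (fun t => `|w N0 t| + `|w n t - w N0 t|) <= _).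
    apply: ri_le; [exact: bmf_norm|by apply: bmfD; apply: bmf_norm => //; exact: bmfB|].
    by move=> t _; have := ler_normD (w N0 t) (w n t - w N0 t); rewrite addrC subrK.
  by rewrite riD ?lerD2l ?HN0//; apply: bmf_norm => //; exact: bmfB.
exists U; split.
  move=> z z1; exists (U' z); have d0 : 0 < 1 - cmod z by rewrite subr_gt0.
  apply: (@taylor_cderiv _ _ _ _ (8 / (1 - cmod z) ^+ 3 * B) ((1 - cmod z) / 2)); first by rewrite divr_gt0.
  move=> h hz; have zh1 : cmod (z + h) < 1 by have := cmodD z h; lra.
  apply/ler_addgt0Pr => e e0.
  have c0 : 0 < 2 + cmod h by rewrite ltr_wpDr ?cmod_ge0.
  set e1 := e / (2 + cmod h); have e10 : 0 < e1 by rewrite divr_gt0.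
  have [N1 H1] := HU _ zh1 _ e10; have [N2 H2] := HU _ z1 _ e10; have [N3 H3] := HU' _ z1 _ e10.
  set n := maxn N0 (maxn N1 (maxn N2 N3)).
  have n1 : (N1 <= n)%N by rewrite /n !leq_max leqnn !orbT.
  have n2 : (N2 <= n)%N by rewrite /n !leq_max leqnn !orbT.
  have n3 : (N3 <= n)%N by rewrite /n !leq_max leqnn !orbT.
  have := herglotz_taylor (bw n) z1 hz; have := wB n (leq_maxl _ _).
  move: (H1 n n1) (H2 n n2) (H3 n n3).
  set a := herglotz (w n) (z + h); set b := herglotz (w n) z; set c := herglotz' (w n) z => q1 q2 q3 q4 q5.
  have -> : U (z + h) - U z - U' z * h =
     (a - b - c * h) + (- (a - U (z + h)) + ((b - U z) + (c - U' z) * h)) by ring.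
  apply: (le_trans (cmodD _ _)); apply: lerD.
    apply: (le_trans q5); rewrite ler_wpM2r ?exprn_ge0 ?cmod_ge0//.
    by rewrite ler_wpM2l// divr_ge0// exprn_ge0// ltW.
  have -> : e = e1 + (e1 + e1 * cmod h) by rewrite /e1; field; exact: lt0r_neq0.
  apply: (le_trans (cmodD _ _)); rewrite cmodN; apply: lerD => //.
  apply: (le_trans (cmodD _ _)); apply: lerD => //.
  by rewrite cmodM ler_wpM2r ?cmod_ge0.
move=> r e r1 e0; have d0 : 0 < 1 - r by rewrite subr_gt0.
have [N HN] := scale (2 / (1 - r)) e (divr_gt0 (@ltr0n R 2) d0) e0.
exists N => n nN z zr; have z1 : cmod z < 1 by exact: le_lt_trans zr r1.
apply/ler_addgt0Pr => e1 e10; have [M HM] := HU _ z1 _ e10.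
have := HM _ (leq_maxr N M); have := HN n _ nN (leq_maxl N M); set m := maxn N M => q1 q2.
have -> : herglotz (w n) z - U z = (herglotz (w n) z - herglotz (w m) z) + (herglotz (w m) z - U z) by ring.
apply: (le_trans (cmodD _ _)); apply: lerD => //; apply: le_trans q1.
rewrite herglotzB//; apply: le_trans (herglotz_bound _ z1) _; first exact: bmfB.
rewrite ler_wpM2r//; first exact: ri_ge0.
by rewrite ler_wpM2l// lef_pV2 ?posrE ?subr_gt0// lerB.
Qed.

(** Jensen's inequality: the square lies above its tangent at c = poisson V z,
    and the Poisson integral is monotone and reproduces constants. *)
Lemma poisson_sqr V z : bm V -> cmod z < 1 -> poisson V z ^+ 2 <= poisson (fun t => V t ^+ 2) z.
Proof.
move=> bV z1; set c := poisson V z.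
have b2 := bmfX 2 bV; have bc := bmf_cst 0 (2 * pi) (- c ^+ 2).
have : poisson (fun t => 2 * c * V t + - c ^+ 2) z <= poisson (fun t => V t ^+ 2) z.
  apply: poisson_le => //; first by apply: bmfD => //; exact: bmfZ.
  by move=> t _; have := sqr_ge0 (V t - c); nra.
rewrite poissonD ?poissonZ ?poisson_cst -/c//; last exact: bmfZ.
by nra.
Qed.

Lemma herglotz_circle_L2 V r : bm V -> 0 < r < 1 ->
  I (fun t => Re (herglotz V (r%:C * circle_pt t)) ^+ 2) <= I (fun t => V t ^+ 2).
Proof.
move=> bV /andP[r0 r1]; have b2 := bmfX 2 bV.
have dh W : bm W -> forall z, cmod z < 1 -> exists d, cderiv (herglotz W) z d.
  by move=> bW z z1; exists (herglotz' W z); exact: cderiv_herglotz.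
have bh W : bm W -> bm (fun t => Re (herglotz W (r%:C * circle_pt t))).
  by move=> bW; apply: bm_disk_sub (ltW r0) _ => z zr; apply: dh => //; exact: le_lt_trans zr r1.
have c1 t : cmod (r%:C * circle_pt t : R[i]) < 1 by rewrite cmod_polar ?(ltW r0).
have -> : I (fun t => V t ^+ 2) = I (fun t => Re (herglotz (fun t => V t ^+ 2) (r%:C * circle_pt t))).
  rewrite (mean_value0 (dh _ b2) r0 r1) Re_herglotz ?cmod0// /poisson mulrCA divff ?mulr1 ?lt0r_neq0 ?pi2_gt0//.
  by apply: eq_ri => t _; rewrite /pk cmod0 expr0n subr0 subr0 circle_pt_cmod expr1n divr1 mul1r.
apply: ri_le; [by apply: bmfX; exact: bh|exact: bh|].
by move=> t _; rewrite !Re_herglotz//; exact: poisson_sqr.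
Qed.

Definition mi : R[i] := 0 +i* (-1).
Lemma Re_mi z : Re (mi * z) = Im z.
Proof. by rewrite cReM /= mul0r mulN1r sub0r opprK. Qed.

(** The real part of g^2 is harmonic, so the means of (Re g)^2 - (Im g)^2 over
    circles are constant. *)
Lemma Im_circle_L2 g r : (forall z, cmod z < 1 -> exists d, cderiv g z d) -> 0 < r < 1 ->
  I (fun t => Im (g (r%:C * circle_pt t)) ^+ 2) <=
  I (fun t => Re (g (r%:C * circle_pt t)) ^+ 2) + 2 * pi * Im (g 0) ^+ 2.
Proof.
move=> gd /andP[r0 r1].
have d2 z : cmod z < 1 -> exists d, cderiv (fun z => g z * g z) z d.
  by move=> /gd[d Hd]; eexists; exact: (cderivM Hd Hd).
have di z : cmod z < 1 -> exists d, cderiv (fun z => mi * g z) z d.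
  by move=> /gd[d Hd]; eexists; exact: (cderivM (cderiv_cst mi _) Hd).
have sub f : (forall z, cmod z < 1 -> exists d, cderiv f z d) -> bm (fun t => Re (f (r%:C * circle_pt t))).
  by move=> fd; apply: bm_disk_sub (ltW r0) _ => z zr; apply: fd; exact: le_lt_trans zr r1.
have b1 := sub _ gd; have := sub _ di; under eq_fun do rewrite Re_mi.
move=> b2.
have := mean_value0 d2 r0 r1; rewrite cReM.
have -> : I (fun t => Re (g (r%:C * circle_pt t) * g (r%:C * circle_pt t))) =
   I (fun t => Re (g (r%:C * circle_pt t)) ^+ 2) - I (fun t => Im (g (r%:C * circle_pt t)) ^+ 2).
  by rewrite -riB; [|exact: bmfX..]; apply: eq_ri => t _; rewrite cReM !expr2.
rewrite -!expr2 => E; have : 0 <= 2 * pi * Re (g 0) ^+ 2 by rewrite mulr_ge0 ?pi2_ge0 ?sqr_ge0.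
by move: E; rewrite mulrBr; lra.
Qed.


Definition cntlim be (u : R[i] -> R[i]) t (l : R[i]) := forall e, 0 < e -> exists2 dl, 0 < dl &
  forall z, cone be z t -> cmod (z - circle_pt t) < dl -> cmod (u z - l) < e.

Lemma cntlim_ReIm be u t : (exists a, ntlim be (fun z => Re (u z)) t a) ->
  (exists b, ntlim be (fun z => Re (mi * u z)) t b) -> exists l, cntlim be u t l.
Proof.
move=> [a Ha] [b Hb]; exists (a +i* b) => e e0.
have [d1 p1 H1] := Ha (e / 2) ltac:(by rewrite divr_gt0).
have [d2 p2 H2] := Hb (e / 2) ltac:(by rewrite divr_gt0).
exists (Num.min d1 d2); first by rewrite lt_min p1.
move=> z cz; rewrite lt_min => /andP[/(H1 z cz) h1 /(H2 z cz)]; rewrite Re_mi => h2.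
apply: (le_lt_trans (cmod_ReIm _)); rewrite cReB cImB /=; lra.
Qed.

Lemma cntlim_cst be (k : R[i]) t : cntlim be (fun=> k) t k.
Proof. by move=> e e0; exists 1 => // z _ _; rewrite subrr cmod0. Qed.

Lemma cntlimD be u v t (l m : R[i]) : cntlim be u t l -> cntlim be v t m ->
  cntlim be (fun z => u z + v z) t (l + m).
Proof.
move=> Hu Hv e e0.
have [d1 p1 H1] := Hu (e / 2) ltac:(by rewrite divr_gt0).
have [d2 p2 H2] := Hv (e / 2) ltac:(by rewrite divr_gt0).
exists (Num.min d1 d2); first by rewrite lt_min p1.
move=> z cz; rewrite lt_min => /andP[/(H1 z cz) h1 /(H2 z cz) h2].
have -> : u z + v z - (l + m) = (u z - l) + (v z - m) by ring.
apply: (le_lt_trans (cmodD _ _)); lra.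
Qed.

Lemma cntlimM be u v t (l m : R[i]) : cntlim be u t l -> cntlim be v t m ->
  cntlim be (fun z => u z * v z) t (l * m).
Proof.
move=> Hu Hv e e0; set a := cmod l + cmod m + 1.
have a1 : 1 <= a by rewrite /a; have := cmod_ge0 l; have := cmod_ge0 m; lra.
set e1 := Num.min 1 (e / (2 * a)).
have a20 : 0 < 2 * a by lra.
have e10 : 0 < e1 by rewrite lt_min ltr01 divr_gt0.
have e11 : e1 <= 1 by rewrite ge_min lexx.
have e12 : e1 * (2 * a) <= e by rewrite -ler_pdivlMr// ge_min lexx orbT.
have [d1 p1 H1] := Hu _ e10; have [d2 p2 H2] := Hv _ e10.
exists (Num.min d1 d2); first by rewrite lt_min p1.
move=> z cz; rewrite lt_min => /andP[/(H1 z cz) h1 /(H2 z cz) h2].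
have -> : u z * v z - l * m = (u z - l) * (v z - m) + ((u z - l) * m + l * (v z - m)) by ring.
apply: (le_lt_trans (cmodD _ _)); rewrite cmodM.
have q1 := cmodD ((u z - l) * m) (l * (v z - m)); rewrite (cmodM (u z - l)) (cmodM l) in q1.
have := cmod_ge0 l; have := cmod_ge0 m; move: h1 h2 q1 (cmod_ge0 (u z - l)) (cmod_ge0 (v z - m)).
rewrite /a in a1 a20 e12; clear -e0 e10 e11 e12.
set x := cmod (u z - l); set y := cmod (v z - m); set L := cmod l; set M := cmod m; set q := cmod _.
rewrite -/L -/M in e12 * => h1 h2 q1 x0 y0 M0 L0.
have : x * y <= e1 * 1 by apply: ler_pM => //; lra.
have : x * M <= e1 * M by rewrite ler_wpM2r// ltW.
have : L * y <= L * e1 by rewrite ler_wpM2l// ltW.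
nra.
Qed.

Lemma cntlimX be u t (l : R[i]) n : cntlim be u t l -> cntlim be (fun z => u z ^+ n) t (l ^+ n).
Proof.
move=> H; elim: n => [|n IH]; first by rewrite expr0; exact: cntlim_cst.
by rewrite exprS; under eq_fun do rewrite exprS; exact: cntlimM.
Qed.

Lemma eq_cntlim be u v t (l : R[i]) : (forall z, cmod z < 1 -> u z = v z) -> cntlim be u t l -> cntlim be v t l.
Proof.
move=> E H e /H [dl dl0 K]; exists dl => // z cz zd; rewrite -E; first exact: K.
by case: cz.
Qed.

Lemma cntlim_H2 g be M : 1 < be -> (forall z, cmod z < 1 -> exists d, cderiv g z d) ->
  (forall r, 0 < r < 1 -> I (fun t => Re (g (r%:C * circle_pt t)) ^+ 2) <= M) ->
  aec (fun t => exists l, cntlim be g t l).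
Proof.
move=> be1 gd gM; have h1 := ntlim_L2 be1 gd gM.
have h2 : aec (fun t => exists l, ntlim be (fun z => Re (mi * g z)) t l).
  apply: (ntlim_L2 (M := M + 2 * pi * Im (g 0) ^+ 2)) => //.
    by move=> z /gd[d Hd]; eexists; exact: (cderivM (cderiv_cst mi _) Hd).
  move=> r r01; under eq_ri do rewrite Re_mi.
  by apply: (le_trans (Im_circle_L2 gd r01)); rewrite lerD2r; exact: gM.
by apply: aec_imp (aec_and h1 h2) => t _ [l1 l2]; exact: cntlim_ReIm.
Qed.

(** If g had boundary values, U would be the Herglotz transform of |g*|^(p/2).
    Without them, let C n be the densities whose Poisson integral dominates
    the tail, from n on, of the dilates of |g|^(p/2). Near-minimisers of the
    L2 norm over C n converge in quadratic mean, and U is the limit of their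
    Herglotz transforms. *)
Lemma hardy_majorant g (p M : R) : 0 < p -> (forall z, cmod z < 1 -> exists d, cderiv g z d) ->
  (forall r, 0 < r < 1 -> I (fun t => cmod (g (r%:C * circle_pt t)) `^ p) <= M) ->
  exists U M', [/\ forall z, cmod z < 1 -> exists d, cderiv U z d,
    forall z, cmod z < 1 -> cmod (g z) `^ (p / 2) <= Re (U z) &
    forall r, 0 < r < 1 -> I (fun t => Re (U (r%:C * circle_pt t)) ^+ 2) <= M'].
Proof.
move=> p0 gd gM; set q := p / 2; have q0 : 0 < q by rewrite divr_gt0.
pose A (k : nat) (z : R[i]) : R := cmod (g ((dil k)%:C * z)) `^ q.
have A2 k t : A k (circle_pt t) ^+ 2 = cmod (g ((dil k)%:C * circle_pt t)) `^ p.
  by rewrite /A -powR_mulrn ?powR_ge0// -powRrM /q mulfVK.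
have Ad k := holo_dilate (dil_itv k) gd.
have Ac k : ccont_disk (A k) by case: (Ad k) => r1 rd; exact: (ccont_disk_norm_powR r1 q0 rd).
have Acirc k : circle_cont (A k).
  move=> x xE e e0; have [dl dl0 H] := Ac k x (eq_ind_r (fun y => y <= 1) (lexx _) xE) e e0.
  by exists dl => // w wE; apply: H; rewrite wE.
pose C (n : nat) (V : R -> R) := bm V /\ forall z (c : R), cmod z < 1 ->
  (forall k, (n <= k)%N -> c <= A k z) -> c <= poisson V z.
have [|||n|w [Cw wC]] := @near_minimizers_cauchy R C M.
- by move=> n V [].
- move=> n m V nm [bV H]; split => // z c z1 Hc; apply: H => // k mk.
  by apply: Hc; exact: leq_trans mk.
- move=> n V W [bV HV] [bW HW]; split.
    by under eq_fun do rewrite mulrC; apply: bmfZ; exact: bmfD.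
  move=> z c z1 Hc; have := HV z c z1 Hc; have := HW z c z1 Hc.
  have -> : poisson (fun t => (V t + W t) / 2) z = (poisson V z + poisson W z) / 2.
    rewrite -poissonD// mulrC -poissonZ//; last exact: bmfD.
    by congr poisson; apply/funext => t; rewrite mulrC.
  lra.
- exists (fun t => A n (circle_pt t)); last first.
    by under eq_ri do rewrite A2; apply: gM; exact: dil_itv.
  split; first exact: circle_cont_bm.
  move=> z c z1 Hc; apply: (le_trans (Hc n (leqnn n))).
  case: (Ad n) => r1 rd; exact: (norm_powR_poisson r1 q0 rd z1).
have bw n : bm (w n) by case: (Cw n).
have [|U [Ud HU]] := @herglotz_limit w bw.
  move=> e e0; have e2 : 0 < e ^+ 2 / (2 * pi) by rewrite divr_gt0 ?exprn_gt0 ?pi2_gt0.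
  have [N HN] := wC _ e2; exists N => n m nN mN; have := HN n m nN mN.
  rewrite ltr_pdivlMr ?pi2_gt0// => h.
  have h2 := l1_l2 (bmfB (bw n) (bw m)).
  have := le_trans h2 (ltW h); rewrite ler_pXn2r ?nnegrE ?(ltW e0)//.
  exact: ri_ge0.
have [N0 HN0] := wC 1 ltr01.
set B := 2 * I (fun t => w N0 t ^+ 2) + 2.
have wB n : (N0 <= n)%N -> I (fun t => w n t ^+ 2) <= B.
  move=> nN; have b1 := bmfX 2 (bw N0); have b2 := bmfX 2 (bmfB (bw n) (bw N0)).
  apply: (@le_trans _ _ (I (fun t => 2 * w N0 t ^+ 2 + 2 * (w n t - w N0 t) ^+ 2))).
    apply: ri_le; [exact: bmfX|by apply: bmfD; exact: bmfZ|].
    by move=> t _; have := sq_add (w N0 t) (w n t - w N0 t); rewrite addrC subrK addrC.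
  rewrite riD; [|exact: bmfZ..]; rewrite !riZ// /B lerD2l.
  by have := HN0 n N0 nN (leqnn _); lra.
exists U, (2 * B + 2 * (2 * pi)); split => //.
- move=> z z1; apply/ler_addgt0Pr => e e0.
  have e20 : 0 < e / 2 by rewrite divr_gt0.
  have [d /cderiv_ccont gc] := gd z z1.
  have [eta eta0 Heta] := powR_cont q0 (cmod_ge0 (g z)) e20.
  have [|N1 H1] := @dilate_cvg R (fun z => cmod (g z) `^ q) z (e / 2) _ z1 e20.
    move=> dl dl0; have [eta1 eta10 K1] := powR_cont q0 (cmod_ge0 (g z)) dl0.
    have [eta2 eta20 K2] := gc _ eta10; exists eta2 => // x xz.
    by apply: K1; rewrite ?cmod_ge0//; apply: le_lt_trans (K2 x xz); exact: cmod_dist.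
  have [N2 H2] := HU _ _ z1 e20.
  set n := maxn N1 N2; have := H2 n (leq_maxr _ _) z (lexx _) => h2.
  have h1 : cmod (g z) `^ q - e / 2 <= poisson (w n) z.
    case: (Cw n) => _; apply => // k nk; have := H1 k (leq_trans (leq_maxl _ _) nk).
    by rewrite /A ler_norml; lra.
  have := le_trans (Re_cmod _) h2; rewrite cReB Re_herglotz// ler_norml; lra.
- move=> r r01; have /andP[r0 r1] := r01; have [N HN] := HU r 1 r1 ltr01.
  set n := maxn N0 N; have := HN n (leq_maxr _ _) => h.
  have sub f : (forall z, cmod z < 1 -> exists d, cderiv f z d) -> bm (fun t => Re (f (r%:C * circle_pt t))).
    by move=> fd; apply: bm_disk_sub (ltW r0) _ => z zr; apply: fd; exact: le_lt_trans zr r1.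
  have b1 : bm (fun t => Re (herglotz (w n) (r%:C * circle_pt t)) ^+ 2).
    by apply: bmfX; apply: sub => z z1; exists (herglotz' (w n) z); exact: cderiv_herglotz.
  apply: (@le_trans _ _ (I (fun t => 2 * Re (herglotz (w n) (r%:C * circle_pt t)) ^+ 2 + 2 * 1))).
    apply: ri_le; [by apply: bmfX; exact: sub|by apply: bmfD; [exact: bmfZ|exact: bmf_cst]|].
    move=> t _; set x := r%:C * circle_pt t.
    have := h x; rewrite cmod_polar ?(ltW r0)// => /(_ (lexx _)) /(le_trans (Re_cmod _)).
    rewrite cReB ler_norml; set a := Re _; set b := Re _ => k.
    have := sq_add a (b - a); rewrite addrC subrK => k2.
    have : (b - a) ^+ 2 <= 1 by nra.
    lra.
  rewrite riD; [|exact: bmfZ|exact: bmf_cst]; rewrite riZ//.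
  rewrite ri_cst ?pi2_ge0// subr0 mulr1; apply: lerD => //.
  rewrite ler_wpM2l//; apply: le_trans (wB n (leq_maxl _ _)).
  exact: herglotz_circle_L2.
Qed.

(** Dividing g by a power of 1 + U, with U as in [hardy_majorant], gives a
    bounded function, so the quadratic theory applies to the quotient and to 1
    + U. *)
Theorem cntlim_hardy g (p be M : R) : 0 < p -> 1 < be -> (forall z, cmod z < 1 -> exists d, cderiv g z d) ->
  (forall r, 0 < r < 1 -> I (fun t => cmod (g (r%:C * circle_pt t)) `^ p) <= M) ->
  aec (fun t => exists l, cntlim be g t l).
Proof.
move=> p0 be1 gd gM; have [U [M' [Ud gU UM]]] := hardy_majorant p0 gd gM.
have [m Hm] : exists m : nat, 2 / p <= m%:R.
  by exists (Num.bound (2 / p)); rewrite ltW// archi_boundP// divr_ge0// ltW.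
pose W (z : R[i]) : R[i] := 1 + U z.
have ReU0 z : cmod z < 1 -> 0 <= Re (U z) by move=> /gU; apply: le_trans; exact: powR_ge0.
have W1 z : cmod z < 1 -> 1 + Re (U z) <= cmod (W z).
  by move=> z1; apply: le_trans (Re_cmod _); rewrite /W cReD ger0_norm//= addr_ge0 ?ReU0.
have Wn0 z : cmod z < 1 -> W z != 0.
  by move=> z1; rewrite -cmod_gt0; apply: lt_le_trans (W1 z z1); have := ReU0 z z1; lra.
have Wm0 z : cmod z < 1 -> W z ^+ m != 0 by move=> z1; rewrite expf_neq0// Wn0.
pose B (z : R[i]) : R[i] := g z * (W z ^+ m)^-1.
have Wd z : cmod z < 1 -> exists d, cderiv W z d.
  by move=> /Ud[d Hd]; eexists; exact: (cderivD (cderiv_cst 1 _) Hd).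
have Bd z : cmod z < 1 -> exists d, cderiv B z d.
  move=> z1; have [d1 H1] := gd z z1; have [d2 H2] := Wd z z1; have [d3 H3] := cderivX m H2.
  have H4 := @cderivV R (fun w => W w ^+ m) z d3 (Wm0 z z1) H3.
  by eexists; apply: (cderivM H1 H4).
have B1 z : cmod z < 1 -> cmod (B z) <= 1.
  move=> z1; rewrite /B cmodM cmodV ler_pdivrMr ?mul1r ?cmod_gt0 ?Wm0// cmodX.
  have w1 : 1 <= cmod (W z) by apply: le_trans (W1 z z1); have := ReU0 z z1; lra.
  have gW : cmod (g z) `^ (p / 2) <= cmod (W z) by apply: (le_trans (gU z z1)); apply: le_trans (W1 z z1); lra.
  have -> : cmod (g z) = (cmod (g z) `^ (p / 2)) `^ (2 / p).
    rewrite -powRrM (_ : p / 2 * (2 / p) = 1) ?powRr1 ?cmod_ge0//.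
    by field; exact: lt0r_neq0.
  apply: (@le_trans _ _ (cmod (W z) `^ (2 / p))).
    by apply: ge0_ler_powR; rewrite ?nnegrE ?powR_ge0 ?cmod_ge0 ?divr_ge0// ltW.
  by rewrite -powR_mulrn ?cmod_ge0//; exact: ler_powR.
have h1 := cntlim_H2 be1 Ud UM.
have h2 : aec (fun t => exists l, cntlim be B t l).
  apply: (cntlim_H2 (M := 2 * pi)) => // r /andP[r0 r1].
  apply: (@le_trans _ _ (I (fun=> 1))); last by rewrite ri_cst ?pi2_ge0// mul1r subr0.
  apply: ri_le; [|exact: bmf_cst|].
    by apply: bmfX; apply: bm_disk_sub (ltW r0) _ => z zr; apply: Bd; exact: le_lt_trans zr r1.
  move=> t _; rewrite -[leLHS]real_normK ?num_real// expr_le1//.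
  apply: le_trans (Re_cmod _) _; apply: B1; by rewrite cmod_polar ?(ltW r0).
apply: aec_imp (aec_and h1 h2) => t _ [[u Hu] [b Hb]].
exists (b * (1 + u) ^+ m).
apply: (@eq_cntlim be (fun z => B z * W z ^+ m)).
  by move=> z z1; rewrite /B mulfVK// Wm0.
by apply: cntlimM => //; apply: cntlimX; apply: cntlimD => //; exact: cntlim_cst.
Qed.

End HardyLimits.

(** * The non-tangential maximal inequality in the Hardy class *)

Section HardyMaximal.
Context {R : realType}.
Implicit Types (z w xi : R[i]) (t e r be : R) (V W : R -> R) (g : R[i] -> R[i]).
Local Notation pi := (@pi R).
Local Notation bm := (bmf 0 (2 * pi)).
Local Notation I := (ri 0 (2 * pi)).
Local Notation mu := (@lebesgue_measure R).

Lemma ri_EFin V : bm V -> (\int[mu]_(t in `[0%R, (2 * pi)%R]) (V t)%:E = (I V)%:E)%E.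
Proof.
move=> bV; rewrite /ri /Rintegral fineK//.
by apply: integrable_fin_num => //; exact: bmf_integrable.
Qed.

Lemma ntmax_perturb be (zs : nat -> R[i]) (F G : nat -> R) (eta : R) n t : 0 <= eta ->
  (forall k, (k < n)%N -> F k <= G k + eta) -> ntmax be zs F n t <= ntmax be zs G n t + eta.
Proof.
move=> e0; elim: n => [|n IH] FG; first by rewrite /= add0r.
have IH' := IH (fun k kn => FG k (leqW kn)).
rewrite !ntmaxS ge_max; apply/andP; split.
  by apply: (le_trans IH'); rewrite lerD2r le_max lexx.
rewrite indicE; case: (_ \in _); rewrite ?mulr1 ?mulr0.
  by apply: (le_trans (FG n (ltnSn n))); rewrite lerD2r le_max lexx orbT.
by rewrite addr_ge0// le_max ntmax_ge0.
Qed.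

Lemma bm_disk_powR g r q : 0 < q -> 0 < r < 1 -> (forall z, cmod z < 1 -> exists d, cderiv g z d) ->
  bm (fun t => cmod (g (r%:C * circle_pt t)) `^ q).
Proof.
move=> q0 r01 gd; have [r1 rd] := holo_dilate r01 gd.
have := @bm_disk_circle R _ 0 1 (ccont_disk_norm_powR r1 q0 rd) ltr01; rewrite cmod0 add0r => /(_ (lexx _)).
by congr bm; apply/funext => t; rewrite add0r mul1r.
Qed.

(** The L2 inequality for Poisson integrals, applied to the dilates of
    |g|^(p/2), bounds the integral of N. Being integrable, N allows dominated
    convergence for the dilates of |g|^p, which replaces their means by the
    integral of G. *)
Theorem hardy_ntmax g (p be M : R) : 0 < p -> 1 < be ->
  (forall z, cmod z < 1 -> exists d, cderiv g z d) ->
  (forall r, 0 < r < 1 -> I (fun t => cmod (g (r%:C * circle_pt t)) `^ p) <= M) ->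
  exists N G : R -> \bar R, [/\ measurable_fun `[0, 2 * pi] N /\ measurable_fun `[0, 2 * pi] G,
    forall t, (0 <= N t)%E,
    forall t z, cone be z t -> ((cmod (g z) `^ p)%:E <= N t)%E,
    (\int[mu]_(t in `[0%R, (2 * pi)%R]) N t <=
      ((8 * (1 + be) ^+ 2) ^+ 2)%:E * \int[mu]_(t in `[0%R, (2 * pi)%R]) G t)%E &
    aec (fun t => exists2 l : R[i], cntlim be g t l & G t = (cmod l `^ p)%:E)].
Proof.
move=> p0 be1 gd gM; set q := p / 2; have q0 : 0 < q by rewrite divr_gt0.
set K := (8 * (1 + be) ^+ 2) ^+ 2; have K0 : 0 <= K by exact: sqr_ge0.
have be0 : 0 <= be by lra.
have sq (x : R) : 0 <= x -> (x `^ q) ^+ 2 = x `^ p.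
  by move=> x0; rewrite -powR_mulrn ?powR_ge0// -powRrM /q mulfVK.
have [zs [zs1 zsd]] := dense_sequence (R := R).
pose h (j : nat) (t : R) : R := cmod (g ((dil j)%:C * circle_pt t)) `^ p.
have bh j : bm (h j) by apply: bm_disk_powR => //; exact: dil_itv.
pose F (k : nat) : R := cmod (g (zs k)) `^ q.
have F0 k : 0 <= F k by exact: powR_ge0.
pose f n t := ntmax be zs F n t ^+ 2.
have bf n : bm (f n) by apply: bmfX; exact: bm_ntmax.
have f0 n t : 0 <= f n t by exact: sqr_ge0.
have fnd n m t : (n <= m)%N -> f n t <= f m t.
  by move=> nm; rewrite /f lerXn2r ?nnegrE ?ntmax_ge0//; exact: ntmax_nd.
(* For fixed n, finitely many values of g are approximated by those of a dilate. *)
have bnd n e : 0 < e -> exists J, forall j, (J <= j)%N -> forall c, I (h j) <= c -> 0 <= c ->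
    I (f n) <= (1 + e) * (K * c) + 2 * pi * (e + e ^+ 2).
  move=> e0.
  have ex k : exists J, forall j, (J <= j)%N -> `|cmod (g ((dil j)%:C * zs k)) `^ q - F k| <= e.
    apply: (@dilate_cvg R (fun z => cmod (g z) `^ q)) => //.
    move=> dl dl0; have [eta1 eta10 K1] := powR_cont q0 (cmod_ge0 (g (zs k))) dl0.
    have [d /cderiv_ccont gc] := gd (zs k) (zs1 k).
    have [eta2 eta20 K2] := gc _ eta10; exists eta2 => // x xz.
    by apply: K1; rewrite ?cmod_ge0//; apply: le_lt_trans (K2 x xz); exact: cmod_dist.
  have [J HJ] := choice ex.
  exists (\max_(k < n) J k) => j jJ c hc c0.
  pose Fj (k : nat) : R := cmod (g ((dil j)%:C * zs k)) `^ q.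
  have Fj0 k : 0 <= Fj k by exact: powR_ge0.
  have [r1 rd] := holo_dilate (dil_itv j) gd.
  have bV : bm (fun t => cmod (g ((dil j)%:C * circle_pt t)) `^ q) by apply: bm_disk_powR => //; exact: dil_itv.
  have := ntmax_bound be0 zs1 Fj0 bV (fun t _ => powR_ge0 _ _)
    (fun k (_ : (k < n)%N) => norm_powR_poisson r1 q0 rd (zs1 k)).
  have -> : I (fun t => (cmod (g ((dil j)%:C * circle_pt t)) `^ q) ^+ 2) = I (h j).
    by apply: eq_ri => t _; rewrite sq ?cmod_ge0.
  rewrite -/K => Hj.
  have bj := bmfX 2 (bm_ntmax be zs Fj n).
  apply: (@le_trans _ _ (I (fun t => (1 + e) * ntmax be zs Fj n t ^+ 2 + (e + e ^+ 2)))).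
    apply: ri_le => //; first by apply: bmfD; [exact: bmfZ|exact: bmf_cst].
    move=> t _; have le1 : ntmax be zs F n t <= ntmax be zs Fj n t + e.
      apply: ntmax_perturb => [|k kn]; first exact: ltW.
      have := HJ k j (leq_trans (@leq_bigmax _ (fun k : 'I_n => J k) (Ordinal kn)) jJ).
      by rewrite ler_norml /Fj; lra.
    have a0 := ntmax_ge0 be zs F n t; have b0 := ntmax_ge0 be zs Fj n t.
    rewrite /f; move: le1 a0 b0; set a := ntmax _ _ F _ _; set b := ntmax _ _ Fj _ _ => le1 a0 b0.
    have : a ^+ 2 <= (b + e) ^+ 2 by rewrite lerXn2r ?nnegrE// addr_ge0// ltW.
    have : e * (2 * b) <= e * (b ^+ 2 + 1) by rewrite ler_wpM2l ?(ltW e0)//; have := sqr_ge0 (b - 1); nra.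
    nra.
  rewrite riD; [|exact: bmfZ|exact: bmf_cst]; rewrite riZ// ri_cst ?pi2_ge0// subr0 (mulrC (e + _)) lerD2r.
  rewrite ler_wpM2l//; first lra.
  by apply: (le_trans Hj); rewrite ler_wpM2l.
have conv n c : 0 <= c -> (forall J, exists2 j, (J <= j)%N & I (h j) <= c) -> I (f n) <= K * c.
  move=> c0 Hc; apply/ler_addgt0Pr => e e0; have pp := @pi2_gt0 R.
  have Kc : 0 <= K * c by exact: mulr_ge0.
  set e1 := Num.min 1 (e / (K * c + 4 * pi + 1)).
  have d0 : 0 < K * c + 4 * pi + 1 by lra.
  have e10 : 0 < e1 by rewrite lt_min ltr01 divr_gt0.
  have e11 : e1 <= 1 by rewrite ge_min lexx.
  have e12 : e1 * (K * c + 4 * pi + 1) <= e by rewrite -ler_pdivlMr// ge_min lexx orbT.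
  have [J HJ] := bnd n e1 e10; have [j jJ hj] := Hc J.
  apply: (le_trans (HJ j jJ c hj c0)).
  have : 2 * pi * e1 ^+ 2 <= 2 * pi * e1 by rewrite ler_wpM2l ?(ltW pp)// expr2 ler_piMr// ltW.
  by move: e12 e10; clear; nra.
have M0 : 0 <= M by apply: le_trans (gM (1 / 2) ltac:(lra)); apply: ri_ge0 => t _; exact: powR_ge0.
have [|N1 [mN1 N10 fN1 IN1 _]] := monotone_majorant bf f0 fnd (C := K * M).
  by move=> n; apply: conv => // J; exists J => //; apply: gM; exact: dil_itv.
have cone_le (N : R -> \bar R) : (forall n t, ((f n t)%:E <= N t)%E) ->
    forall t z, cone be z t -> ((cmod (g z) `^ p)%:E <= N t)%E.
  move=> fN t z cz; case E : (N t) => [c| |]; rewrite ?leey//; last first.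
    by have := fN 0%N t; rewrite E leeNy_eq.
  rewrite lee_fin; apply: (@cont_cone_sup R be (fun z => cmod (g z) `^ p) zs t c zsd _ _ _ z cz).
  - move=> x x1 dl dl0; have [eta1 eta10 K1] := powR_cont p0 (cmod_ge0 (g x)) dl0.
    have [d /cderiv_ccont gc] := gd x x1; have [eta2 eta20 K2] := gc _ eta10; exists eta2 => // y yx.
    by apply: K1; rewrite ?cmod_ge0//; apply: le_lt_trans (K2 y yx); exact: cmod_dist.
  - lra.
  - move=> k ck; have := fN k.+1 t; rewrite E lee_fin; apply: le_trans.
    rewrite -sq ?cmod_ge0// /f lerXn2r ?nnegrE ?powR_ge0 ?ntmax_ge0//.
    by apply: (@ntmax_ge _ be zs F) => //; case: ck.
pose G t := limn_esup (fun j => (h j t)%:E).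
have mG : measurable_fun `[0, 2 * pi] G.
  by apply: measurable_fun_limn_esup => j; apply/measurable_EFinP; case: (bh j).
have aeG : aec (fun t => (fun j => (h j t)%:E) @ \oo --> G t /\
    exists2 l : R[i], cntlim be g t l & G t = (cmod l `^ p)%:E).
  apply: aec_imp (cntlim_hardy p0 be1 gd gM) => t _ [l Hl].
  have hc : (fun j => (h j t)%:E) @ \oo --> (cmod l `^ p)%:E.
    apply: cvg_EFin; first exact: nearW.
    apply/cvgrPdist_lt => e e0.
    have [eta eta0 He] := powR_cont p0 (cmod_ge0 l) e0.
    have [dl dl0 Hd] := Hl _ eta0; have [J HJ] := dil_lim dl0.
    exists J => //= j Jj; rewrite distrC; apply: He; rewrite ?cmod_ge0//.
    apply: le_lt_trans (cmod_dist _ _) _; have /andP[r0 r1] := @dil_itv R j.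
    apply: Hd; first by apply: radial_cone => //; rewrite (ltW r0).
    by rewrite radial_dist ?(ltW r0) ?(ltW r1)//; exact: HJ.
  have GE : G t = (cmod l `^ p)%:E by have [_] := cvg_limn_einf_sup hc.
  by rewrite GE; split => //; exists l.
have iN1 : mu.-integrable `[0, 2 * pi] N1.
  apply/integrableP; split => //.
  under eq_integral do rewrite gee0_abs//.
  by apply: le_lt_trans IN1 _; exact: ltry.
have toae (P : R -> Prop) : aec P -> {ae mu, forall t, `[0, 2 * pi]%classic t -> P t}.
  move=> [A [mA A0 HA]]; exists A; split => // t /= /not_implyP [tt nP].
  by apply: contrapT => nA; apply: nP; apply: HA => //; move: tt; rewrite in_itv.
have mh j : measurable_fun `[0, 2 * pi] (fun t => (h j t)%:E) by apply/measurable_EFinP; case: (bh j).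
have hN1 j t : (`|(h j t)%:E| <= N1 t)%E.
  rewrite gee0_abs ?lee_fin ?powR_ge0//; apply: cone_le => //.
  by apply: radial_cone => //; have /andP[r0 ->] := @dil_itv R j; rewrite ltW.
have [iG _ Ic] := @dominated_convergence _ _ R mu `[0, 2 * pi]%classic ltac:(by []) (fun j t => (h j t)%:E) G N1 mh mG
  ltac:(by apply: toae; apply: aec_imp aeG => t _ []) iN1 ltac:(by apply: nearW => t j _; exact: hN1).
set c := fine (\int[mu]_(t in `[0%R, (2 * pi)%R]) G t)%E.
have cE : (\int[mu]_(t in `[0%R, (2 * pi)%R]) G t)%E = c%:E.
  by rewrite /c fineK//; apply: integrable_fin_num.
have Ihc : (fun j => I (h j)) @ \oo --> c.
  rewrite cE in Ic; apply: cvg_trans (fine_cvg Ic); apply: near_eq_cvg.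
  by apply: nearW => j /=; rewrite ri_EFin.
have c0 : 0 <= c.
  rewrite -(cvg_lim (@Rhausdorff R) Ihc); apply: limr_ge; first by apply/cvg_ex; exists c.
  by apply: nearW => j; apply: ri_ge0 => t _; exact: powR_ge0.
have Kc n : I (f n) <= K * c.
  apply/ler_addgt0Pr => e e0; have K1 : 0 < K + 1 by lra.
  have e1 : 0 < e / (K + 1) by rewrite divr_gt0.
  apply: (@le_trans _ _ (K * (c + e / (K + 1)))).
    apply: conv; first by rewrite addr_ge0// ltW.
    move=> J; have /cvgrPdist_lt /(_ _ e1) [J2 _ HJ] := Ihc.
    exists (maxn J J2); first exact: leq_maxl.
    by have := HJ (maxn J J2) (leq_maxr _ _); rewrite /= ltr_norml; lra.
  rewrite mulrDr lerD2l mulrCA ler_piMr ?(ltW e0)// ler_pdivrMr// mul1r; lra.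
have [N [mN N0 fN IN _]] := monotone_majorant bf f0 fnd Kc.
exists N, G; split => //; first exact: cone_le.
  by rewrite cE -EFinM.
by apply: aec_imp aeG => t _ [].
Qed.

End HardyMaximal.

(** * Expanding maps and the angle of a unimodular number *)

Section ExpandingMaps.
Context {R : realType}.
Implicit Types (z w xi : R[i]) (t e r be : R).
Local Notation Re := (@complex.Re R).
Local Notation Im := (@complex.Im R).
Local Notation pi := (@pi R).
Local Notation mu := (@lebesgue_measure R).

(** The integral of a nonnegative function is monotone without any
    measurability, being a supremum over simple minorants. This matters
    because the boundary function and the integrand along the curve are not
    known to be measurable. *)
Lemma le_integral_ge0 (D : set R) (f g : R -> \bar R) :
  (forall x, D x -> (0 <= f x)%E) -> (forall x, D x -> (f x <= g x)%E) ->
  (\int[mu]_(x in D) f x <= \int[mu]_(x in D) g x)%E.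
Proof.
move=> f0 fg; rewrite !ge0_integralE//; last by move=> x Dx; apply: le_trans (fg x Dx); exact: f0.
apply: le_ereal_sup => _ [h hf <-]; exists h => // x; apply: (le_trans (hf x)).
by rewrite /patch; case: ifPn => // /set_mem; exact: fg.
Qed.

(** An expanding map cannot compress measure: the preimage of an interval has
    diameter at most L times its length, and intervals suffice by coverings. *)
Lemma expanding_measure (h : R -> R) (L : R) : 0 < L -> measurable_fun setT h ->
  (forall s s', `|s - s'| <= L * `|h s - h s'|) ->
  forall A, measurable A -> (mu (h @^-1` A) <= (2 * L)%:E * mu A)%E.
Proof.
move=> Lp mh hL A mA; have L0 := ltW Lp.
have mp B : measurable B -> measurable (h @^-1` B) by move=> mB; rewrite -[_ @^-1` _]setTI; exact: mh.
have itv c d : c <= d -> (mu (h @^-1` `]c, d[%classic) <= (2 * L * (d - c))%:E)%E.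
  move=> cd; have [->|/set0P [s0]] := eqVneq (h @^-1` `]c, d[%classic) set0.
    by rewrite measure0 lee_fin !mulr_ge0// subr_ge0.
  rewrite /= in_itv /= => /andP[s1 s2].
  apply: (@le_trans _ _ (mu `[s0 - L * (d - c), s0 + L * (d - c)]%classic)).
    apply: le_measure; rewrite ?inE; [by apply: mp| by []|].
    move=> s /=; rewrite !in_itv /= => /andP[t1 t2].
    have := hL s s0; have : L * `|h s - h s0| <= L * (d - c).
      by rewrite ler_wpM2l// ler_norml; apply/andP; split; lra.
    by move=> q1 q2; rewrite -ler_distlC distrC; exact: le_trans q2 q1.
  rewrite lebesgue_measure_itv /=; case: ifP => _; rewrite lee_fin; last by rewrite !mulr_ge0// subr_ge0.
  lra.
have [->|Afin] := eqVneq (mu A) +oo%E.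
  by rewrite gt0_muley ?lte_fin ?mulr_gt0// leey.
apply/lee_addgt0Pr => e e0.
have e1 : 0 < e / (2 * L) by rewrite divr_gt0// mulr_gt0.
have [F [Fitv AF] Fe] : exists2 F, open_itv_cover A F &
    (\sum_(0 <= k <oo) wlength idfun (F k) <= mu A + (e / (2 * L))%:E)%E.
  have fin : (wlength (@idfun R))^*%mu A \is a fin_num.
    by rewrite ge0_fin_numE ?outer_measure_ge0// ltey.
  have := fin; rewrite outer_measure_open_itv_cover => fin2.
  have [_ [F AF <-] Fe] := lb_ereal_inf_adherent e1 fin2.
  by exists F => //; apply: ltW; rewrite -outer_measure_open_itv_cover in Fe.
have oF k : open (F k) by case: (Fitv k) => ab ->; exact: interval_open.
have mF k : measurable (F k) by exact: open_measurable.
apply: (@le_trans _ _ (\sum_(0 <= k <oo) mu (h @^-1` F k))%E).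
  apply: (@le_trans _ _ (mu (\bigcup_k (h @^-1` F k)))).
    apply: le_measure; rewrite ?inE; [exact: mp|by apply: bigcupT_measurable => k; exact: mp|].
    by move=> x /AF[k _ Fk]; exists k.
  by apply: measure_sigma_subadditive => //; [move=> k; exact: mp|apply: bigcupT_measurable => k; exact: mp].
apply: (@le_trans _ _ (\sum_(0 <= k <oo) ((2 * L)%:E * wlength idfun (F k)))%E).
  apply: lee_nneseries => // k _.
  case: (Fitv k) => -[c d] ->; have [cd|cd] := leP c d.
    apply: (le_trans (itv c d cd)); rewrite wlength_itv /= lte_fin.
    case: ltP => [_|dc]; first by rewrite -EFinM.
    by rewrite mule0 lee_fin (_ : d - c = 0) ?mulr0//; lra.
  by rewrite set_itv_ge ?preimage_set0 ?measure0 ?wlength0 ?mule0// bnd_simp -leNgt ltW.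
rewrite nneseriesZl//.
have -> : ((2 * L)%:E * mu A + e%:E = (2 * L)%:E * (mu A + (e / (2 * L))%:E))%E.
  rewrite ge0_muleDr ?lee_fin ?measure_ge0 ?(ltW e1)// -EFinM.
  by congr (_ + _%:E)%E; field; exact: lt0r_neq0.
by rewrite lee_pmul2l// lte_fin mulr_gt0.
Qed.

Lemma expanding_integral (h : R -> R) (L : R) (B : set R) (G : R -> \bar R) :
  0 < L -> measurable_fun setT h -> (forall s s', `|s - s'| <= L * `|h s - h s'|) ->
  measurable B -> measurable_fun B G -> (forall t, (0 <= G t)%E) ->
  (\int[mu]_(s in h @^-1` B) G (h s) <= (2 * L)%:E * \int[mu]_(t in B) G t)%E.
Proof.
move=> L0 mh hL mB mG G0.
pose h' : measurableTypeR R -> measurableTypeR R := h.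
have mh' : measurable_fun setT h' by exact: mh.
rewrite -(@ge0_integral_pushforward _ _ _ _ R h' mh' mu B G mB mG) => [|t _]; last exact: G0.
pose k : {nonneg R} := NngNum (ltW (mulr_gt0 (@ltr0n R 2) L0)).
have -> : ((2 * L)%:E * \int[mu]_(t in B) G t = \int[mscale k mu]_(t in B) G t)%E.
  by rewrite ge0_integral_mscale.
rewrite integral_mkcond [leRHS]integral_mkcond.
apply: ge0_le_measure_integral => //.
- by move=> A mA; rewrite /mscale /=; exact: expanding_measure.
- by move=> x; rewrite /patch; case: ifP.
- exact: (iffLR (measurable_restrictT G mB) mG).
Qed.

(** The map of an interval is extended outside with slope one, leaving a gap
    of one on each side, so that it stays expanding and the extension avoids
    the target. *)
Lemma expanding_integral_on (a b : R) (h : R -> R) (L c d : R) (G : R -> \bar R) : 1 <= L -> b - a <= L ->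
  measurable_fun `[a, b] h -> (forall s, a <= s <= b -> c <= h s <= d) ->
  (forall s s', a <= s <= b -> a <= s' <= b -> `|s - s'| <= L * `|h s - h s'|) ->
  measurable_fun `[c, d] G -> (forall t, (0 <= G t)%E) ->
  (\int[mu]_(s in `[a, b]) G (h s) <= (2 * L)%:E * \int[mu]_(t in `[c, d]) G t)%E.
Proof.
move=> L1 Lba mh hcd hL mG G0; have L0 : 0 < L by lra.
have [ba|ab] := ltP b a.
  rewrite [X in (X <= _)%E](_ : _ = 0%E); last by rewrite set_itv_ge ?integral_set0// bnd_simp -ltNge.
  by rewrite mule_ge0 ?lee_fin ?mulr_ge0 ?(ltW L0)//; apply: integral_ge0.
have cd : c <= d by have := hcd a; rewrite lexx ab => /(_ isT) /andP[]; exact: le_trans.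
pose h1 (s : R) := if s < a then c - 1 + (s - a) else if s <= b then h s else d + 1 + (s - b).
have mh1 : measurable_fun setT h1.
  apply: measurable_fun_if => //; first exact: measurable_fun_ltr.
    by apply: measurable_funD => //; exact: measurable_funB.
  apply: measurable_fun_if => //.
  - by rewrite setTI; rewrite (_ : _ @^-1` _ = `[a, +oo[%classic)//; apply/seteqP; split => s /=; rewrite in_itv /= andbT leNgt; case: (s < a).
  - by apply: measurable_fun_ler => //; exact: measurable_funTS.
  - apply: measurable_funS mh => // s /= [[_ sa] sb]; by rewrite in_itv /= leNgt sa sb.
  - by apply: measurable_funTS; apply: measurable_funD => //; exact: measurable_funB.
have h1in s : a <= s <= b -> h1 s = h s by move=> /andP[s1 s2]; rewrite /h1 ltNge s1 s2.
have E : h1 @^-1` `[c, d]%classic = `[a, b]%classic.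
  apply/seteqP; split => s /=; rewrite !in_itv /=; last by move=> sab; rewrite h1in ?hcd.
  rewrite /h1; case: ltP => sa; first by lra.
  by case: (leP s b) => sb //= /andP[]; lra.
rewrite [leLHS](_ : _ = \int[mu]_(s in h1 @^-1` `[c, d]) G (h1 s))%E; last first.
  by rewrite E; apply: eq_integral => s; rewrite inE /= in_itv /= => sab; rewrite h1in.
apply: expanding_integral => // s s'.
wlog ss : s s' / s <= s'.
  by move=> H; have [/H//|/ltW/H] := leP s s'; rewrite distrC (distrC (h1 _)).
have lin x : 0 <= x -> x <= L * x by move=> x0; rewrite ler_peMl.
rewrite distrC (distrC (h1 _)) (ger0_norm (_ : 0 <= s' - s)) ?subr_ge0//.
suff : s' - s <= L * (h1 s' - h1 s) \/ `|s' - s| <= L * `|h1 s' - h1 s|.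
  case=> [H|]; last by rewrite ger0_norm ?subr_ge0.
  by apply: (le_trans H); rewrite ler_wpM2l ?(ltW L0)// ler_norm.
have [sa|sa] := ltP s a.
  left; rewrite {2}/h1 sa /h1; case: ltP => sa'.
    by have := lin (s' - s); rewrite subr_ge0 => /(_ ss); lra.
  case: (leP s' b) => sb.
    have := hcd s'; rewrite sa' sb => /(_ isT) /andP[q1 q2].
    have := lin (a - s); rewrite subr_ge0 => /(_ (ltW sa)).
    have : L * (a - s + 1) <= L * (h s' - (c - 1 + (s - a))) by rewrite ler_wpM2l ?(ltW L0)//; lra.
  lra.
  have := lin (a - s + (s' - b)); have : 0 <= a - s + (s' - b) by lra.
  move=> q /(_ q).
  have : L * (a - s + (s' - b) + 1) <= L * (d + 1 + (s' - b) - (c - 1 + (s - a))) by rewrite ler_wpM2l ?(ltW L0)//; lra.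
  lra.
have sa' := le_trans sa ss.
have [sb|sb] := leP s b.
  have [sb'|sb'] := leP s' b; first by right; rewrite !h1in ?sa ?sa'//; apply: hL; apply/andP.
  left; rewrite (h1in s) ?sa ?sb// /h1 (ltNge s' a) sa' (leNgt s' b) sb' /=.
  have := hcd s; rewrite sa sb => /(_ isT) /andP[q1 q2].
  have := lin (s' - b); rewrite subr_ge0 => /(_ (ltW sb')).
  have : L * (s' - b + 1) <= L * (d + 1 + (s' - b) - h s) by rewrite ler_wpM2l ?(ltW L0)//; lra.
  lra.
left; rewrite /h1 (ltNge s a) (ltNge s' a) sa sa' (leNgt s b) (leNgt s' b) sb (lt_le_trans sb ss) /=.
by have := lin (s' - s); rewrite subr_ge0 => /(_ ss); lra.
Qed.

(** The clamping makes this a monotone function on the whole line, equal to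
    acos on [-1, 1]. *)
Definition clamp_acos (x : R) : R := acos (Num.max (-1) (Num.min 1 x)).
(** The angle of a unimodular number in [0, 2 pi], assembled from monotone
    functions of its coordinates so that measurability is immediate. *)
Definition carg z : R := (0 <= Im z)%R%:R * clamp_acos (Re z) + (1 - (0 <= Im z)%R%:R) * (2 * pi - clamp_acos (Re z)).

Lemma circle_pt_carg z : cmod z = 1 -> circle_pt (carg z) = z /\ 0 <= carg z <= 2 * pi.
Proof.
move=> z1; have := cmod_sqr z; rewrite z1 expr1n => E.
have x1 : -1 <= Re z <= 1 by have := Re_cmod z; rewrite z1 ler_norml.
have cE : clamp_acos (Re z) = acos (Re z).
  by have /andP[q1 q2] := x1; rewrite /clamp_acos (min_idPr q2) (max_idPr q1).
have a0 := acos_ge0 x1; have ap := acos_lepi x1; have pp := @pi_ge0 R.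
have sE : sin (acos (Re z)) = `|Im z|.
  by rewrite sin_acos// E addrAC subrr add0r sqrtr_sqr.
have co : cos (acos (Re z)) = Re z by rewrite acosK// in_itv.
rewrite /carg cE; have [y0|y0] := leP 0 (Im z).
  rewrite mul1r subrr mul0r addr0 a0 /=; split; last lra.
  by rewrite /circle_pt co sE ger0_norm//; case: (z).
rewrite mul0r add0r subr0 mul1r; split; last lra.
rewrite addrC circle_pt_periodic /circle_pt cosN sinN co sE ltr0_norm// opprK.
by case: (z).
Qed.

Lemma measurable_carg (D : set R) (F : R -> R[i]) : measurable D ->
  measurable_fun D (fun t => Re (F t)) -> measurable_fun D (fun t => Im (F t)) ->
  measurable_fun D (fun t => carg (F t)).
Proof.
move=> mD m1 m2.
have mA : measurable_fun setT clamp_acos.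
  apply: nonincreasing_measurable => // x y xy; rewrite /clamp_acos.
  have cl (u : R) : -1 <= Num.max (-1) (Num.min 1 u) <= 1.
    by rewrite le_max lexx /= ge_max ge_min lexx /= andbT; lra.
  rewrite leNgt; apply/negP => lt1.
  have := @ltr_cos R (acos (Num.max (-1) (Num.min 1 x))) (acos (Num.max (-1) (Num.min 1 y))).
  rewrite !in_itv /= !acos_ge0 ?cl// !acos_lepi ?cl// => /(_ isT isT); rewrite lt1.
  rewrite !acosK ?in_itv ?cl//= => /idP; rewrite ltNge => /negP; apply.
  rewrite ge_max !le_max lexx /=; apply/orP; right.
  by rewrite le_min !ge_min lexx xy orbT.
have mH : measurable_fun setT (fun y : R => (0 <= y)%R%:R : R).
  apply: nondecreasing_measurable => // x y xy.
  by have [x0|x0] := leP 0 x; [rewrite (le_trans x0 xy)|case: (0 <= y)].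
have mA' : measurable_fun D (fun t => clamp_acos (Re (F t))) by exact: measurableT_comp.
have mH' : measurable_fun D (fun t => (0 <= Im (F t))%R%:R : R) by exact: (measurableT_comp mH m2).
apply: measurable_funD; apply: measurable_funM => //; exact: measurable_funB.
Qed.

Lemma chord_ge (s t : R) : `|s - t| <= pi -> `|s - t| <= 4 * cmod (circle_pt s - circle_pt t : R[i]).
Proof.
move=> h; rewrite chordE; set x := (s - t) / 2.
have -> : `|s - t| = 2 * `|x| by rewrite /x normrM (@ger0_norm _ (2^-1)) ?invr_ge0//; field.
have xp : `|x| <= 2.
  have /andP[_] := @pihalf_02 R; move: h; have -> : s - t = 2 * x by rewrite /x; field.
  by rewrite normrM ger0_norm//; lra.
suff : `|x| <= 4 * `|sin x| by lra.
wlog x0 : x xp / 0 <= x => [H|].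
  have [/(H _ xp)//|x0] := leP 0 x.
  by rewrite -normrN -(normrN (sin x)) -sinN; apply: H; rewrite ?normrN// oppr_ge0 ltW.
move: xp; rewrite (ger0_norm x0) => x2.
set u := x / 2; have u0 : 0 <= u by rewrite /u; lra.
have u1 : u <= 1 by rewrite /u; lra.
have cosu c : 0 <= c <= u -> 1 / 2 <= cos c.
  move=> /andP[c0 cu]; have -> : cos c = 1 - 2 * sin (c / 2) ^+ 2.
    by rewrite {1}(_ : c = c / 2 + c / 2) ?cosD; [have := cos2Dsin2 (c / 2); rewrite !expr2; lra|field].
  have := abs_sin_le (c / 2); rewrite (@ger0_norm _ (c / 2)); last lra.
  move=> q; have : `|sin (c / 2)| ^+ 2 <= (c / 2) ^+ 2 by rewrite lerXn2r ?nnegrE//; lra.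
  rewrite real_normK ?num_real//; nra.
have [c cI] : exists2 c, c \in `[0, u] & sin u - sin 0 = cos c * (u - 0).
  by apply: MVT_segment => //; apply/continuous_subspaceT => y; exact: continuous_sin.
rewrite sin0 !subr0 => Es; move: cI; rewrite in_itv /= => cI.
have hc := cosu c cI; have hu := cosu u; rewrite u0 lexx in hu; have {}hu := hu isT.
have -> : sin x = 2 * (sin u * cos u).
  by rewrite (_ : x = u + u) ?sinD; [rewrite mulrC; ring|rewrite /u; field].
have s1 : 1 / 2 * u <= sin u by rewrite Es ler_wpM2r.
have s2 : (1 / 2 * u) * (1 / 2) <= sin u * cos u by apply: ler_pM => //; lra.
apply: le_trans (_ : 4 * (2 * (sin u * cos u)) <= _); last by rewrite ler_wpM2l// ler_norm.
by rewrite /u in s2 *; lra.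
Qed.

End ExpandingMaps.

(** * Boundary points of plane convex sets on a line *)

Section ConvexBoundary.
Context {R : realType}.
Implicit Types (z w e p q u v : R[i]) (E : set (Cplx R)).
Local Notation Re := (@complex.Re R).
Local Notation Im := (@complex.Im R).

Lemma convex_combination E x y (l : R) : convex_set E -> 0 <= l <= 1 -> E x -> E y ->
  E (l%:C * x + (1 - l)%:C * y).
Proof.
move=> cE /andP[l0 l1] Ex Ey.
have c0 : 0 <= l%:C :> R[i] by rewrite lecE /= eqxx.
have c1 : l%:C <= 1 :> R[i] by rewrite lecE /= eqxx.
have := cE x y (Itv01 c0 c1); rewrite !inE => /(_ Ex Ey).
by rewrite /conv /= rmorphB /= rmorph1.
Qed.

Definition cross u v : R := Re u * Im v - Im u * Re v.
Definition det3 p q z : R := cross (q - p) (z - p).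

Lemma cross_bound u v : `|cross u v| <= cmod u * cmod v.
Proof.
have -> : cross u v = Im (u^* * v) by rewrite cImM /cross; case: u => a b; case: v => c d /=; ring.
by apply: le_trans (Im_cmod _) _; rewrite cmodM cmod_conj.
Qed.

Lemma det3_close p q z p' q' z' (d : R) : d <= 1 -> cmod p <= 1 -> cmod q <= 1 -> cmod z <= 1 ->
  cmod (p' - p) <= d -> cmod (q' - q) <= d -> cmod (z' - z) <= d ->
  `|det3 p' q' z' - det3 p q z| <= 12 * d.
Proof.
move=> d1 p1 q1 z1 pd qd zd.
have d0 : 0 <= d by apply: le_trans pd; exact: cmod_ge0.
have -> : det3 p' q' z' - det3 p q z =
   cross ((q' - q) - (p' - p)) (z' - p') + cross (q - p) ((z' - z) - (p' - p)).
  by rewrite /det3 /cross !cReB !cImB; ring.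
have a1 : cmod ((q' - q) - (p' - p)) <= 2 * d by apply: (le_trans (cmodB _ _)); lra.
have a2 : cmod ((z' - z) - (p' - p)) <= 2 * d by apply: (le_trans (cmodB _ _)); lra.
have a3 : cmod (z' - p') <= 4.
  have -> : z' - p' = (z' - z) - (p' - p) + (z - p) by ring.
  by apply: (le_trans (cmodD _ _)); have := cmodB z p; lra.
have a4 : cmod (q - p) <= 2 by have := cmodB q p; lra.
apply: (le_trans (ler_normD _ _)).
have b1 := cross_bound ((q' - q) - (p' - p)) (z' - p').
have b2 := cross_bound (q - p) ((z' - z) - (p' - p)).
have b3 : cmod ((q' - q) - (p' - p)) * cmod (z' - p') <= 2 * d * 4 by apply: ler_pM => //; exact: cmod_ge0.
have b4 : cmod (q - p) * cmod ((z' - z) - (p' - p)) <= 2 * (2 * d) by apply: ler_pM => //; exact: cmod_ge0.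
lra.
Qed.

(** Barycentric coordinates are ratios of determinants. *)
Lemma in_triangle E p q z y : convex_set E -> E p -> E q -> E z ->
  0 <= det3 y q z -> 0 <= det3 p y z -> 0 <= det3 p q y ->
  0 < det3 y q z + det3 p y z -> E y.
Proof.
move=> cE Ep Eq Ez; set a := det3 y q z; set b := det3 p y z; set c := det3 p q y => a0 b0 c0 ab.
have abc : 0 < a + b + c by lra.
have n1 := lt0r_neq0 ab; have n2 := lt0r_neq0 abc.
have -> : y = ((a + b) / (a + b + c))%:C * ((a / (a + b))%:C * p + (1 - a / (a + b))%:C * q) +
    (1 - (a + b) / (a + b + c))%:C * z.
  have E1 : (a + b + c) * Re y = a * Re p + b * Re q + c * Re z.
    by rewrite /a /b /c /det3 /cross !cReB !cImB; ring.
  have E2 : (a + b + c) * Im y = a * Im p + b * Im q + c * Im z.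
    by rewrite /a /b /c /det3 /cross !cReB !cImB; ring.
  clearbody a b c.
  apply/eqP; rewrite eq_complex; apply/andP; split; apply/eqP.
    apply: (mulfI n2); rewrite E1 cReD !cReM !cReD !cReM /=; field; by rewrite n1 n2.
  apply: (mulfI n2); rewrite E2 cImD !cImM !cImD !cImM !cReD !cReM /=; field; by rewrite n1 n2.
apply: convex_combination => //; first by rewrite divr_ge0 ?ler_pdivrMr//=; lra.
apply: convex_combination => //; by rewrite divr_ge0 ?ler_pdivrMr//=; lra.
Qed.

Lemma det3_swap p q z : det3 q p z = - det3 p q z.
Proof. by rewrite /det3 /cross !cReB !cImB; ring. Qed.

Lemma closure_cmod E z : closure E z -> forall d, 0 < d -> exists2 w, E w & cmod (w - z) < d.
Proof.
move=> cz d d0; have [|w [Ew Hw]] := cz [set w | cmod (w - z) < d]; last by exists w.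
by apply/nbhs_cmod; exists d.
Qed.

(** The point w2 lies on the broken line w1 w2 w3, with p on one side and q on
    the other, so it is interior to the quadrilateral w1 p w3 q. The strict
    inequalities persist when the vertices are moved into the convex set and
    w2 to a nearby point. *)
Lemma crossing_interior E w1 w2 w3 p q : convex_set E -> E `<=` unit_disk ->
  closure E w1 -> closure E w2 -> closure E w3 -> closure E p -> closure E q ->
  det3 w1 w2 p < 0 -> det3 w2 w3 p < 0 -> 0 < det3 w1 w2 q -> 0 < det3 w2 w3 q ->
  interior E w2.
Proof.
move=> cE Ed c1 c2 c3 cp cq h1 h2 h3 h4.
have cl z : closure E z -> cmod z <= 1.
  move=> cz; apply/ler_addgt0Pr => d d0; have [w /Ed w1' wd] := closure_cmod cz d0.
  by have := cmodD w (z - w); rewrite addrC subrK (cmodBC z); rewrite /unit_disk /= in w1'; lra.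
set m := Num.min (Num.min (- det3 w1 w2 p) (- det3 w2 w3 p)) (Num.min (det3 w1 w2 q) (det3 w2 w3 q)).
have m0 : 0 < m by rewrite !lt_min !oppr_gt0 h1 h2 h3.
have m1 : m <= - det3 w1 w2 p by rewrite !ge_min lexx.
have m2 : m <= - det3 w2 w3 p by rewrite !ge_min lexx !orbT.
have m3 : m <= det3 w1 w2 q by rewrite !ge_min lexx !orbT.
have m4 : m <= det3 w2 w3 q by rewrite !ge_min lexx !orbT.
(* by [det3_close] a displacement by d moves each determinant by less than m *)
set d := Num.min 1 (m / 13).
have d0 : 0 < d by rewrite lt_min ltr01 divr_gt0.
have d1 : d <= 1 by rewrite ge_min lexx.
have dm : 12 * d < m.
  have : d <= m / 13 by rewrite ge_min lexx orbT.
  lra.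
have [v1 E1 /ltW k1] := closure_cmod c1 d0; have [v3 E3 /ltW k3] := closure_cmod c3 d0.
have [p' Ep /ltW kp] := closure_cmod cp d0; have [q' Eq /ltW kq] := closure_cmod cq d0.
apply/nbhs_cmod; exists d => // y /ltW yd.
have := det3_close d1 (cl _ c1) (cl _ c2) (cl _ cp) k1 yd kp.
have := det3_close d1 (cl _ c2) (cl _ c3) (cl _ cp) yd k3 kp.
have := det3_close d1 (cl _ c1) (cl _ c2) (cl _ cq) k1 yd kq.
have := det3_close d1 (cl _ c2) (cl _ c3) (cl _ cq) yd k3 kq.
rewrite !ler_norml => /andP[q1 _] /andP[q2 _] /andP[_ q3] /andP[_ q4].
have [T0|T0] := leP 0 (det3 v1 v3 y).
  apply: (@in_triangle E v1 v3 q' y) => //; lra.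
have i1 := det3_swap v1 y p'; have i2 := det3_swap y v3 p'; have i3 := det3_swap v1 v3 y.
by apply: (@in_triangle E v3 v1 p' y) => //; lra.
Qed.

Definition along e z : R := Re z * Re e + Im z * Im e.
Definition across e z : R := Im z * Re e - Re z * Im e.

Lemma alongB e z w : along e (z - w) = along e z - along e w.
Proof. by rewrite /along cReB cImB; ring. Qed.

Lemma acrossB e z w : across e (z - w) = across e z - across e w.
Proof. by rewrite /across cReB cImB; ring. Qed.

Lemma cross_rot e u v : cmod e = 1 -> cross u v = along e u * across e v - across e u * along e v.
Proof.
move=> e1; have := cmod_sqr e; rewrite e1 expr1n => E.
transitivity ((Re e ^+ 2 + Im e ^+ 2) * cross u v); first by rewrite -E mul1r.
by rewrite /cross /along /across; ring.
Qed.

Lemma along_across_eq e z w : cmod e = 1 -> along e z = along e w -> across e z = across e w -> z = w.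
Proof.
move=> e1; have := cmod_sqr e; rewrite e1 expr1n /along /across => E E1 E2.
have H x : Re x = (Re x * Re e + Im x * Im e) * Re e - (Im x * Re e - Re x * Im e) * Im e.
  by rewrite -[LHS]mulr1 E; ring.
have K x : Im x = (Re x * Re e + Im x * Im e) * Im e + (Im x * Re e - Re x * Im e) * Re e.
  by rewrite -[LHS]mulr1 E; ring.
have R1 : Re z = Re w by rewrite [LHS]H [RHS]H E1 E2.
have R2 : Im z = Im w by rewrite [LHS]K [RHS]K E1 E2.
by apply/eqP; rewrite eq_complex R1 R2 !eqxx.
Qed.

(** Of three points on the line the middle one would be interior, by
    [crossing_interior]. *)
Lemma two_boundary_points E e (s : R) w1 w2 w3 p q : convex_set E -> E `<=` unit_disk -> cmod e = 1 ->
  (closure E `\` interior E) w1 -> (closure E `\` interior E) w2 -> (closure E `\` interior E) w3 ->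
  closure E p -> closure E q -> along e w1 = s -> along e w2 = s -> along e w3 = s ->
  along e q < s < along e p -> w1 <> w2 -> w2 <> w3 -> w1 <> w3 -> False.
Proof.
move=> cE Ed e1 b1 b2 b3 cp cq x1 x2 x3 /andP[xq xp] n12 n23 n13.
have D u v z : along e u = s -> along e v = s -> det3 u v z = - ((across e v - across e u) * (along e z - s)).
  by move=> xu xv; rewrite /det3 (cross_rot _ _ e1) !alongB !acrossB xu xv; ring.
have mid u v w : (closure E `\` interior E) u -> (closure E `\` interior E) v -> (closure E `\` interior E) w ->
    along e u = s -> along e v = s -> along e w = s ->
    across e u < across e v -> across e v < across e w -> False.
  move=> [cu _] [cv nv] [cw _] xu xv xw uv vw; apply: nv.
  have p0 : 0 < along e p - s by lra.
  have q0 : 0 < s - along e q by lra.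
  have uv0 : 0 < across e v - across e u by lra.
  have vw0 : 0 < across e w - across e v by lra.
  have := mulr_gt0 uv0 p0; have := mulr_gt0 vw0 p0; have := mulr_gt0 uv0 q0; have := mulr_gt0 vw0 q0.
  move=> *; apply: (@crossing_interior E u v w p q) => //; rewrite D//; lra.
have neq u v : along e u = s -> along e v = s -> u <> v -> across e u <> across e v.
  by move=> xu xv uv yE; apply: uv; apply: (along_across_eq e1) => //; rewrite xu xv.
have m12 := neq _ _ x1 x2 n12; have m23 := neq _ _ x2 x3 n23; have m13 := neq _ _ x1 x3 n13.
have [h12|h12|//] := ltgtP (across e w1) (across e w2);
have [h23|h23|//] := ltgtP (across e w2) (across e w3);
have [h13|h13|//] := ltgtP (across e w1) (across e w3).
- exact: (mid w1 w2 w3).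
- lra.
- exact: (mid w1 w3 w2).
- exact: (mid w3 w1 w2).
- exact: (mid w2 w1 w3).
- exact: (mid w2 w3 w1).
- lra.
- exact: (mid w3 w2 w1).
Qed.

End ConvexBoundary.

(** * Sums over the pieces of a partition *)

Section Partitions.
Context {R : realType}.
Implicit Types (a b c d t : R) (s : seq R) (Phi Psi : R -> R -> R).

(** Partitions of [a, b] are lists s with [path <%R a s] and [last a s = b].
    Recursion on the list keeps the left endpoint of each piece available. *)
Fixpoint psum Phi a s : R := if s is x :: s' then Phi a x + psum Phi x s' else 0.

Lemma path_le_last a s : path <%R a s -> a <= last a s.
Proof.
elim: s a => [//|x s IH] a /= /andP[ax /IH]; exact: le_trans (ltW ax).
Qed.

Lemma psum_cat Phi a s s' : psum Phi a (s ++ s') = psum Phi a s + psum Phi (last a s) s'.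
Proof. by elim: s a => [|x s IH] a /=; rewrite ?add0r// IH addrA. Qed.

Lemma psum_le Phi Psi a s : path <%R a s ->
  (forall c d, a <= c -> c < d -> d <= last a s -> Phi c d <= Psi c d) -> psum Phi a s <= psum Psi a s.
Proof.
elim: s a => [//|x s IH] a /= /andP[ax ps] H; apply: lerD.
  by apply: H => //; exact: path_le_last.
by apply: IH => // c d xc; apply: H; exact: le_trans (ltW ax) xc.
Qed.

Lemma psumD Phi Psi a s : psum (fun c d => Phi c d + Psi c d) a s = psum Phi a s + psum Psi a s.
Proof. by elim: s a => [|x s IH] a /=; rewrite ?addr0// IH addrACA. Qed.

Lemma psumZ (k : R) Phi a s : psum (fun c d => k * Phi c d) a s = k * psum Phi a s.
Proof. by elim: s a => [|x s IH] a /=; rewrite ?mulr0// IH mulrDr. Qed.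

Lemma psum_telescope (L : R -> R) a s : psum (fun c d => L d - L c) a s = L (last a s) - L a.
Proof. by elim: s a => [|x s IH] a /=; rewrite ?subrr// IH; ring. Qed.

Lemma psum_sum (n : nat) (Phi : 'I_n -> R -> R -> R) a s :
  psum (fun c d => \sum_(j < n) Phi j c d) a s = \sum_(j < n) psum (Phi j) a s.
Proof.
elim: s a => [|x s IH] a /=; first by rewrite big1.
by rewrite IH -big_split.
Qed.

Lemma psum_ge0 Phi a s : path <%R a s ->
  (forall c d, a <= c -> c < d -> d <= last a s -> 0 <= Phi c d) -> 0 <= psum Phi a s.
Proof.
move=> ps H; apply: le_trans (_ : psum (fun _ _ => 0) a s <= _); last exact: psum_le.
by elim: s a {ps H} => [//|x s IH] a /=; rewrite add0r.
Qed.

Fixpoint pall (P : R -> R -> Prop) a s : Prop := if s is x :: s' then P a x /\ pall P x s' else True.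

Lemma pall_imp (P Q : R -> R -> Prop) a s : (forall c d, P c d -> Q c d) -> pall P a s -> pall Q a s.
Proof. by move=> PQ; elim: s a => [//|x s IH] a /= [/PQ ? /IH]. Qed.

Lemma pall_and (P Q : R -> R -> Prop) a s : pall P a s -> pall Q a s -> pall (fun c d => P c d /\ Q c d) a s.
Proof. by elim: s a => [//|x s IH] a /= [p1 p2] [q1 q2]; split => //; exact: IH. Qed.

Lemma pall_inside a b s : path <%R a s -> last a s <= b -> pall (fun c d => a <= c /\ c < d /\ d <= b) a s.
Proof.
suff H y : a <= y -> path <%R y s -> last y s <= b -> pall (fun c d => a <= c /\ c < d /\ d <= b) y s by exact: H.
elim: s y => [//|x s IH] y ay /= /andP[yx ps] xb.
split; first by split => //; split => //; exact: le_trans (path_le_last ps) xb.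
by apply: IH => //; exact: le_trans ay (ltW yx).
Qed.

Lemma pall_right (P : R -> R -> Prop) a s t : path <%R a s -> pall P a s -> a < t <= last a s ->
  exists c d, [/\ a <= c, c < t, t <= d, d <= last a s & P c d].
Proof.
elim: s a => [|x s IH] a /=; first by move=> _ _ /andP[h1 h2]; have := lt_le_trans h1 h2; rewrite ltxx.
move=> /andP[ax ps] [Pax Ps] /andP[at0 tl]; have [tx|xt] := leP t x.
  by exists a, x; split => //; exact: path_le_last.
have [|c [d [c1 c2 c3 c4 c5]]] := IH x ps Ps; first by rewrite xt.
by exists c, d; split => //; exact: le_trans (ltW ax) c1.
Qed.

Lemma pall_left (P : R -> R -> Prop) a s t : path <%R a s -> pall P a s -> a <= t < last a s ->
  exists c d, [/\ a <= c, c <= t, t < d, d <= last a s & P c d].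
Proof.
elim: s a => [|x s IH] a /=; first by move=> _ _ /andP[h1 h2]; have := le_lt_trans h1 h2; rewrite ltxx.
move=> /andP[ax ps] [Pax Ps] /andP[at0 tl]; have [tx|xt] := ltP t x.
  by exists a, x; split => //; exact: path_le_last.
have [|c [d [c1 c2 c3 c4 c5]]] := IH x ps Ps; first by rewrite xt.
by exists c, d; split => //; exact: le_trans (ltW ax) c1.
Qed.

Lemma psum_term Phi a s : path <%R a s ->
  (forall c d, a <= c -> c < d -> d <= last a s -> 0 <= Phi c d) ->
  pall (fun c d => Phi c d <= psum Phi a s) a s.
Proof.
elim: s a => [//|x s IH] a /= /andP[ax ps] H; have xl := path_le_last ps.
have Hx c d : x <= c -> c < d -> d <= last x s -> 0 <= Phi c d.
  by move=> xc; apply: H; exact: le_trans (ltW ax) xc.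
split; first by rewrite lerDl; exact: psum_ge0.
apply: pall_imp (IH x ps Hx) => c d h; apply: (le_trans h); rewrite lerDr; exact: H.
Qed.

Fixpoint pcount (P : R -> R -> bool) a s : nat := if s is x :: s' then P a x + pcount P x s' else 0.

Lemma pcount_ex P a s n : path <%R a s -> (n < pcount P a s)%N ->
  exists c d s', [/\ a <= c, c < d, P c d & [/\ path <%R d s', last d s' = last a s & (n <= pcount P d s')%N]].
Proof.
elim: s a => [//|x s IH] a /= /andP[ax ps]; case E : (P a x).
  by move=> np; exists a, x, s.
move=> np; have [c [d [s' [c1 c2 c3 c4]]]] := IH x ps np.
by exists c, d, s'; split => //; exact: le_trans (ltW ax) c1.
Qed.

Lemma pcount_three P a s : path <%R a s -> (2 < pcount P a s)%N ->
  exists c1 d1 c2 d2 c3 d3, [/\ a <= c1, c1 < d1, d1 <= c2, c2 < d2 &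
   [/\ d2 <= c3, c3 < d3, d3 <= last a s & [/\ P c1 d1, P c2 d2 & P c3 d3]]].
Proof.
move=> ps /(pcount_ex ps) [c1 [d1 [s1 [q1 q2 q3 [p1 l1 n1]]]]].
have [c2 [d2 [s2 [r1 r2 r3 [p2 l2 n2]]]]] := pcount_ex p1 n1.
have [c3 [d3 [s3 [t1 t2 t3 [p3 l3 _]]]]] := pcount_ex p2 n2.
exists c1, d1, c2, d2, c3, d3; split => //; split => //.
by rewrite -l1 -l2 -l3; exact: path_le_last.
Qed.

Lemma psum_count (P : R -> R -> bool) (F : R -> R) (M : R) a s :
  pall (fun c d => P c d -> F c <= M) a s ->
  psum (fun c d => F c * (P c d)%:R) a s <= M * (pcount P a s)%:R.
Proof.
elim: s a => [|x s IH] a /=; first by rewrite mulr0.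
move=> [Px Ps]; rewrite natrD mulrDr; apply: lerD; last exact: IH.
by case E : (P a x); rewrite ?mulr0// !mulr1; exact: Px.
Qed.

Lemma psum_le_pall Phi Psi a s : pall (fun c d => Phi c d <= Psi c d) a s -> psum Phi a s <= psum Psi a s.
Proof. by elim: s a => [//|x s IH] a /= [h1 h2]; apply: lerD => //; exact: IH. Qed.

Definition fine_pieces (dl : R) := pall (fun c d => d - c < dl).

Lemma fine_cat dl a s s' : fine_pieces dl a s -> fine_pieces dl (last a s) s' -> fine_pieces dl a (s ++ s').
Proof. by elim: s a => [//|x s IH] a /= [xa fs] fs'; split => //; exact: IH. Qed.

Lemma subdivide Phi (dl : R) a b : 0 < dl -> a < b ->
  (forall c d e, a <= c -> c < d -> d < e -> e <= b -> Phi c e <= Phi c d + Phi d e) ->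
  exists s, [/\ path <%R a s, last a s = b, fine_pieces dl a s & Phi a b <= psum Phi a s].
Proof.
move=> dl0; have [n Hn] : exists n : nat, b - a < n%:R * (dl / 2).
  exists (Num.bound ((b - a) / (dl / 2))); have [ab|ba] := leP 0 (b - a).
    by rewrite -ltr_pdivrMr ?divr_gt0//; apply: archi_boundP; rewrite divr_ge0// divr_ge0// ltW.
  by apply: (lt_le_trans ba); rewrite mulr_ge0// divr_ge0// ltW.
elim: n a Hn => [|n IH] a; first by rewrite mul0r subr_lt0; move=> /ltW; case: ltgtP.
rewrite -natr1 mulrDl mul1r => Hn ab H.
have [bd|db] := ltP (b - a) dl.
  by exists [:: b]; split => //=; rewrite ?ab// addr0.
have ad : a < a + dl / 2 by rewrite ltrDl divr_gt0.
have adb : a + dl / 2 < b by lra.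
have [|||s [ps ls fs Hs]] := IH (a + dl / 2); [lra|by []| |].
  by move=> c d e ac; apply: H; lra.
exists ((a + dl / 2) :: s); split => //=; first by rewrite ad.
  by split => //; lra.
by have := H a _ b (lexx a) ad adb (lexx b); lra.
Qed.

Lemma refine_partition Phi (dl : R) a s0 : 0 < dl -> path <%R a s0 ->
  (forall c d e, a <= c -> c < d -> d < e -> e <= last a s0 -> Phi c e <= Phi c d + Phi d e) ->
  exists s, [/\ path <%R a s, last a s = last a s0, fine_pieces dl a s & psum Phi a s0 <= psum Phi a s].
Proof.
move=> dl0; elim: s0 a => [|x s0 IH] a /=; first by exists [::].
move=> /andP[ax ps] H; have xl := path_le_last ps.
have [|s1 [p1 l1 f1 H1]] := @subdivide Phi dl a x dl0 ax.
  by move=> c d e ac cd de ex; apply: H => //; exact: le_trans ex xl.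
have [|s2 [p2 l2 f2 H2]] := IH x ps.
  by move=> c d e xc; apply: H; exact: le_trans (ltW ax) xc.
exists (s1 ++ s2); split.
- by rewrite cat_path p1 l1 p2.
- by rewrite last_cat l1.
- by apply: fine_cat => //; rewrite l1.
- by rewrite psum_cat l1; exact: lerD.
Qed.

(** Compactness of an interval: take the supremum of the points up to which a
    uniform length works. *)
Lemma lebesgue_number (Q : R -> R -> Prop) a b :
  (forall x, a <= x <= b -> exists2 dl, 0 < dl & forall c d, a <= c -> c <= d -> d <= b ->
     x - dl < c -> d < x + dl -> Q c d) ->
  exists2 dl, 0 < dl & forall c d, a <= c -> c <= d -> d <= b -> d - c < dl -> Q c d.
Proof.
move=> H; have [ba|ab] := ltP b a.
  by exists 1 => // c d ac cd db; have := le_trans (le_trans ac cd) db; rewrite leNgt ba.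
pose S := [set x | a <= x <= b /\ exists2 dl, 0 < dl & forall c d, a <= c -> c <= d -> d <= x -> d - c < dl -> Q c d].
have Sa : S a.
  split; first by rewrite lexx ab.
  have [|dl dl0 Hd] := H a; first by rewrite lexx ab.
  exists dl => // c d ac cd da _; apply: Hd => //; lra.
have supS : has_sup S by split; [exists a|exists b => x [/andP[]]].
set T := sup S.
have aT : a <= T by apply: ub_le_sup => //; case: supS.
have Tb : T <= b by apply: ge_sup; [exists a|move=> x [/andP[]]].
have [|dl dl0 Hd] := H T; first by rewrite aT Tb.
have [x [/andP[ax xb] [d1 d10 Hx]] xT] := sup_adherent (divr_gt0 dl0 (@ltr0n R 2)) supS.
rewrite -/T in xT.
set y := Num.min b (T + dl / 2).
have yb : y <= b by rewrite ge_min lexx.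
have yT : y <= T + dl / 2 by rewrite ge_min lexx orbT.
have ay : a <= y by rewrite le_min ab; lra.
have Sy : S y.
  split; first by rewrite ay yb.
  exists (Num.min d1 (dl / 2)); first by rewrite lt_min d10 divr_gt0.
  move=> c d ac cd dy; rewrite lt_min => /andP[h1 h2].
  have [dx|xd] := leP d x; first exact: Hx.
  apply: Hd => //; lra.
have yT' : y <= T by apply: ub_le_sup => //; case: supS.
have by' : b <= y by rewrite le_min lexx /= leNgt; apply/negP => k; move: yT'; rewrite leNgt lt_min; lra.
have -> : b = y by apply/eqP; rewrite eq_le by' yb.
by case: Sy => _.
Qed.

End Partitions.

(** * Arclength and inscribed chord sums *)

Section Arclength.
Context {R : realType}.
Local Notation mu := (@lebesgue_measure R).

Lemma ri_integral (a b : R) (f : R -> R) : bmf a b f -> (\int[mu]_(t in `[a, b]) (f t)%:E = (ri a b f)%:E)%E.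
Proof.
move=> bV; rewrite /ri /Rintegral fineK//.
by apply: integrable_fin_num => //; exact: bmf_integrable.
Qed.

Lemma bmf_psum (A B : R) (Phi : R -> R -> R -> R) a s : (forall c d, bmf A B (Phi c d)) ->
  bmf A B (fun u => psum (fun c d => Phi c d u) a s).
Proof.
by move=> H; elim: s a => [|x s IH] a /=; [exact: bmf_cst|apply: bmfD].
Qed.

Lemma ri_psum (A B : R) (Phi : R -> R -> R -> R) a s : A <= B -> (forall c d, bmf A B (Phi c d)) ->
  ri A B (fun u => psum (fun c d => Phi c d u) a s) = psum (fun c d => ri A B (Phi c d)) a s.
Proof.
move=> AB H; elim: s a => [|x s IH] a /=; first by rewrite ri_cst// mul0r.
by rewrite riD ?IH//; exact: bmf_psum.
Qed.

Lemma ri_indic_itv (A B c d : R) : A <= c -> c <= d -> d <= B -> ri A B (\1_(`[c, d]%classic)) = d - c.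
Proof.
move=> Ac cd dB; apply: EFin_inj; rewrite -ri_integral; last exact: bmf_indic.
rewrite integral_indic//= (setIidl (_ : `[c, d] `<=` `[A, B])); last first.
  by move=> x /=; rewrite !in_itv /= => /andP[h1 h2]; rewrite (le_trans Ac h1) (le_trans h2 dB).
rewrite lebesgue_measure_itv /= lte_fin; have [->|cd'] := eqVneq c d; first by rewrite ltxx subrr.
by rewrite lt_neqAle cd' cd EFinB.
Qed.

Variables (gamma : R -> R[i]) (a b : R).
Hypothesis ab : a <= b.
Hypothesis rect : (curve_length gamma a b < +oo)%E.

Definition chord (c d : R) : R := cmod (gamma d - gamma c).
Definition len (t : R) : R := fine (curve_length gamma a t).

Lemma chord_ge0 c d : 0 <= chord c d. Proof. exact: cmod_ge0. Qed.

Lemma chord_triangle c d e : chord c e <= chord c d + chord d e.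
Proof.
rewrite /chord; have -> : gamma e - gamma c = (gamma d - gamma c) + (gamma e - gamma d) by ring.
exact: cmodD.
Qed.

Lemma curve_lengthE t : curve_length gamma a t =
  ereal_sup [set (psum chord a s)%:E | s in itv_partition a t].
Proof.
rewrite /curve_length; congr ereal_sup; apply/seteqP; split => _ [s ps <-]; exists s => //; congr EFin.
  elim: s (a) {ps} => [|x s IH] a0 /=; first by rewrite big_nil.
  by rewrite big_nat_recl//= -IH.
elim: s (a) {ps} => [|x s IH] a0 /=; first by rewrite big_nil.
by rewrite big_nat_recl//= -IH.
Qed.

Lemma curve_length_ge0 t : a <= t -> (0 <= curve_length gamma a t)%E.
Proof.
rewrite curve_lengthE le_eqVlt => /orP[/eqP <-|at0].
  by apply: ereal_sup_ubound; exists [::] => //; split => /=.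
apply: le_ereal_sup_tmp; exists (psum chord a [:: t])%:E; last by rewrite lee_fin /= addr0 chord_ge0.
by exists [:: t] => //; split => /=; rewrite ?at0.
Qed.

Lemma curve_length_fin t : a <= t <= b -> curve_length gamma a t \is a fin_num.
Proof.
move=> /andP[at0 tb]; rewrite ge0_fin_numE ?curve_length_ge0//; apply: le_lt_trans rect.
rewrite !curve_lengthE; apply: ge_ereal_sup => _ [s [ps /eqP ls] <-].
move: tb; rewrite (le_eqVlt t b) => /orP[/eqP tb|tb].
  by apply: ereal_sup_ubound; exists s => //; split => //; rewrite ls tb.
apply: le_ereal_sup_tmp; exists (psum chord a (rcons s b))%:E.
  by exists (rcons s b) => //; split; rewrite ?last_rcons// rcons_path ps ls.
by rewrite -cats1 psum_cat /= addr0 lee_fin lerDl chord_ge0.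
Qed.

Lemma lenE t : a <= t <= b -> curve_length gamma a t = (len t)%:E.
Proof. by move=> h; rewrite /len fineK// curve_length_fin. Qed.

Lemma psum_le_len s : path <%R a s -> last a s <= b -> psum chord a s <= len (last a s).
Proof.
move=> ps lb; rewrite -lee_fin -lenE ?lb ?path_le_last//.
by rewrite curve_lengthE; apply: ereal_sup_ubound; exists s => //; split => /=.
Qed.

Lemma len_lub t x : a <= t <= b -> (forall s, path <%R a s -> last a s = t -> psum chord a s <= x) -> len t <= x.
Proof.
move=> h H; rewrite -lee_fin -lenE// curve_lengthE; apply: ge_ereal_sup => _ [s [ps /eqP ls] <-].
by rewrite lee_fin; exact: H.
Qed.

Lemma len_superadd t t' : a <= t -> t <= t' -> t' <= b -> len t + chord t t' <= len t'.
Proof.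
move=> at0 tt' t'b; rewrite -lerBrDr; apply: len_lub => [|s ps ls]; first by rewrite at0 (le_trans tt' t'b).
rewrite lerBrDr; move: tt'; rewrite le_eqVlt => /orP[/eqP tt'|tt'].
  by rewrite /chord -tt' subrr cmod0 addr0 -ls; apply: psum_le_len => //; rewrite ls tt'.
have := @psum_le_len (rcons s t'); rewrite last_rcons -cats1 psum_cat /= addr0 cat_path ps ls /= tt'; exact.
Qed.

Lemma len_nd t t' : a <= t -> t <= t' -> t' <= b -> len t <= len t'.
Proof. by move=> h1 h2 h3; have := len_superadd h1 h2 h3; have := chord_ge0 t t'; lra. Qed.

Lemma len_a : len a = 0.
Proof.
apply/eqP; rewrite eq_le; apply/andP; split; last first.
  by have := @psum_le_len [::] isT ab.
apply: len_lub; first by rewrite lexx ab.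
case=> [//|x s] /= /andP[ax /path_le_last xl] ls.
by have := lt_le_trans ax xl; rewrite ls ltxx.
Qed.

Lemma len_approx e : 0 < e -> exists s, [/\ path <%R a s, last a s = b & len b - e < psum chord a s].
Proof.
move=> e0; apply: contrapT => H; have : len b <= len b - e; last by lra.
apply: len_lub; first by rewrite lexx ab.
by move=> s ps ls; rewrite leNgt; apply/negP => h; apply: H; exists s.
Qed.

(** Refining a partition does not decrease chord sums, by the triangle
    inequality. *)
Lemma fine_partition e dl : 0 < e -> 0 < dl ->
  exists s, [/\ path <%R a s, last a s = b, fine_pieces dl a s & len b - e < psum chord a s].
Proof.
move=> e0 dl0; have [s0 [p0 l0 H0]] := len_approx e0.
have [|s [ps ls fs Hs]] := @refine_partition R chord dl a s0 dl0 p0.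
  by move=> *; exact: chord_triangle.
by exists s; split => //; [rewrite ls|exact: lt_le_trans Hs].
Qed.

Hypothesis gc : forall x, a <= x <= b -> forall e, 0 < e -> exists2 dl, 0 < dl &
  forall y, a <= y <= b -> `|y - x| < dl -> cmod (gamma y - gamma x) < e.

Lemma uniform_chord e : 0 < e -> exists2 eta, 0 < eta &
  forall c d, a <= c -> c <= d -> d <= b -> d - c < eta -> chord c d <= e.
Proof.
move=> e0; have e2 : 0 < e / 2 by rewrite divr_gt0.
apply: lebesgue_number => x xab; have [dl dl0 H] := gc xab e2.
exists dl => // c d ac cd db xc dx; have /andP[ax xb] := xab.
have h1 : cmod (gamma c - gamma x) < e / 2 by apply: H; [rewrite ac (le_trans cd db)|rewrite ltr_norml; lra].
have h2 : cmod (gamma d - gamma x) < e / 2 by apply: H; [rewrite db (le_trans ac cd)|rewrite ltr_norml; lra].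
have := chord_triangle c x d; rewrite /chord (cmodBC (gamma x)); lra.
Qed.

(** Along a fine partition that almost exhausts the length, no piece can have
    an arclength much bigger than its chord, and short pieces have small
    chords. *)
Lemma small_increments e : 0 < e -> exists s, [/\ path <%R a s, last a s = b & pall (fun c d => len d - len c <= e) a s].
Proof.
move=> e0; have e2 : 0 < e / 2 by rewrite divr_gt0.
have [eta eta0 Heta] := uniform_chord e2.
have [s [ps ls fs Hs]] := fine_partition e2 eta0.
have H c d : a <= c -> c < d -> d <= last a s -> 0 <= len d - len c + - 1 * chord c d.
  by move=> ac cd; rewrite ls => db; have := len_superadd ac (ltW cd) db; lra.
exists s; split => //.
have inb := @pall_inside R a b s ps ltac:(by rewrite ls).
have := pall_and inb (pall_and fs (psum_term ps H)).
apply: pall_imp => c d [[ac [cd db]] [cde]]; rewrite psumD psumZ psum_telescope ls len_a subr0.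
have := Heta c d ac (ltW cd) db cde; lra.
Qed.

(** The length function is monotone with arbitrarily small jumps. *)
Lemma len_onto u : 0 <= u <= len b -> exists2 t, a <= t <= b & len t = u.
Proof.
move=> /andP[u0 ub]; pose S := [set t | a <= t <= b /\ len t <= u].
have Sa : S a by split; rewrite ?len_a ?lexx ?ab.
have supS : has_sup S by split; [exists a|exists b => x [/andP[]]].
set T := sup S; have aT : a <= T by apply: ub_le_sup => //; case: supS.
have Tb : T <= b by apply: ge_sup; [exists a|move=> x [/andP[]]].
exists T; first by rewrite aT Tb.
apply/eqP; rewrite eq_le; apply/andP; split; rewrite leNgt; apply/negP => lt1.
  have [s [ps ls Hs]] := small_increments (e := (len T - u) / 2) ltac:(lra).
  have Ta : a < T by rewrite lt_neqAle aT andbT; apply/eqP => TE; move: lt1; rewrite -TE len_a; lra.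
  have [|c [d [c1 c2 c3 c4 c5]]] := @pall_right R _ a s T ps Hs; first by rewrite Ta ls.
  rewrite ls in c4; have := len_nd aT c3 c4 => c6.
  suff : T <= c by rewrite leNgt c2.
  apply: ge_sup; first by exists a.
  move=> x [/andP[ax xb] xu]; rewrite leNgt; apply/negP => cx.
  by have := len_nd c1 (ltW cx) xb; lra.
have Tb' : T < b by rewrite lt_neqAle Tb andbT; apply/eqP => TE; move: lt1; rewrite TE; lra.
have [s [ps ls Hs]] := small_increments (e := (u - len T) / 2) ltac:(lra).
have [|c [d [c1 c2 c3 c4 c5]]] := @pall_left R _ a s T ps Hs; first by rewrite aT ls.
rewrite ls in c4; have := len_nd c1 c2 Tb => c6.
suff : d <= T by rewrite leNgt c3.
apply: ub_le_sup; first by case: supS.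
by split; [rewrite (le_trans aT (ltW c3))|lra].
Qed.

(** On each piece F is nearly constant, and the defect between arclength and
    chord sums up to the missing length, against the bound B of F. *)
Lemma curve_integral_le (F : R[i] -> R) (B e dl : R) : a < b -> 0 < e -> 0 < dl ->
  (forall t, a <= t <= b -> 0 <= F (gamma t) <= B) ->
  (forall x : R, a <= x <= b -> forall e : R, 0 < e -> exists2 dl : R, 0 < dl &
    forall y, a <= y <= b -> `|y - x| < dl -> `|F (gamma y) - F (gamma x)| < e) ->
  exists s, [/\ path <%R a s, last a s = b,
    pall (fun c d => d - c < dl /\ forall t, c <= t <= d -> `|F (gamma t) - F (gamma c)| <= e) a s &
    (curve_integral gamma a b F <=
      (psum (fun c d => F (gamma c) * chord c d) a s + e * (len b + B))%:E)%E].
Proof.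
move=> ab' e0 dl0 FB Fc.
have [d1 d10 Hd] : exists2 d1, 0 < d1 & forall c d, a <= c -> c <= d -> d <= b -> d - c < d1 ->
    forall t, c <= t <= d -> `|F (gamma t) - F (gamma c)| <= e.
  apply: lebesgue_number => x xab; have [d1 d10 H] := Fc x xab (e / 2) ltac:(by rewrite divr_gt0).
  exists d1 => // c d ac cd db xc dx t /andP[ct td]; have /andP[ax xb] := xab.
  have h1 : `|F (gamma c) - F (gamma x)| < e / 2.
    by apply: H; [rewrite ac (le_trans cd db)|rewrite ltr_norml; lra].
  have h2 : `|F (gamma t) - F (gamma x)| < e / 2.
    by apply: H; [rewrite (le_trans ac ct) (le_trans td db)|rewrite ltr_norml; lra].
  by move: h1 h2; rewrite !ltr_norml ler_norml; lra.
have [s [ps ls fs Hs]] := fine_partition e0 (dl := Num.min dl d1) ltac:(by rewrite lt_min dl0).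
have lb0 : 0 <= len b by rewrite -len_a; exact: len_nd.
have inb := @pall_inside R a b s ps ltac:(by rewrite ls).
have osc : pall (fun c d => d - c < dl /\ forall t, c <= t <= d -> `|F (gamma t) - F (gamma c)| <= e) a s.
  apply: pall_imp (pall_and inb fs) => c d [[ac [cd db]]]; rewrite lt_min => /andP[cd1 cd2].
  by split => //; apply: Hd => //; exact: ltW.
exists s; split => //.
pose Phi (c d u : R) : R := (F (gamma c) + e) * \1_(`[len c, len d]%classic) u.
have bPhi c d : bmf 0 (len b) (Phi c d) by apply: bmfZ; exact: bmf_indic.
have F0 c d : a <= c -> c < d -> d <= last a s -> 0 <= F (gamma c) + e.
  rewrite ls => ac cd db; have /andP[h _] : 0 <= F (gamma c) <= B by apply: FB; rewrite ac; lra.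
  by rewrite addr_ge0// ltW.
apply: (@le_trans _ _ (\int[mu]_(u in `[0%R, len b]) (psum (fun c d => Phi c d u) a s)%:E)%E).
  apply: le_integral_ge0 => u /=; rewrite in_itv /= => /len_onto [t0 t0ab t0u].
    rewrite /arclength_pt; case: xgetP => [t _ [tab _]|]; first by rewrite lee_fin; case/andP: (FB t tab).
    by move=> /(_ t0) nP; exfalso; apply: nP; split => //; rewrite lenE// t0u.
  rewrite /arclength_pt; case: xgetP => [t _ [tab]|]; last by move=> /(_ t0) nP; exfalso; apply: nP; split => //; rewrite lenE// t0u.
  rewrite lenE// => tuE; have tu : len t = u by apply: EFin_inj.
  rewrite lee_fin; clear tuE.
  have piece : pall (fun c d => c <= t <= d -> F (gamma t) <= psum (fun c d => Phi c d u) a s) a s.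
    have ps0 : forall c d, a <= c -> c < d -> d <= last a s -> 0 <= Phi c d u.
      by move=> c d ac cd db; apply: mulr_ge0; [exact: F0 db|rewrite indicE; case: (_ \in _)].
    have := pall_and inb (pall_and osc (psum_term ps ps0)).
    apply: pall_imp => c d [[ac [cd db]] [[_ H] H2]] /andP[ct td]; apply: le_trans H2.
    rewrite /Phi indicE mem_set ?mulr1; last first.
      by rewrite /= in_itv /= -tu !len_nd//; [exact: le_trans ac ct|exact: le_trans td db].
    by have := H t; rewrite ct td => /(_ isT); rewrite ler_norml; lra.
  have /andP[at0 tb] := tab; move: at0; rewrite (le_eqVlt a t) => /orP[/eqP ta|at0].
    have [|c [d [c1 c2 c3 c4]]] := pall_left ps piece (t := a); first by rewrite lexx ls.
    by rewrite -ta; apply; rewrite c2 ltW.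
  have [|c [d [c1 c2 c3 c4]]] := pall_right ps piece (t := t); first by rewrite at0 ls.
  by apply; rewrite c3 ltW.
rewrite ri_integral; last exact: bmf_psum.
rewrite lee_fin ri_psum//.
apply: (@le_trans _ _ (psum (fun c d => F (gamma c) * chord c d + (e * (len d - len c) + B * (len d - len c + -1 * chord c d))) a s)).
  apply: psum_le => // c d ac cd; rewrite ls => db.
  rewrite /Phi riZ; last exact: bmf_indic.
  have lcd : len c <= len d by apply: len_nd => //; exact: ltW.
  rewrite ri_indic_itv//; last 2 first.
  - by rewrite -len_a; apply: len_nd => //; lra.
  - by apply: len_nd => //; lra.
  have := len_superadd ac (ltW cd) db => sup.
  have /andP[f0 fB] : 0 <= F (gamma c) <= B by apply: FB; rewrite ac; lra.
  have : 0 <= (B - F (gamma c)) * (len d - len c - chord c d) by rewrite mulr_ge0//; lra.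
  lra.
rewrite psumD psumD !psumZ psum_telescope psumD psumZ psum_telescope ls len_a subr0.
have B0 : 0 <= B by have /andP[h1 h2] := FB a ltac:(by rewrite lexx ab); exact: le_trans h2.
have : B * (len b + -1 * psum chord a s) <= B * e by rewrite ler_wpM2l//; lra.
lra.
Qed.

End Arclength.

(** * Lines near the origin and Stolz cones *)

Section Transversals.
Context {R : realType}.
Implicit Types (z w e u v xi : R[i]) (s t : R).
Local Notation Re := (@complex.Re R).
Local Notation Im := (@complex.Im R).
Local Notation pi := (@pi R).

Lemma cmod_coords e z : cmod e = 1 -> cmod z ^+ 2 = along e z ^+ 2 + across e z ^+ 2.
Proof.
move=> e1; have := cmod_sqr e; rewrite e1 expr1n cmod_sqr /along /across => E.
by rewrite -[LHS]mulr1 E; ring.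
Qed.

Lemma along_le e z : cmod e = 1 -> `|along e z| <= cmod z.
Proof.
move=> e1; rewrite -(@ler_pXn2r _ 2) ?nnegrE ?cmod_ge0// real_normK ?num_real//.
by rewrite (cmod_coords _ e1) lerDl sqr_ge0.
Qed.

(** The two points of the circle on the line of height s over the direction e. *)
Definition exit_pt e (b : bool) s : R[i] := e * (s +i* ((if b then 1 else -1) * Num.sqrt (1 - s ^+ 2))).

Lemma exit_pt_coords e b s : cmod e = 1 ->
  along e (exit_pt e b s) = s /\ across e (exit_pt e b s) = (if b then 1 else -1) * Num.sqrt (1 - s ^+ 2).
Proof.
move=> e1; have := cmod_sqr e; rewrite e1 expr1n /along /across /exit_pt cReM cImM /=.
set y := _ * Num.sqrt _ => E; split.
  by rewrite -[RHS]mulr1 E; ring.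
by rewrite -[RHS]mulr1 E; ring.
Qed.

Lemma exit_pt_unit e b s : cmod e = 1 -> `|s| <= 1 -> cmod (exit_pt e b s) = 1.
Proof.
move=> e1 s1; apply/eqP; rewrite -(@eqrXn2 _ 2) ?cmod_ge0// (cmod_coords _ e1).
have [-> ->] := exit_pt_coords b s e1; rewrite exprMn sqr_sqrtr; last first.
  by rewrite subr_ge0 -(real_normK (num_real s)) expr_le1.
by case: b; rewrite ?sqrrN !expr1n mul1r addrC subrK.
Qed.

(** Take the exit point on the side of w. With y the distance of w from the
    middle of the line and S the half length of the line, |w - xi| = S - y
    while 1 - |w|^2 = (S - y)(S + y); so the cone condition reads 1 + |w| < al
    (S + y). *)
Lemma exit_stolz (al kap s : R) e w : cmod e = 1 -> 1 < al -> 0 < kap -> kap < 1 ->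
  1 + kap < al * Num.sqrt (1 - kap ^+ 2) -> `|s| <= kap -> cmod w < 1 -> along e w = s ->
  exists b, stolz al (exit_pt e b s) w.
Proof.
move=> e1 al1 k0 k1 Hk sk w1 ws.
set S := Num.sqrt (1 - s ^+ 2); set b := 0 <= across e w; exists b; split => //.
have s2 : s ^+ 2 <= kap ^+ 2 by rewrite -(real_normK (num_real s)) lerXn2r ?nnegrE ?(ltW k0).
have kk : kap ^+ 2 < 1 by rewrite expr_lt1 ?(ltW k0).
have SS : S ^+ 2 = 1 - s ^+ 2 by rewrite sqr_sqrtr//; lra.
have S0 : 0 <= S by exact: sqrtr_ge0.
have Sk : Num.sqrt (1 - kap ^+ 2) <= S by rewrite ler_sqrt; lra.
set sg : R := if b then 1 else -1; set y := sg * across e w.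
have y0 : 0 <= y by rewrite /y /sg /b; case: (leP 0 (across e w)) => h /=; lra.
have sg2 : sg ^+ 2 = 1 by rewrite /sg; case: ifP => _; rewrite ?sqrrN expr1n.
have wE : cmod w ^+ 2 = s ^+ 2 + y ^+ 2 by rewrite (cmod_coords _ e1) ws exprMn sg2 mul1r.
have w0 := cmod_ge0 w.
have yS : y < S by rewrite -(@ltr_pXn2r _ 2) ?nnegrE// SS; nra.
have dist : cmod (w - exit_pt e b s) = S - y.
  apply/eqP; rewrite -(@eqrXn2 _ 2) ?cmod_ge0// ?subr_ge0 ?(ltW yS)// (cmod_coords _ e1).
  rewrite alongB acrossB ws; have [-> ->] := exit_pt_coords b s e1; rewrite -/S -/sg subrr expr0n add0r.
  apply/eqP; transitivity (sg ^+ 2 * (across e w - sg * S) ^+ 2); first by rewrite sg2 mul1r.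
  transitivity ((y - sg ^+ 2 * S) ^+ 2); first by rewrite /y; ring.
  by rewrite sg2 mul1r -[LHS]sqrrN opprB.
rewrite dist.
have wle : cmod w <= kap + y.
  rewrite -(@ler_pXn2r _ 2) ?nnegrE//; last lra.
  rewrite wE; have : 0 <= kap * y by rewrite mulr_ge0// ltW.
  nra.
have k3 : 1 + cmod w < al * (S + y).
  have : al * Num.sqrt (1 - kap ^+ 2) <= al * S by rewrite ler_wpM2l//; lra.
  have : y <= al * y by rewrite ler_peMl// ltW.
  lra.
have h1 : (S - y) * (1 + cmod w) < (S - y) * (al * (S + y)) by rewrite ltr_pM2l// subr_gt0.
have h2 : (1 - cmod w) * (1 + cmod w) = (S - y) * (S + y) by move: wE SS; clear; nra.
rewrite -(@ltr_pM2r _ (1 + cmod w)); last lra.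
by rewrite -mulrA h2; lra.
Qed.

Lemma cone_parameter (al : R) : 1 < al -> exists kap, [/\ 0 < kap, kap <= 1 / 2 & 1 + kap < al * Num.sqrt (1 - kap ^+ 2)].
Proof.
move=> al1; have a2 : 1 < al ^+ 2 by rewrite expr_gt1//; lra.
set k := (al ^+ 2 - 1) / (2 * (al ^+ 2 + 1)).
have d0 : 0 < 2 * (al ^+ 2 + 1) by lra.
have kE : k * (2 * (al ^+ 2 + 1)) = al ^+ 2 - 1 by rewrite /k mulfVK// lt0r_neq0.
have k0 : 0 < k by rewrite /k divr_gt0//; lra.
have k1 : k <= 1 / 2 by rewrite /k ler_pdivrMr//; lra.
exists k; split => //.
have kk : k ^+ 2 < 1 by rewrite expr_lt1 ?(ltW k0)//; lra.
rewrite -(@ltr_pXn2r _ 2) ?nnegrE//; [|lra|by rewrite mulr_ge0 ?sqrtr_ge0//; lra].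
rewrite exprMn sqr_sqrtr; last lra.
have -> : al ^+ 2 * (1 - k ^+ 2) = (al ^+ 2 * (1 - k)) * (1 + k) by ring.
have -> : (1 + k) ^+ 2 = (1 + k) * (1 + k) by ring.
rewrite ltr_pM2r; last lra.
by move: kE a2 k0 k1; clear; nra.
Qed.

Lemma two_directions e e' u : `|cross e e'| * cmod u <= (`|along e u| + `|along e' u|) * Num.max (cmod e) (cmod e').
Proof.
set m := Num.max _ _; have m1 : cmod e <= m by rewrite le_max lexx.
have m2 : cmod e' <= m by rewrite le_max lexx orbT.
rewrite -(cmod_real (cross e e')) -cmodM.
have -> : (cross e e')%:C * u = (along e u)%:C * (Im e' +i* - Re e') + (along e' u)%:C * (- Im e +i* Re e).
  apply/eqP; rewrite eq_complex; apply/andP; split; apply/eqP.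
    by rewrite cReM cReD !cReM /cross /along /=; ring.
  by rewrite cImM cImD !cImM /cross /along /=; ring.
apply: (le_trans (cmodD _ _)); rewrite !cmodM !cmod_real mulrDl.
have -> : cmod (Im e' +i* - Re e') = cmod e'.
  by apply/eqP; rewrite -(@eqrXn2 _ 2) ?cmod_ge0// !cmod_sqr /= sqrrN addrC.
have -> : cmod (- Im e +i* Re e) = cmod e.
  by apply/eqP; rewrite -(@eqrXn2 _ 2) ?cmod_ge0// !cmod_sqr /= sqrrN addrC.
by apply: lerD; rewrite ler_wpM2l.
Qed.

(** The directions within kap / 2 of the normal to z satisfy the first bound.
    Two neighbouring directions of a net of mesh kap / 2 do so, and one of the
    two sees u because they are not parallel. *)
Lemma direction_net (kap : R) : 0 < kap -> kap < 1 -> exists (m : nat) (eta c0 : R), 0 < c0 /\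
  forall z u, cmod z < 1 -> exists j : 'I_m,
    `|along (circle_pt (j%:R * eta)) z| <= kap / 2 /\ c0 * cmod u <= `|along (circle_pt (j%:R * eta)) u|.
Proof.
move=> k0 k1; set eta := kap / 2.
have eta0 : 0 < eta by rewrite divr_gt0.
have eta1 : eta < 1 by rewrite /eta; lra.
have s0 : 0 < sin eta by apply: sin_gt0_pi; rewrite eta0 /=; have := pi_ge2 R; lra.
(* the net runs past 3 pi so that it contains neighbours of th + pi / 2 *)
set m := (Num.bound ((3 * pi) / eta)).+2.
have mB : 3 * pi < (m.-2)%:R * eta.
  by rewrite -ltr_pdivrMr//; apply: archi_boundP; rewrite divr_ge0 ?(ltW eta0)// mulr_ge0 ?pi_ge0.
exists m, eta, (sin eta / 2); split; first by rewrite divr_gt0.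
move=> z u z1.
have [th [th0 thE]] : exists th, 0 <= th <= 2 * pi /\ z = (cmod z)%:C * circle_pt th.
  have [z0|z0] := eqVneq (cmod z) 0.
    by exists 0; rewrite lexx mulr_ge0 ?pi_ge0//; split => //; rewrite z0 mul0r; exact: cmod0_eq0.
  have zc : (cmod z)%:C != 0 :> R[i] by rewrite -cmod_gt0 cmod_real normr_gt0.
  have [cE cI] : circle_pt (carg (((cmod z)%:C)^-1 * z)) = ((cmod z)%:C)^-1 * z /\ 0 <= carg (((cmod z)%:C)^-1 * z) <= 2 * pi.
    by apply: circle_pt_carg; rewrite cmodM cmodV cmod_real (ger0_norm (cmod_ge0 _)) mulVf.
  by exists (carg (((cmod z)%:C)^-1 * z)); split => //; rewrite cE mulrA mulfV// mul1r.
have pp := @pi_gt0 R; move: th0 => /andP[th0 th2].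
pose P (n : nat) := th + pi / 2 < n%:R * eta.
have [n Pn nmin] : exists2 n, P n & forall k, P k -> (n <= k)%N.
  have ex : exists n, P n by exists m.-2; rewrite /P; lra.
  by exists (ex_minn ex); case: ex_minnP.
have nm : (n <= m.-2)%N by apply: nmin; rewrite /P; lra.
have n0 : (0 < n)%N by rewrite lt0n; apply/eqP => nE; move: Pn; rewrite /P nE mul0r; lra.
have Pn1 : n.-1%:R * eta <= th + pi / 2.
  by rewrite leNgt; apply/negP => /nmin; rewrite leqNgt ltn_predL n0.
have nE : n%:R = n.-1%:R + 1 :> R by rewrite natr1 prednK.
have nE' : n%:R * eta = n.-1%:R * eta + eta by rewrite nE mulrDl mul1r.
have near (k : nat) : `|k%:R * eta - (th + pi / 2)| <= eta -> `|along (circle_pt (k%:R * eta)) z| <= kap / 2.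
  move=> hk; rewrite thE.
  have -> : along (circle_pt (k%:R * eta)) ((cmod z)%:C * circle_pt th) = - cmod z * sin (k%:R * eta - (th + pi / 2)).
    have -> : sin (k%:R * eta - (th + pi / 2)) = - cos (k%:R * eta - th).
      by rewrite opprD addrA sinB cos_pihalf sin_pihalf mulr0 mulr1 sub0r.
    by rewrite /along cReM cImM /= cosB; ring.
  rewrite normrM normrN (ger0_norm (cmod_ge0 z)); apply: le_trans (_ : 1 * eta <= _); last by rewrite mul1r.
  apply: ler_pM => //; [exact: cmod_ge0|exact: ltW|exact: le_trans (abs_sin_le _) hk].
have h1 : `|along (circle_pt (n.-1%:R * eta)) z| <= kap / 2.
  by apply: near; move: Pn; rewrite /P ler_norml; lra.
have h2 : `|along (circle_pt (n%:R * eta)) z| <= kap / 2.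
  by apply: near; move: Pn; rewrite /P ler_norml; lra.
have cr : cross (circle_pt (n.-1%:R * eta)) (circle_pt (n%:R * eta)) = sin eta.
  have {3}-> : eta = n%:R * eta - n.-1%:R * eta by rewrite nE'; ring.
  by rewrite /cross sinB /=; ring.
have := two_directions (circle_pt (n.-1%:R * eta)) (circle_pt (n%:R * eta)) u.
rewrite cr !circle_pt_cmod maxxx mulr1 (gtr0_norm s0) => Hu.
have nm1 : (n.-1 < m)%N by apply: leq_ltn_trans (leq_pred n) _; rewrite (leq_ltn_trans nm)// /m ltnS leqnSn.
have nm2 : (n < m)%N by rewrite (leq_ltn_trans nm)// /m ltnS leqnSn.
have [q|q] := leP (sin eta / 2 * cmod u) `|along (circle_pt (n.-1%:R * eta)) u|.
  by exists (Ordinal nm1).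
by exists (Ordinal nm2); split => //=; lra.
Qed.

End Transversals.

(** * Integrals over convex curves *)

Section ConvexCurveBound.
Context {R : realType}.
Implicit Types (z w e u v xi : R[i]).
Local Notation pi := (@pi R).
Local Notation mu := (@lebesgue_measure R).

Definition ccont_on (a b : R) (f : R -> R[i]) := forall x, a <= x <= b -> forall e : R, 0 < e ->
  exists2 dl : R, 0 < dl & forall y, a <= y <= b -> `|y - x| < dl -> cmod (f y - f x) < e.

Lemma ccont_on_lip a b (f : R -> R[i]) (g : R -> R) : ccont_on a b f ->
  (forall x y, `|g y - g x| <= cmod (f y - f x)) -> cont_on a b g.
Proof.
move=> fc fg x xab e e0; have [dl dl0 H] := fc x xab e e0; exists dl => // y yab yx.
by apply: le_lt_trans (fg x y) _; exact: H.
Qed.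

Lemma cont_on_sub a b c d (g : R -> R) : a <= c -> d <= b -> cont_on a b g -> cont_on c d g.
Proof.
move=> ac db gc x /andP[cx xd] e e0; have [|dl dl0 H] := gc x _ e e0.
  by rewrite (le_trans ac cx) (le_trans xd db).
exists dl => // y /andP[cy yd]; apply: H; by rewrite (le_trans ac cy) (le_trans yd db).
Qed.

Lemma strict_ivt c d (x : R -> R) (s : R) : c < d -> cont_on c d x ->
  (x c < s < x d) || (x d < s < x c) -> exists2 t, c < t < d & x t = s.
Proof.
move=> cd xc H; have [|t] := @IVT R x c d s (ltW cd) (cont_onP xc).
  rewrite ge_min le_max; case/orP: H => /andP[h1 h2]; rewrite (ltW h1) (ltW h2) ?orbT//.
rewrite in_itv /= => /andP[ct td] xt; exists t => //.
rewrite !lt_neqAle ct td !andbT; apply/andP; split; apply/eqP => E.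
  by move: H; rewrite E xt ltxx andbF.
by move: H; rewrite -E xt ltxx andbF.
Qed.

Variables (gamma : R -> R[i]) (a b : R) (E : set (Cplx R)).
Hypothesis ab : a < b.
Hypothesis rect : (curve_length gamma a b < +oo)%E.
Hypothesis gc : ccont_on a b gamma.
Hypothesis inj : forall s t, a < s -> s < t -> t < b -> gamma s <> gamma t.
Hypothesis cE : convex_set E.
Hypothesis Ed : E `<=` unit_disk.
Hypothesis gE : forall t, a <= t <= b -> (closure E `\` interior E) (gamma t).
Hypothesis gD : forall t, a <= t <= b -> cmod (gamma t) < 1.

(** Strict inequalities: only heights strictly between those of the endpoints
    are counted, which loses a null set of heights and makes the crossing
    points of different pieces distinct. *)
Definition separates e (s : R) (c d : R) : bool :=
  (along e (gamma c) < s < along e (gamma d)) || (along e (gamma d) < s < along e (gamma c)).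

Lemma along_cont e : cmod e = 1 -> cont_on a b (fun t => along e (gamma t)).
Proof.
move=> e1; apply: (ccont_on_lip gc) => x y; rewrite -alongB; exact: along_le.
Qed.

Lemma separates_point e s c d : cmod e = 1 -> a <= c -> c < d -> d <= b -> separates e s c d ->
  exists2 t, c < t < d & along e (gamma t) = s.
Proof.
move=> e1 ac cd db; exact: (strict_ivt cd (cont_on_sub ac db (along_cont e1))).
Qed.

(** Three pieces crossing the line would give three distinct points of the
    boundary of E on it; the endpoints of one piece lie strictly on both
    sides. *)
Lemma separates_count e (s : R) l : cmod e = 1 -> path <%R a l -> last a l = b ->
  (pcount (separates e s) a l <= 2)%N.
Proof.
move=> e1 pl ll; rewrite leqNgt; apply/negP => /(pcount_three pl).
have ab' := ab; move=> [c1 [d1 [c2 [d2 [c3 [d3 [h1 h2 h3 h4 [h5 h6 h7 [s1 s2 s3]]]]]]]]]; rewrite ll in h7.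
have [t1 /andP[p1 q1] x1] := separates_point e1 h1 h2 ltac:(lra) s1.
have [t2 /andP[p2 q2] x2] := separates_point e1 (c := c2) ltac:(lra) h4 ltac:(lra) s2.
have [t3 /andP[p3 q3] x3] := separates_point e1 (c := c3) ltac:(lra) h6 h7 s3.
have g t : a <= t <= b -> closure E (gamma t) by move=> /gE[].
have [p [q [cp cq xpq]]] : exists p q, [/\ closure E p, closure E q & along e q < s < along e p].
  case/orP: s1 => xs; first by exists (gamma d1), (gamma c1); split => //; apply: g; lra.
  by exists (gamma c1), (gamma d1); split => //; apply: g; lra.
have g1 : (closure E `\` interior E) (gamma t1) by apply: gE; lra.
have g2 : (closure E `\` interior E) (gamma t2) by apply: gE; lra.
have g3 : (closure E `\` interior E) (gamma t3) by apply: gE; lra.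
have n12 : gamma t1 <> gamma t2 by apply: inj; lra.
have n23 : gamma t2 <> gamma t3 by apply: inj; lra.
have n13 : gamma t1 <> gamma t3 by apply: inj; lra.
exact: (two_boundary_points cE Ed e1 g1 g2 g3 cp cq x1 x2 x3 xpq n12 n23 n13).
Qed.

Variables (al kap L : R) (F : R[i] -> R) (H : R[i] -> R) (N : R -> \bar R).
Hypothesis al1 : 1 < al.
Hypothesis kap0 : 0 < kap.
Hypothesis kap1 : kap <= 1 / 2.
Hypothesis kapal : 1 + kap < al * Num.sqrt (1 - kap ^+ 2).
Hypothesis L1 : 1 <= L.
Hypothesis HI : forall xi, cmod xi = 1 -> 0 <= H xi <= 2 * pi.
Hypothesis HL : forall xi eta, cmod xi = 1 -> cmod eta = 1 -> cmod (xi - eta) <= L * `|H xi - H eta|.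
Hypothesis Hm : forall c d (f : R -> R[i]), (forall t, c <= t <= d -> cmod (f t) = 1) ->
  ccont_on c d f -> measurable_fun `[c, d] (fun t => H (f t)).
Hypothesis mN : measurable_fun `[0, 2 * pi] N.
Hypothesis N0 : forall t, (0 <= N t)%E.
Hypothesis FN : forall xi z, cmod xi = 1 -> stolz al xi z -> ((F z)%:E <= N (H xi))%E.
Hypothesis F0 : forall z, cmod z < 1 -> 0 <= F z.
Hypothesis Fc : cont_on a b (fun t => F (gamma t)).

Lemma exit_pt_cont e bo : cmod e = 1 -> ccont_on (- kap) kap (exit_pt e bo).
Proof.
move=> e1 x xab ep ep0.
have sc : {for 1 - x ^+ 2, continuous (@Num.sqrt R)} by exact: sqrt_continuous.
have /cvgrPdist_lt /(_ (ep / 2) ltac:(by rewrite divr_gt0)) : (Num.sqrt (1 - y ^+ 2) @[y --> x] --> Num.sqrt (1 - x ^+ 2)).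
  apply: (@continuous_comp _ _ _ (fun y : R => 1 - y ^+ 2) Num.sqrt) => //.
  by apply: cvgB; [exact: cvg_cst|exact: exprn_continuous].
move=> /nbhs_ballP [d1 /= d10 Hd].
exists (Num.min d1 (ep / 2)); first by rewrite lt_min d10 divr_gt0.
move=> y yab; rewrite lt_min => /andP[y1 y2].
rewrite /exit_pt -mulrBr cmodM e1 mul1r; apply: (le_lt_trans (cmod_ReIm _)); rewrite cReB cImB /=.
have := Hd y; rewrite /ball /= distrC => /(_ y1).
set A := Num.sqrt _; set B := Num.sqrt _ => hAB.
have -> : `|(if bo then 1 else -1) * B - (if bo then 1 else -1) * A| = `|A - B|.
  by rewrite -mulrBr normrM; case: bo; rewrite ?normrN normr1 mul1r distrC.
lra.
Qed.

Definition crossed e (c d : R) : set R :=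
  `](Num.min (along e (gamma c)) (along e (gamma d))), (Num.max (along e (gamma c)) (along e (gamma d)))[%classic.

Definition crossing_length e (c d : R) : R := ri (- kap) kap (\1_(crossed e c d)).

Lemma crossed_separates e c d s : \1_(crossed e c d) s = (separates e s c d)%:R :> R.
Proof.
rewrite indicE; congr (_%:R); congr nat_of_bool; apply/idP/idP.
  rewrite inE /crossed /= in_itv /= gt_min lt_max /separates.
  set x := along e _; set y := along e _.
  by move=> /andP[/orP[] h1 /orP[] h2]; rewrite ?h1 ?h2 ?orbT//; have := lt_trans h1 h2; rewrite ltxx.
rewrite /separates inE /crossed /= in_itv /= gt_min lt_max.
by case/orP => /andP[-> ->]; rewrite ?orbT.
Qed.

Lemma crossing_length_eq e c d : `|along e (gamma c)| <= kap -> `|along e (gamma d)| <= kap ->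
  crossing_length e c d = `|along e (gamma d) - along e (gamma c)|.
Proof.
rewrite /crossing_length /crossed; set x := along e _; set y := along e _ => xk yk.
apply: EFin_inj; rewrite -ri_integral; last exact: bmf_indic.
rewrite integral_indic//= setIidl; last first.
  move=> t /=; rewrite !in_itv /= gt_min lt_max; move: xk yk; rewrite !ler_norml.
  by move=> /andP[h1 h2] /andP[h3 h4] /andP[/orP[] h5 /orP[] h6]; lra.
rewrite lebesgue_measure_itv /= lte_fin; have [xy|xy|->] := ltgtP x y; rewrite ?ltxx ?subrr ?normr0// ?xy -EFinB.
  by rewrite gtr0_norm ?subr_gt0.
by rewrite ltr0_norm ?subr_lt0// opprB.
Qed.

(** Integrate over the heights s of the lines across one direction: each line
    meets the curve at most twice, at points of the Stolz cones of its exit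
    points, and the exit points move expandingly in the angular coordinate H. *)
Lemma direction_bound e (ep : R) l : cmod e = 1 -> 0 < ep -> path <%R a l -> last a l = b ->
  pall (fun c d => forall t, c <= t <= d -> `|F (gamma t) - F (gamma c)| <= ep) a l ->
  ((psum (fun c d => F (gamma c) * crossing_length e c d) a l)%:E <=
    (8 * L)%:E * \int[mu]_(t in `[0%R, (2 * pi)%R]) N t + (4 * kap * ep)%:E)%E.
Proof.
move=> e1 ep0 pl ll osc.
have k0 := kap0; have k1 := kap1; have l1 := L1.
have k2 : kap < 1 by lra.
have kk : - kap <= kap by lra.
have inb := @pall_inside R a b l pl ltac:(by rewrite ll).
have kapabs (s : R) : - kap <= s <= kap -> `|s| <= kap by rewrite ler_norml.
pose h bo s := H (exit_pt e bo s).
have un bo (s : R) : - kap <= s <= kap -> cmod (exit_pt e bo s) = 1.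
  by move=> /kapabs hs; apply: exit_pt_unit => //; lra.
have mh bo : measurable_fun `[(- kap), kap] (h bo) by apply: Hm; [exact: un|exact: exit_pt_cont].
have hin bo (s : R) : - kap <= s <= kap -> 0 <= h bo s <= 2 * pi by move=> /(un bo) /HI.
have mNh bo : measurable_fun `[(- kap), kap] (fun s => N (h bo s)).
  apply: (measurable_comp _ _ mN (mh bo)) => //.
  by move=> _ [s /= sk <-]; rewrite in_itv /= hin//; move: sk; rewrite in_itv.
have INh bo : (\int[mu]_(s in `[(- kap)%R, kap]) N (h bo s) <= (2 * L)%:E * \int[mu]_(t in `[0%R, (2 * pi)%R]) N t)%E.
  apply: expanding_integral_on => //; first lra; first exact: hin.
  move=> s s' sk sk'; apply: le_trans (HL (un bo s sk) (un bo s' sk')).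
  have [x1 _] := exit_pt_coords bo s e1; have [x2 _] := exit_pt_coords bo s' e1.
  by rewrite -{1}x1 -{1}x2 -alongB; exact: along_le.
pose Phi (c d s : R) : R := F (gamma c) * \1_(crossed e c d) s.
have bPhi c d : bmf (- kap) kap (Phi c d) by apply: bmfZ; apply: bmf_indic; exact: measurable_itv.
have -> : psum (fun c d => F (gamma c) * crossing_length e c d) a l =
    ri (- kap) kap (fun s => psum (fun c d => Phi c d s) a l).
  rewrite ri_psum//; congr psum; apply/funext => c; apply/funext => d.
  by rewrite /Phi riZ//; apply: bmf_indic; exact: measurable_itv.
rewrite -ri_integral; last exact: bmf_psum.
apply: (@le_trans _ _ (\int[mu]_(s in `[(- kap)%R, kap]) (2%:E * (N (h true s) + N (h false s)) + (2 * ep)%:E))%E).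
  apply: le_integral_ge0 => s /=; rewrite in_itv /= => sk.
    rewrite lee_fin; apply: psum_ge0 => // c d ac cd; rewrite ll => db.
    apply: mulr_ge0; first by apply: F0; apply: gD; lra.
    by rewrite indicE; case: (_ \in _).
  have N2 : (0 <= N (h true s) + N (h false s))%E by rewrite adde_ge0.
  case EN : (N (h true s) + N (h false s))%E => [n| |]; last 2 first.
  - by rewrite gt0_muley ?lte_fin// addye// leey.
  - by move: N2; rewrite EN.
  have Nle bo : (N (h bo s) <= n%:E)%E.
    by rewrite -EN; case: bo; rewrite ?leeDl ?leeDr.
  rewrite -EFinM -EFinD lee_fin.
  have -> : psum (fun c d => Phi c d s) a l = psum (fun c d => F (gamma c) * (separates e s c d)%:R) a l.
    by congr psum; apply/funext => c; apply/funext => d; rewrite /Phi crossed_separates.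
  have n0 : 0 <= n by rewrite -lee_fin -EN.
  apply: (@le_trans _ _ ((n + ep) * (pcount (separates e s) a l)%:R)).
    apply: psum_count; apply: pall_imp (pall_and inb osc) => c d [[ac [cd db]] Hosc] sep.
    have [t /andP[ct td] ts] := separates_point e1 ac cd db sep.
    have [|bo st] := @exit_stolz R al kap s e (gamma t) e1 al1 kap0 k2 kapal (kapabs s sk) _ ts.
      by apply: gD; lra.
    have := le_trans (FN (un bo s sk) st) (Nle bo); rewrite lee_fin => Fn.
    by have := Hosc t; rewrite (ltW ct) (ltW td) => /(_ isT); rewrite ler_norml; lra.
  have : (pcount (separates e s) a l)%:R <= 2 :> R by rewrite ler_nat; exact: separates_count.
  move=> hc; apply: (@le_trans _ _ ((n + ep) * 2)); first by rewrite ler_wpM2l//; lra.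
  lra.
have mS : measurable_fun `[(- kap), kap] (fun s => N (h true s) + N (h false s))%E.
  by apply: emeasurable_funD; exact: mNh.
rewrite ge0_integralD//=; last 3 first.
- by move=> s _; rewrite mule_ge0// adde_ge0.
- exact: measurable_funeM.
- by move=> s _; rewrite lee_fin; lra.
rewrite ge0_integralZl//; last by move=> s _; rewrite adde_ge0.
rewrite ge0_integralD//; [|exact: mNh..].
apply: leeD.
  have -> : ((8 * L)%:E = 2%:E * ((2 * L)%:E + (2 * L)%:E))%E.
    by rewrite -EFinD -EFinM; congr EFin; ring.
  rewrite -muleA lee_pmul2l// ge0_muleDl ?lee_fin; [|lra..].
  exact: leeD.
by rewrite (ri_integral (bmf_cst _ _ (2 * ep))) ri_cst// lee_fin le_eqVlt; apply/orP; left; apply/eqP; ring.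
Qed.

(** Every short chord is crossed transversally by the lines over one of
    finitely many directions, so the chord sums of F are controlled by the
    integral of N. *)
Theorem convex_curve_bound (m : nat) (eta c0 : R) : 0 < c0 ->
  (forall z u, cmod z < 1 -> exists j : 'I_m,
    `|along (circle_pt (j%:R * eta)) z| <= kap / 2 /\ c0 * cmod u <= `|along (circle_pt (j%:R * eta)) u|) ->
  (curve_integral gamma a b F <=
    (m%:R * (8 * L) / c0)%:E * \int[mu]_(t in `[0%R, (2 * pi)%R]) N t)%E.
Proof.
move=> c00 net; have ab' := ab; have k0 := kap0; have l1 := L1.
have m0 : (0 < m)%N by have [|j _] := net 0 0; [rewrite cmod0|exact: leq_ltn_trans (ltn_ord j)].
have mR : 0 < m%:R :> R by rewrite ltr0n.
have Cp : 0 < m%:R * (8 * L) / c0 by rewrite divr_gt0// mulr_gt0//; lra.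
have IN0 : (0 <= \int[mu]_(t in `[0%R, (2 * pi)%R]) N t)%E by apply: integral_ge0.
case EN : (\int[mu]_(t in `[0%R, (2 * pi)%R]) N t)%E => [n| |]; last 2 first.
- by rewrite gt0_muley ?lte_fin// leey.
- by move: IN0; rewrite EN.
have [B HB] : exists B, forall t, a <= t <= b -> 0 <= F (gamma t) <= B.
  have [_ [B HB]] := cont_on_bmf Fc; exists B => t tab.
  rewrite F0 ?gD//=; apply: le_trans (HB t tab); exact: ler_norm.
have B0 : 0 <= B by have /andP[h1 h2] := HB a ltac:(by rewrite lexx ltW); exact: le_trans h2.
have lb0 : 0 <= len gamma a b.
  have := len_nd rect (lexx a) (ltW ab) (lexx b); by rewrite (len_a (ltW ab) rect).
set K := m%:R * (4 * kap) / c0 + (len gamma a b + B).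
have K0 : 0 <= K by rewrite addr_ge0 ?addr_ge0// divr_ge0 ?(ltW c00)// mulr_ge0 ?ler0n//; lra.
(* K collects the errors from the oscillation of F and from the missing length *)
apply/lee_addgt0Pr => e e0; set ep := e / (K + 1).
have K1 : 0 < K + 1 by lra.
have ep0 : 0 < ep by rewrite divr_gt0.
have [dl dl0 Hdl] := uniform_chord gc (divr_gt0 k0 (@ltr0n R 2)).
have [l [pl ll osc Hl]] := curve_integral_le (ltW ab) rect gc ab ep0 dl0 HB Fc.
apply: (le_trans Hl); rewrite -EFinM -EFinD lee_fin.
have inb := @pall_inside R a b l pl ltac:(by rewrite ll).
have e1 (j : 'I_m) : cmod (circle_pt (j%:R * eta) : R[i]) = 1 by exact: circle_pt_cmod.
have oscF : pall (fun c d => forall t, c <= t <= d -> `|F (gamma t) - F (gamma c)| <= ep) a l.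
  by apply: pall_imp osc => c d [].
have dir (j : 'I_m) : psum (fun c d => F (gamma c) * crossing_length (circle_pt (j%:R * eta)) c d) a l <=
    8 * L * n + 4 * kap * ep.
  by have := direction_bound (e1 j) ep0 pl ll oscF; rewrite EN -EFinM -EFinD lee_fin.
have sum1 : psum (fun c d => c0 * (F (gamma c) * chord gamma c d)) a l <=
    psum (fun c d => \sum_(j < m) F (gamma c) * crossing_length (circle_pt (j%:R * eta)) c d) a l.
  apply: psum_le_pall; apply: pall_imp (pall_and inb osc) => c d [[ac [cd db]] [cdl _]].
  have cD : cmod (gamma c) < 1 by apply: gD; lra.
  have Fc0 : 0 <= F (gamma c) by exact: F0.
  have [j [h1 h2]] := net (gamma c) (gamma d - gamma c) cD.
  have ch := Hdl c d ac (ltW cd) db cdl.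
  rewrite (bigD1 j)//= mulrCA -[leLHS]addr0; apply: lerD; last first.
    apply: sumr_ge0 => i _; apply: mulr_ge0 => //; apply: ri_ge0 => t _.
    by rewrite indicE; case: (_ \in _).
  rewrite ler_wpM2l// crossing_length_eq; [by rewrite -alongB| |]; first by apply: (le_trans h1); lra.
  have := along_le (gamma d - gamma c) (e1 j); rewrite alongB.
  have := Hdl c d ac (ltW cd) db cdl; rewrite /chord; move: h1; rewrite !ler_norml.
  by set x := along _ (gamma c); set y := along _ (gamma d); set q := cmod _; lra.
have sum2 : c0 * psum (fun c d => F (gamma c) * chord gamma c d) a l <= m%:R * (8 * L * n + 4 * kap * ep).
  rewrite -psumZ; apply: (le_trans sum1); rewrite psum_sum.
  apply: (@le_trans _ _ (\sum_(j < m) (8 * L * n + 4 * kap * ep))); first by apply: ler_sum => j _; exact: dir.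
  by rewrite sumr_const card_ord -[leLHS]mulr_natl.
have sum3 : psum (fun c d => F (gamma c) * chord gamma c d) a l <= m%:R * (8 * L * n + 4 * kap * ep) / c0.
  by rewrite ler_pdivlMr// mulrC.
apply: (@le_trans _ _ (m%:R * (8 * L) / c0 * n + ep * K)).
  apply: (@le_trans _ _ (m%:R * (8 * L * n + 4 * kap * ep) / c0 + ep * (len gamma a b + B))).
    by rewrite lerD2r.
  by rewrite /K le_eqVlt; apply/orP; left; apply/eqP; field; exact: lt0r_neq0.
rewrite lerD2l /ep mulrAC ler_pdivrMr// ler_wpM2l ?(ltW e0)//; lra.
Qed.

End ConvexCurveBound.

(** * Boundary homeomorphisms of the circle *)

Section CircleHomeomorphisms.
Context {R : realType}.
Implicit Types (z w xi : R[i]) (s t : R).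
Local Notation Re := (@complex.Re R).
Local Notation Im := (@complex.Im R).
Local Notation pi := (@pi R).
Local Notation mu := (@lebesgue_measure R).

Lemma within_cmod (A : set (Cplx R)) (f : Cplx R -> Cplx R) : {within A, continuous f} ->
  forall x, A x -> forall e, 0 < e -> exists2 dl, 0 < dl & forall y : R[i], A y -> cmod (y - x) < dl -> cmod (f y - f x) < e.
Proof.
move=> /subspace_continuousP H x Ax e e0; have /cvg_cmod /(_ e e0) := H x Ax.
by rewrite near_withinE => /nbhs_cmod [dl dl0 K]; exists dl => // y Ay yx; exact: K.
Qed.

Lemma within_itv (a b : R) (f : R -> Cplx R) : {within `[a, b], continuous f} -> ccont_on a b f.
Proof.
move=> /subspace_continuousP H x xab e e0; have /cvg_cmod /(_ e e0) : f y @[y --> within `[a, b] (nbhs x)] --> f x.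
  by apply: H; rewrite /= in_itv.
rewrite near_withinE => /nbhs_ballP [dl /= dl0 K]; exists dl => // y yab yx.
by apply: K; rewrite /= ?in_itv// /ball /= distrC.
Qed.

Lemma arc_dist_le s t : arc_dist (circle_pt s) (circle_pt t) <= `|s - t|.
Proof.
by apply: ge_inf; [exists 0 => _ [st _ <-]|exists (s, t)].
Qed.

Lemma chord_le_arc_dist xi eta : cmod xi = 1 -> cmod eta = 1 -> cmod (xi - eta) <= arc_dist xi eta.
Proof.
move=> x1 e1; apply: lb_le_inf.
  exists `|carg xi - carg eta|, (carg xi, carg eta) => //=.
  by split; [case: (circle_pt_carg x1)|case: (circle_pt_carg e1)].
by move=> _ [[s t] /= [<- <-] <-]; exact: chord_le.
Qed.

Lemma carg_circle_pt t : 0 <= t < 2 * pi -> carg (circle_pt t) = t.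
Proof.
move=> /andP[t0 t2]; have pp := @pi_gt0 R.
have cE x : clamp_acos (cos x) = acos (cos x) :> R.
  by rewrite /clamp_acos (min_idPr (cos_le1 _)) (max_idPr (cos_geN1 _)).
rewrite /carg /circle_pt /= cE; have [tp|tp] := leP t pi.
  rewrite sin_ge0_pi ?t0// mul1r subrr mul0r addr0 cosK// in_itv /= t0 tp.
  by [].
have st : sin t < 0.
  have -> : t = (t - pi) + pi by rewrite subrK.
  by rewrite sinDpi oppr_lt0 sin_gt0_pi//; lra.
rewrite leNgt st mul0r add0r subr0 mul1r.
have -> : cos t = cos (2 * pi - t).
  by have /(congr1 (@complex.Re R)) := circle_pt_periodic (- t); rewrite /= cosN addrC.
rewrite cosK ?in_itv /=; [ring|lra].
Qed.

Lemma measurable_angle (phi : R[i] -> R[i]) c d (f : R -> R[i]) :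
  (forall xi, cmod xi = 1 -> cmod (phi xi) = 1) ->
  (forall x, cmod x = 1 -> forall e : R, 0 < e ->
    exists2 dl : R, 0 < dl & forall y : R[i], cmod y = 1 -> cmod (y - x) < dl -> cmod (phi y - phi x) < e) ->
  (forall t, c <= t <= d -> cmod (f t) = 1) ->
  ccont_on c d f -> measurable_fun `[c, d] (fun t => carg (phi (f t))).
Proof.
move=> phi_circle phi_cont f1 fc; have pc : ccont_on c d (fun t => phi (f t)).
  move=> x xab e e0; have [d1 d10 H1] := phi_cont _ (f1 x xab) e e0.
  have [d2 d20 H2] := fc x xab d1 d10; exists d2 => // y yab yx.
  by apply: H1; [exact: f1|exact: H2].
apply: measurable_carg => //.
  have [] // := cont_on_bmf (ccont_on_lip (g := fun t => Re (phi (f t))) pc _).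
  by move=> x y; rewrite -cReB; exact: Re_cmod.
have [] // := cont_on_bmf (ccont_on_lip (g := fun t => Im (phi (f t))) pc _).
by move=> x y; rewrite -cImB; exact: Im_cmod.
Qed.

Variables (phi psi : R[i] -> R[i]) (L : R).
Hypothesis L1 : 1 <= L.
Hypothesis phi1 : forall xi, cmod xi = 1 -> cmod (phi xi) = 1.
Hypothesis psi1 : forall xi, cmod xi = 1 -> cmod (psi xi) = 1.
Hypothesis psiK : forall xi, cmod xi = 1 -> phi (psi xi) = xi.
Hypothesis phi_cont : forall x, cmod x = 1 -> forall e : R, 0 < e ->
    exists2 dl : R, 0 < dl & forall y : R[i], cmod y = 1 -> cmod (y - x) < dl -> cmod (phi y - phi x) < e.
Hypothesis psi_cont : forall x, cmod x = 1 -> forall e : R, 0 < e ->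
    exists2 dl : R, 0 < dl & forall y : R[i], cmod y = 1 -> cmod (y - x) < dl -> cmod (psi y - psi x) < e.
Hypothesis lip : circle_bilipschitz L phi.

Lemma carg_arc_dist xi eta : cmod xi = 1 -> cmod eta = 1 -> arc_dist xi eta <= `|carg xi - carg eta|.
Proof.
move=> x1 e1; have [Ex _] := circle_pt_carg x1; have [Ee _] := circle_pt_carg e1.
by rewrite -{1}Ex -{1}Ee; exact: arc_dist_le.
Qed.

(** The lower Lipschitz bound of phi, in the form in which the curve estimate
    uses it. *)
Lemma chord_le_angle xi eta : cmod xi = 1 -> cmod eta = 1 ->
  cmod (xi - eta) <= L * `|carg (phi xi) - carg (phi eta)|.
Proof.
move=> x1 e1; have l0 : 0 < L by have := L1; lra.
apply: (le_trans (chord_le_arc_dist x1 e1)).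
have /andP[h _] := lip x1 e1; rewrite ler_pdivrMl// in h.
by apply: (le_trans h); rewrite ler_wpM2l ?(ltW l0)//; apply: carg_arc_dist; exact: phi1.
Qed.

Lemma circle_pt_ccont c d : ccont_on c d (@circle_pt R).
Proof.
by move=> x _ e e0; exists e => // y _ yx; apply: le_lt_trans yx; exact: chord_le.
Qed.

(** Substitute G = W o b, where b is the angle of the inverse homeomorphism
    psi and W is the integrand on the right. Since phi is Lipschitz, b is
    expanding on each half circle, where chords are comparable to angles. *)
Lemma boundary_transport (G : R -> \bar R) : measurable_fun `[0, 2 * pi] G -> (forall t, (0 <= G t)%E) ->
  G (2 * pi) = G 0 ->
  (\int[mu]_(t in `[0%R, (2 * pi)%R]) G t <=
    (16 * L)%:E * \int[mu]_(t in `[0%R, (2 * pi)%R]) G (carg (phi (circle_pt t))))%E.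
Proof.
move=> mG G0 G2; have l1 := L1; have l0 : 0 < L by lra.
have pp := @pi_gt0 R; have p4 : pi <= 4 by have /andP[_] := @pihalf_02 R; lra.
pose W t := G (carg (phi (circle_pt t))).
have hin t : 0 <= carg (phi (circle_pt t)) <= 2 * pi.
  by have [] := circle_pt_carg (phi1 (circle_pt_cmod t)).
have mh := measurable_angle phi1 phi_cont (fun t (_ : 0 <= t <= 2 * pi) => circle_pt_cmod t) (@circle_pt_ccont 0 (2 * pi)).
have mW : measurable_fun `[0, 2 * pi] W.
  apply: (measurable_comp _ _ mG mh) => //.
  by move=> _ [s /= sk <-]; rewrite in_itv /= hin.
pose b s := carg (psi (circle_pt s)).
have bE s : circle_pt (b s) = psi (circle_pt s) by have [] := circle_pt_carg (psi1 (circle_pt_cmod s)).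
have bin s : 0 <= b s <= 2 * pi by have [] := circle_pt_carg (psi1 (circle_pt_cmod s)).
have mb (c d : R) : measurable_fun `[c, d] b.
  exact: (measurable_angle psi1 psi_cont (fun t _ => circle_pt_cmod t) (@circle_pt_ccont c d)).
have WG s : 0 <= s <= 2 * pi -> W (b s) = G s.
  move=> /andP[s0 s2]; rewrite /W bE psiK ?circle_pt_cmod//.
  move: s2; rewrite le_eqVlt => /orP[/eqP ->|s2]; last by rewrite carg_circle_pt// s0.
  by rewrite G2 circle_pt2pi -circle_pt0 carg_circle_pt// lexx mulr_gt0.
(* chords are comparable to angles only for angles that differ by at most pi *)
have half (c d : R) : 0 <= c -> d <= 2 * pi -> d - c <= pi ->
    (\int[mu]_(t in `[c, d]) G t <= (2 * (4 * L))%:E * \int[mu]_(t in `[0%R, (2 * pi)%R]) W t)%E.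
  move=> c0 d2 dc.
  have -> : (\int[mu]_(t in `[c, d]) G t = \int[mu]_(t in `[c, d]) W (b t))%E.
    apply: eq_integral => s; rewrite inE /= in_itv /= => /andP[cs sd].
    by rewrite WG// (le_trans c0 cs) (le_trans sd d2).
  apply: expanding_integral_on => //; [lra|lra| |by move=> t; exact: G0].
  move=> s s' /andP[cs sd] /andP[cs' sd'].
  apply: (le_trans (@chord_ge _ s s' _)); first by rewrite ler_norml; lra.
  rewrite -mulrA ler_wpM2l//; apply: (le_trans (chord_le_arc_dist (circle_pt_cmod s) (circle_pt_cmod s'))).
  have p1 := psi1 (circle_pt_cmod s); have p2 := psi1 (circle_pt_cmod s').
  have /andP[_] := lip p1 p2; rewrite !psiK ?circle_pt_cmod// => h; apply: (le_trans h).
  by rewrite ler_wpM2l ?(ltW l0)//; exact: carg_arc_dist.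
have E : `[0, 2 * pi]%classic = `[0, pi]%classic `|` `]pi, (2 * pi)]%classic :> set R.
  apply/seteqP; split => t /=; rewrite !in_itv /=.
    by move=> /andP[t0 t2]; have [tp|tp] := leP t pi; [left; rewrite t0|right].
  by case=> /andP[h1 h2]; lra.
rewrite [in leLHS]E ge0_integral_setU//; [|by rewrite -E|]; last first.
  by apply/disj_setPS => t /=; rewrite !in_itv /= => -[/andP[_ h1] /andP[h2 _]]; rewrite ltNge h1 in h2.
have -> : ((16 * L)%:E = (2 * (4 * L))%:E + (2 * (4 * L))%:E)%E by rewrite -EFinD; congr EFin; ring.
rewrite ge0_muleDl ?lee_fin; [|by rewrite !mulr_ge0// ltW..].
apply: leeD; first by apply: half => //; lra.
apply: (@le_trans _ _ (\int[mu]_(t in `[pi, (2 * pi)%R]) G t)%E); last by apply: half => //; lra.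
apply: ge0_subset_integral => //.
  by apply: measurable_funS mG => // t /=; rewrite !in_itv /= => /andP[h1 h2]; lra.
by move=> t /=; rewrite !in_itv /= => /andP[h1 h2]; rewrite (ltW h1).
Qed.

End CircleHomeomorphisms.

(** * The boundary function of a composition and the inequality *)

Section StoilowBoundary.
Context {R : realType}.
Implicit Types (z w xi : R[i]) (s t : R).
Local Notation pi := (@pi R).
Local Notation I := (ri 0 (2 * pi)).

Lemma hardy_circle_means (p : R) (g : R[i] -> R[i]) : 0 < p -> hardy p g ->
  (forall z, cmod z < 1 -> exists d, cderiv g z d) /\
  exists M, forall r : R, 0 < r < 1 -> I (fun t => cmod (g (r%:C * circle_pt t)) `^ p) <= M.
Proof.
move=> p0 [ga gh]; have gd z : cmod z < 1 -> exists d, cderiv g z d.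
  by move=> z1; apply: derivable_cderiv; exact: ga.
split => //; have H (r : R) : 0 < r < 1 -> ((I (fun t => cmod (g (r%:C * circle_pt t)) `^ p))%:E <= hardy_sup p g)%E.
  move=> r01; apply: ereal_sup_ubound; exists r => //.
  by rewrite /circle_integral ri_EFin//; exact: bm_disk_powR.
have fin : hardy_sup p g \is a fin_num.
  rewrite fin_numE gt_eqF ?lt_eqF//; apply: lt_le_trans (H (1 / 2) ltac:(lra)); exact: ltNyr.
by exists (fine (hardy_sup p g)) => r /H; rewrite -{1}(fineK fin) lee_fin.
Qed.

(** The cone hypothesis maps the approach region at xi into the one at
    phi(xi), and phi is continuous up to the boundary. *)
Lemma nt_boundary_comp (al be : R) (f g phi : R[i] -> R[i]) xi t (l : R[i]) : 1 < al -> cmod xi = 1 ->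
  (forall z, cmod z < 1 -> f z = g (phi z)) ->
  (forall e : R, 0 < e -> exists2 dl : R, 0 < dl & forall y : R[i], cmod y <= 1 -> cmod (y - xi) < dl -> cmod (phi y - phi xi) < e) ->
  phi @` stolz al xi `<=` stolz be (phi xi) -> circle_pt t = phi xi -> cntlim be g t l ->
  nt_boundary al f xi = l.
Proof.
move=> al1 x1 fg pc ps tE gl.
have [xE _] := circle_pt_carg x1.
have FF : ProperFilter (within (stolz al xi) (nbhs (xi : Cplx R))).
  apply: Build_ProperFilter_ex => P /nbhs_cmod [e e0 He].
  have [z [z1 zc] zd] := @cone_near R al (carg xi) e al1 e0; rewrite xE in zc zd.
  by exists z; apply: He => //; split.
rewrite /nt_boundary; apply: cvg_lim; first exact: norm_hausdorff.
apply/cvg_cmod => e e0; have [dl dl0 H] := gl e e0; have [eta eta0 K] := pc dl dl0.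
rewrite near_withinE; apply/nbhs_cmod; exists eta => // z zd zs.
have z1 : cmod z < 1 by case: zs.
have [w1 w2] : stolz be (phi xi) (phi z) by apply: ps; exists z.
rewrite fg//; apply: H; first by split => //; rewrite tE.
by rewrite tE; apply: K => //; exact: ltW.
Qed.

End StoilowBoundary.

Theorem theorem6p5 (R : realType) (p L alpha beta : R) :
  0 < p -> 1 <= L -> 1 < alpha -> 1 < beta ->
  exists A : R, forall K : R, 1 <= K ->
    forall f : Cplx R -> Cplx R, stoilow_class p K L alpha beta f ->
    forall (gamma : R -> Cplx R) (a b : R),
      convex_curve gamma a b -> gamma @` `[a, b] `<=` unit_disk ->
      (curve_integral gamma a b (fun z => (cmod (f z) `^ p)%R)
        <= A%:E * circle_integral
                    (fun xi => (cmod (nt_boundary alpha f xi) `^ p)%R))%E.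
Proof.
move=> p0 L1 al1 be1.
have [kap [kap0 kap1 kapal]] := cone_parameter al1.
have kap2 : kap < 1 by lra.
have [m [eta [c0 [c00 net]]]] := direction_net kap0 kap2.
set C1 := m%:R * (8 * L) / c0; set C2 := (8 * (1 + beta) ^+ 2) ^+ 2.
have C10 : 0 <= C1 by rewrite /C1 divr_ge0 ?(ltW c00)// mulr_ge0 ?ler0n//; lra.
have C20 : 0 <= C2 by exact: sqr_ge0.
exists (C1 * (C2 * (16 * L))) => K K1 f [g [phi [gh qc [phic homeo] [lip cones] fg]]] gamma a b.
move=> [ab gc rect simple [E [cE Ed gE]]] gD.
have [gd [M gM]] := hardy_circle_means p0 gh.
have [N [G [[mN mG] N0 Ncone IN [Z [mZ Z0 HZ]]]]] := hardy_ntmax p0 be1 gd gM.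
have pc := within_cmod phic.
have [_ phicirc [psi [psic psicirc phiK psiK]]] := homeo.
have phi1 (xi : R[i]) : cmod xi = 1 -> cmod (phi xi) = 1 by move=> x1; apply: phicirc; exists xi.
have psi1 (xi : R[i]) : cmod xi = 1 -> cmod (psi xi) = 1 by move=> x1; apply: psicirc; exists xi.
have psiK' (xi : R[i]) : cmod xi = 1 -> phi (psi xi) = xi by move=> x1; apply: psiK; rewrite inE.
have phi_cont (x : R[i]) : cmod x = 1 -> forall e : R, 0 < e -> exists2 dl : R, 0 < dl &
    forall y : R[i], cmod y = 1 -> cmod (y - x) < dl -> cmod (phi y - phi x) < e.
  move=> x1 e e0; have [|dl dl0 H] := pc x _ e e0; first by rewrite /closed_disk /= x1.
  by exists dl => // y y1; apply: H; rewrite /closed_disk /= y1.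
have psi_cont := within_cmod psic.
have phiD (z : R[i]) : cmod z < 1 -> cmod (phi z) < 1.
  by case: qc => -[_ h _] _ _ z1; apply: h; exists z.
pose H (xi : R[i]) : R := carg (phi xi).
pose F (z : R[i]) : R := cmod (f z) `^ p.
have HE (xi : R[i]) : cmod xi = 1 -> circle_pt (H xi) = phi xi /\ 0 <= H xi <= 2 * pi.
  by move=> x1; apply: circle_pt_carg; exact: phi1.
(* the cone hypothesis carries the cone at xi into the one at phi xi *)
have FN (xi z : R[i]) : cmod xi = 1 -> stolz alpha xi z -> ((F z)%:E <= N (H xi))%E.
  move=> x1 zs; have [z1 _] := zs; rewrite /F fg//; apply: Ncone.
  have [pE _] := HE xi x1; have [w1 w2] : stolz beta (phi xi) (phi z) by apply: cones => //; exists z.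
  by split => //; rewrite pE.
have F0 (z : R[i]) : cmod z < 1 -> 0 <= F z by move=> _; exact: powR_ge0.
have gD' t : a <= t <= b -> cmod (gamma t) < 1 by move=> tab; apply: gD; exists t => //; rewrite /= in_itv.
have gc' := within_itv gc.
have Fc : cont_on a b (fun t => F (gamma t)).
  move=> t tab e e0; have zt := gD' t tab.
  have [e1 e10 H1] := powR_cont p0 (cmod_ge0 (g (phi (gamma t)))) e0.
  have [d /cderiv_ccont gcc] := gd _ (phiD _ zt); have [e2 e20 H2] := gcc e1 e10.
  have [|e3 e30 H3] := pc (gamma t) _ e2 e20; first by rewrite /closed_disk /= ltW.
  have [e4 e40 H4] := gc' t tab e3 e30; exists e4 => // s sab st.
  have zs := gD' s sab; rewrite /F !fg//; apply: H1; first exact: cmod_ge0.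
  apply: le_lt_trans (cmod_dist _ _) _; apply: H2; apply: H3; last exact: H4.
  by rewrite /closed_disk /= ltW.
have LHS : (curve_integral gamma a b F <= C1%:E * \int[@lebesgue_measure R]_(t in `[0%R, (2 * pi)%R]) N t)%E.
  move: ab; rewrite le_eqVlt => /orP[/eqP aE|ab].
    rewrite /curve_integral [leLHS](_ : _ = 0%E); last first.
      rewrite -aE in rect *; have := len_a (lexx a) rect; rewrite /len => ->.
      by rewrite set_itv1 integral_set1.
    by rewrite mule_ge0 ?lee_fin//; apply: integral_ge0.
  apply: (@convex_curve_bound R gamma a b E ab rect gc' _ cE Ed _ gD' alpha kap L F H N) => //.
  - move=> s t as_ st tb gE'; have at0 := lt_trans as_ st; have sb := lt_trans st tb.
    suff /eqP : s = t by rewrite lt_eqF.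
    by case: simple => [inj|[_ inj]]; apply: (inj s t _ _ gE'); rewrite in_itv /= ?(ltW as_) ?(ltW at0) ?(ltW sb) ?(ltW tb) ?sb ?tb.
  - by move=> t tab; apply: gE; exists t => //; rewrite /= in_itv.
  - by move=> xi /HE[].
  - by move=> xi xi' x1 x1'; exact: chord_le_angle.
  - by move=> c d h h1 hc; exact: measurable_angle.
  - exact: net.
apply: (le_trans LHS).
have -> : ((C1 * (C2 * (16 * L)))%:E = C1%:E * (C2%:E * (16 * L)%:E))%E by rewrite -!EFinM.
rewrite -!muleA; apply: lee_wpmul2l; first by rewrite lee_fin.
apply: (le_trans IN); rewrite -/C2; apply: lee_wpmul2l; first by rewrite lee_fin.
(* Set G to 0 where it is not given by a limit, so that it can be compared with the
   boundary function of f at every point; 0 and 2 pi are one point of the circle and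
   are discarded as well. *)
set D := `[0, 2 * pi]%classic : set R.
pose X := Z `|` [set 0; 2 * pi] : set R.
have mX : measurable X by apply: measurableU => //; exact: measurableU.
have X0 : @lebesgue_measure R X = 0%E.
  have z0 (x : R) : @lebesgue_measure R [set x] = 0%E by rewrite lebesgue_measure_set1.
  by rewrite /X !measureU0//; [exact: measurableU|exact: z0|exact: z0].
pose Y := ~` X `&` D.
have mD : measurable D by exact: measurable_itv.
have mY : measurable Y by apply: measurableI => //; apply: measurableC.
pose G1 t : \bar R := (G t * (\1_Y t)%:E)%E.
have GY t : Y t -> exists2 l : R[i], cntlim beta g t l & G t = (cmod l `^ p)%:E.
  move=> [nX]; rewrite /D /= in_itv /= => tD; apply: HZ => // Zt; apply: nX; by left.
have G1Y t : Y t -> G1 t = G t by move=> Yt; rewrite /G1 indicE mem_set// mule1.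
have G1N t : ~ Y t -> G1 t = 0%E by move=> Yt; rewrite /G1 indicE memNset// mule0.
have G1ge0 t : (0 <= G1 t)%E.
  have [Yt|Yt] := pselect (Y t); last by rewrite G1N.
  by rewrite G1Y//; have [l _ ->] := GY t Yt; rewrite lee_fin powR_ge0.
have mG1 : measurable_fun D G1.
  by apply: emeasurable_funM => //; apply/measurable_EFinP; exact: measurable_indic.
have -> : (\int[@lebesgue_measure R]_(t in D) G t = \int[@lebesgue_measure R]_(t in D) G1 t)%E.
  apply: ae_eq_integral => //; exists X; split => // t /= /not_implyP [Dt ne].
  by apply: contrapT => nX; apply: ne; rewrite G1Y.
have G1end : G1 (2 * pi) = G1 0.
  by rewrite !G1N// => -[h _]; apply: h; right; [left|right].
apply: (le_trans (boundary_transport L1 phi1 psi1 psiK' phi_cont psi_cont lip mG1 G1ge0 G1end)).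
apply: lee_wpmul2l; first by rewrite lee_fin; lra.
rewrite /circle_integral; apply: le_integral_ge0 => // t _; have c1 := circle_pt_cmod t; have [pE _] := HE _ c1.
have [Yt|Yt] := pselect (Y (H (circle_pt t))); last by rewrite G1N// lee_fin powR_ge0.
rewrite -/(H _) G1Y//; have [l gl ->] := GY _ Yt.
rewrite (nt_boundary_comp al1 c1 fg _ (cones _ c1) pE gl)//.
have c1' : cmod (circle_pt t) <= 1 by rewrite c1.
exact: (pc _ c1').
Qed.
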